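(* Consider the first-price auction with prescreening, with $m\ge2$ potential bidders, $n\in\{2,\dots,m\}$ admitted bidders and predictor $F$. Define, for $\tilde v_i,v_i\in[0,1]$, $$\mathrm{FP}(\tilde v_i,v_i;n,F)=h(\tilde v_i\mid v_i;n,F)\,[v_i-\tilde v_i]+H(\tilde v_i\mid v_i;n,F)\Big[\int_0^{\tilde v_i}L(x\mid\tilde v_i;n,F)dx\Big]\Big[\frac{h(\tilde v_i\mid v_i;n,F)}{H(\tilde v_i\mid v_i;n,F)}-\frac{h(\tilde v_i\mid\tilde v_i;n,F)}{H(\tilde v_i\mid\tilde v_i;n,F)}\Big],$$ where $L(x\mid v;n,F)=\exp\big(-\int_x^{v}\mathrm{RHR}(t;n,F)\,dt\big)$ for $x\in[0,v]$. (i) An SSM equilibrium strategy exists if, for every $v_i\in[0,1]$, $\mathrm{FP}(\tilde v_i,v_i;n,F)\ge0$ for all $\tilde v_i\in[0,v_i]$ and $\mathrm{FP}(\tilde v_i,v_i;n,F)\le0$ for all $\tilde v_i\in[v_i,1]$. This condition is always satisfied under the null predictor, under the perfect predictor, and when all bidders are admitted ($n=m$). (ii) If an SSM equilibrium strategy exists, it is unique and is given by $$\sigma^{\mathrm{FP}}(v_i;n,F)=v_i-\int_0^{v_i}\exp\Big(-\int_t^{v_i}\mathrm{RHR}(x;n,F)\,dx\Big)dt,\qquad v_i\in[0,1].$$ (iii) Under the perfect predictor (PP) the equilibrium strategy is independent of the number of admitted bidders: for every $n\in\{2,\dots,m\}$, $$\sigma^{\mathrm{FP}}(v_i;n,\mathrm{PP})=v_i-\int_0^{v_i}\frac{F_1(x)^{m-1}}{F_1(v_i)^{m-1}}\,dx,\qquad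 v_i\in[0,1],$$ and this also equals $\sigma^{\mathrm{FP}}(v_i;m,F)$ (all bidders admitted) for any predictor $F$ with valuation marginal $F_1$.
   Context: Model. There are $m\ge2$ risk-neutral potential bidders. The valuation–signal pairs $(V_i,S_i)\in[0,1]^2$ are independent across bidders with common joint CDF $F$ (the ''predictor''), whose marginal CDFs $F_1$ (valuations) and $F_2$ (signals) have strictly positive densities $f_1,f_2$ on $[0,1]$; $F_{2\mid1}(s\mid v)=\Pr(S_i\le s\mid V_i=v)$. Standing assumption: $\mathbb E[V_i\mid S_i=s]$ is non-decreasing in $s$. The seller commits ex ante to $n$ and admits the $n$ bidders with the highest signals (equivalently highest $\mathbb E[V_i\mid S_i]$). Bidders know only their own valuation and the admitted set. The admitted valuations have joint density $g(v;n,F)=\binom mn\psi(v;n,F)\prod_{j=1}^nf_1(v_j)$, $v\in[0,1]^n$, where $\psi(v;n,F)=\int_0^1\prod_{k=1}^n[1-F_{2\mid1}(x\mid v_k)]\,d(F_2(x)^{m-n})$ for $n<m$ and $\psi\equiv1$ for $n=m$. An admitted bidder with valuation $v_i$ has belief $g(v_{-i}\mid v_i;n,F)$ (conditional density) about the other admitted valuations. Let $$H(x\mid v_i;n,F)=\int_{[0,x]^{n-1}}g(v_{-i}\mid v_i;n,F)\,dv_{-i},\quad h=\frac{\partial H}{\partial x},\quad\mathrm{RHR}(x;n,F)=\frac{h(x\mid x;n,F)}{H(x\mid x;n,F)}.$$ Perfect predictor: $F(v,s)=\min\{F_1(v),F_2(s)\}$. Null predictor: $F(v,s)=F_1(v)F_2(s)$.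 First-price auction: highest bidder wins the item and pays her bid; others pay nothing. An SSM (symmetric strictly monotone) equilibrium strategy is a differentiable strictly increasing $\sigma:[0,1]\to\mathbb R_+$ such that for every $v_i\in[0,1]$, $\sigma(v_i)$ maximizes $\Pr\{\sigma(V_j)<b_i\ \forall j\neq i\}\,(v_i-b_i)$ over $b_i\in\mathbb R_+$, with $V_{-i}$ having density $g(\cdot\mid v_i;n,F)$.
   Formalization: F_1 has derivative f_1 on [0,1]; for n<m, F_{2|1} is weakly continuous in v and each v>0 can be admitted. In (i), first sentence, σ is differentiable on (0,1], and at 0 if RHR/(f_1/F_1) has a limit at 0 (it can fail otherwise); the three named cases give all of [0,1]. *)

(* Defs.v *)
From HB Require Import structures.
From mathcomp Require Import all_boot all_order all_algebra.
From mathcomp Require Import all_classical all_reals all_analysis.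

Set Implicit Arguments.
Unset Strict Implicit.
Unset Printing Implicit Defensive.

Import Order.TTheory GRing.Theory Num.Theory.
Import numFieldNormedType.Exports.

Local Open Scope classical_set_scope.
Local Open Scope ring_scope.

(* Derivative of a function on [0, 1]: the difference quotient is taken inside
   [0, 1], hence one-sided at 0 and at 1. *)
Definition is_deriv01 (R : realType) (f : R -> R) (x l : R) : Prop :=
  (f y - f x) / (y - x) @[y --> within `[0, 1] x^'] --> l.

Definition deriv01 (R : realType) (f : R -> R) (x : R) : R :=
  lim ((f y - f x) / (y - x) @[y --> within `[0, 1] x^']).

(* [iint k A f] is the integral of f over A^k, as an iterated integral; f is only
   evaluated at sequences of length k. *)
Fixpoint iint (R : realType) (k : nat) (A : set R) (f : seq R -> R) : R :=
  if k is k'.+1 then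
    \int[@lebesgue_measure R]_(x in A) iint k' A (fun w => f (x :: w))
  else f [::].

(* A joint law of (valuation, signal). *)
Definition jointCDF (R : realType) (P : probability (R * R)%type R) (v s : R) : R :=
  fine (P (`]-oo, v] `*` `]-oo, s])).

HB.instance Definition _ (R : realType) :=
  isMeasurableFun.Build _ _ (R * R)%type R fst measurable_fst.

HB.instance Definition _ (R : realType) :=
  isMeasurableFun.Build _ _ (R * R)%type R snd measurable_snd.

Definition margCDF1 (R : realType) (P : probability (R * R)%type R) (v : R) : R :=
  fine (cdf (fst : {RV P >-> R}) v).

Definition margCDF2 (R : realType) (P : probability (R * R)%type R) (s : R) : R :=
  fine (cdf (snd : {RV P >-> R}) s).

(* e is a version of s |-> E[V | S = s]. *)
Definition is_condexp (R : realType) (P : probability (R * R)%type R) (e : R -> R)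
    : Prop :=
  measurable_fun setT e /\
  forall B : set R, measurable B ->
    (\int[P]_(x in snd @^-1` B) (x.1)%:E = \int[P]_(x in snd @^-1` B) (e x.2)%:E)%E.

(* The valuation density f1 is the derivative of F1 at every point of [0, 1]: this
   selects a version of the density, and is what makes h exist pointwise when n = m.
   [sigker] is a regular conditional law of S given V (a choice of version, see
   [regular] below). *)
Record predictor (R : realType) := Predictor {
  law : probability (R * R)%type R ;
  f1 : R -> R ;
  f2 : R -> R ;
  sigker : R.-pker R ~> R ;
  law_support : law (`[0, 1] `*` `[0, 1]) = 1%E ;
  f1_gt0 : forall v : R, v \in `[0, 1] -> 0 < f1 v ;
  f2_gt0 : forall s : R, s \in `[0, 1] -> 0 < f2 s ;
  measurable_f1 : measurable_fun (`[0, 1] : set R) f1 ;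
  measurable_f2 : measurable_fun (`[0, 1] : set R) f2 ;
  f1_density : forall A : set R, measurable A ->
    law (fst @^-1` A) =
    (\int[@lebesgue_measure R]_(v in A `&` `[0%R, 1%R]) (f1 v)%:E)%E ;
  f2_density : forall A : set R, measurable A ->
    law (snd @^-1` A) =
    (\int[@lebesgue_measure R]_(s in A `&` `[0%R, 1%R]) (f2 s)%:E)%E ;
  f1_deriv : forall v : R, v \in `[0, 1] -> is_deriv01 (margCDF1 law) v (f1 v) ;
  sigker_support : forall v : R, v \in `[0, 1] -> sigker v (`[0, 1]%classic : set R) = 1%E ;
  sigker_law : forall A B : set R, measurable A -> measurable B ->
    law (A `*` B) = (\int[law]_(x in fst @^-1` A) sigker x.1 B)%E ;
  condexp_nondecreasing : exists e : R -> R, is_condexp law e /\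
    forall s t : R, s \in `[0, 1] -> t \in `[0, 1] -> s <= t -> e s <= e t
}.

Definition F12 (R : realType) (P : predictor R) : R -> R -> R := jointCDF (law P).
Definition F1 (R : realType) (P : predictor R) : R -> R := margCDF1 (law P).
Definition F2 (R : realType) (P : predictor R) : R -> R := margCDF2 (law P).

(* F_{2|1}(s | v) *)
Definition F21 (R : realType) (P : predictor R) (s v : R) : R :=
  fine (sigker P v `]-oo, s]%classic).

Definition perfect_predictor (R : realType) (P : predictor R) : Prop :=
  forall v s : R, v \in `[0, 1] -> s \in `[0, 1] ->
    F12 P v s = Num.min (F1 P v) (F2 P s).

Definition null_predictor (R : realType) (P : predictor R) : Prop :=
  forall v s : R, v \in `[0, 1] -> s \in `[0, 1] -> F12 P v s = F1 P v * F2 P s.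

(* Conditional laws are unique only up to null sets of v, whereas beliefs are used
   at every v.  [weak_continuity] selects the (unique) version depending weakly
   continuously on v, i.e. F_{2|1}(s | .) is continuous at v0 whenever s is not an
   atom of the law of S given V = v0; for the perfect predictor this version is
   F_{2|1}(s | v) = 1{F1 v <= F2 s}.  [nondegenerate] says that a bidder with v > 0
   is admitted with positive probability, so that her belief, a conditional density
   given v, is defined. *)
Record regular (R : realType) (P : predictor R) : Prop := Regular {
  weak_continuity : forall v0 s : R, v0 \in `[0, 1] ->
    {for s, continuous (fun x => F21 P x v0)} ->
    F21 P s v @[v --> within `[0, 1] (nbhs v0)] --> F21 P s v0 ;
  nondegenerate : forall v : R, v \in `]0, 1] -> F21 P 0 v < 1
}.

Definition F2pow (R : realType) (P : predictor R) (k : nat) (s : R) : R := F2 P s ^+ k.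

Lemma F2_nondecreasing (R : realType) (P : predictor R) : nondecreasing (F2 P).
Proof.
by move=> s t st; rewrite fine_le ?fin_num_measure//; exact: cdf_nondecreasing.
Qed.

Lemma F2_right_continuous (R : realType) (P : predictor R) : right_continuous (F2 P).
Proof.
move=> s; apply: fine_cvg; rewrite fineK ?fin_num_measure//.
exact: cdf_right_continuous.
Qed.

Lemma F2pow_nondecreasing (R : realType) (P : predictor R) (k : nat) :
  nondecreasing (F2pow P k).
Proof.
move=> s t st; rewrite /F2pow lerXn2r ?nnegrE ?fine_ge0//.
exact: F2_nondecreasing.
Qed.

Lemma F2pow_right_continuous (R : realType) (P : predictor R) (k : nat) :
  right_continuous (F2pow P k).
Proof.
move=> s; rewrite /F2pow; elim: k => [|k IH].
  by rewrite expr0; under eq_fun do rewrite expr0; exact: cvg_cst.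
rewrite exprS; under eq_fun do rewrite exprS.
by apply: cvgM => //; exact: F2_right_continuous.
Qed.

HB.instance Definition _ (R : realType) (P : predictor R) (k : nat) :=
  isCumulative.Build R _ R (F2pow P k)
    (@F2pow_nondecreasing R P k) (@F2pow_right_continuous R P k).

(* psi and g are meant for sequences v of length n with entries in [0, 1]. *)
Definition psi (R : realType) (m n : nat) (P : predictor R) (v : seq R) : R :=
  if (n < m)%N then
    \int[lebesgue_stieltjes_measure (F2pow P (m - n))]_(x in `[0, 1])
      \prod_(y <- v) (1 - F21 P x y)
  else 1.

Definition g (R : realType) (m n : nat) (P : predictor R) (v : seq R) : R :=
  'C(m, n)%:R * psi m n P v * \prod_(y <- v) f1 P y.

(* Density of w = v_{-i} given v_i = v; by symmetry of g the index i is irrelevant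
   and v_i is put first.  When the marginal density of v_i vanishes at v (e.g. at
   v = 0 under the perfect predictor) this is 0 by the convention x / 0 = 0; bidders
   of this type then have a constant payoff. *)
Definition belief (R : realType) (m n : nat) (P : predictor R) (v : R) (w : seq R)
    : R :=
  g m n P (v :: w) / iint n.-1 `[0, 1] (fun u => g m n P (v :: u)).

Definition H (R : realType) (m n : nat) (P : predictor R) (x v : R) : R :=
  iint n.-1 `[0, x] (belief m n P v).

Definition h (R : realType) (m n : nat) (P : predictor R) (x v : R) : R :=
  deriv01 (fun y => H m n P y v) x.

Definition RHR (R : realType) (m n : nat) (P : predictor R) (x : R) : R :=
  h m n P x x / H m n P x x.

(* RHR is not integrable at 0: the exponent is an extended real and L(0 | v) = 0. *)
Definition L (R : realType) (m n : nat) (P : predictor R) (x v : R) : R :=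
  fine (expeR (- \int[@lebesgue_measure R]_(t in `[x, v]) (RHR m n P t)%:E)).

Definition FP (R : realType) (m n : nat) (P : predictor R) (x v : R) : R :=
  h m n P x v * (v - x) +
  H m n P x v * (\int[@lebesgue_measure R]_(t in `[0, x]) L m n P t x) *
    (h m n P x v / H m n P x v - h m n P x x / H m n P x x).

Definition FP_condition (R : realType) (m n : nat) (P : predictor R) : Prop :=
  forall v : R, v \in `[0, 1] ->
    (forall x : R, x \in `[0, v] -> 0 <= FP m n P x v) /\
    (forall x : R, x \in `[v, 1] -> FP m n P x v <= 0).

Definition sigmaFP (R : realType) (m n : nat) (P : predictor R) (v : R) : R :=
  v - \int[@lebesgue_measure R]_(t in `[0, v]) L m n P t v.

Definition win_prob (R : realType) (m n : nat) (P : predictor R) (sigma : R -> R)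
    (v b : R) : R :=
  iint n.-1 `[0, 1]
    (fun w => (all (fun y => sigma y < b) w)%:R * belief m n P v w).

Definition payoff (R : realType) (m n : nat) (P : predictor R) (sigma : R -> R)
    (v b : R) : R :=
  win_prob m n P sigma v b * (v - b).

(* Symmetric strictly monotone equilibrium strategy of the first-price auction,
   differentiable at the points of D. *)
Record SSM_on (R : realType) (D : set R) (m n : nat) (P : predictor R)
    (sigma : R -> R) : Prop := SSMOn {
  SSM_ge0 : forall v : R, v \in `[0, 1] -> 0 <= sigma v ;
  SSM_increasing : forall v w : R, v \in `[0, 1] -> w \in `[0, 1] ->
    v < w -> sigma v < sigma w ;
  SSM_derivable : forall v, D v -> exists l, is_deriv01 sigma v l ;
  SSM_best_reply : forall v : R, v \in `[0, 1] -> forall b, 0 <= b ->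
    payoff m n P sigma v b <= payoff m n P sigma v (sigma v)
}.

(* Differentiable on the whole of [0, 1], with one-sided derivatives at 0 and 1. *)
Definition SSM (R : realType) (m n : nat) (P : predictor R) (sigma : R -> R) : Prop :=
  SSM_on `[0, 1] m n P sigma.

(* Differentiable on ]0, 1]; continuity at 0 is automatic as 0 <= sigma v <= v. *)
Definition SSM0 (R : realType) (m n : nat) (P : predictor R) (sigma : R -> R) : Prop :=
  SSM_on `]0, 1] m n P sigma.

(* RHR, relative to the reversed hazard rate f1 / F1 of a single valuation, has a
   limit (possibly infinite) at 0.  Without this, RHR may oscillate log-periodically
   near 0, and then sigmaFP has no derivative at 0 although it is an equilibrium
   strategy. *)
Definition RHR_regular_at0 (R : realType) (m n : nat) (P : predictor R) : Prop :=
  exists c : \bar R,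
    (RHR m n P t / (f1 P t / F1 P t))%:E @[t --> 0^'+] --> c.

(* Main.v *)
(* Write n = k + 2, and let mu be the law of the cutoff signal. Conditionally on
   the cutoff s the admitted valuations are independent, bidder y being admitted
   with probability q s y = 1 - F21 s y. With G s x = int_0^x q s y f1 y dy,
     H(x | v) = K x v / K 1 v   where K x v = int_mu q s v * G s x ^ (k + 1),
   and h, RHR follow by differentiating under the integral sign. With the discount
   factor E' = RHR * E, the first-order condition sigma' = RHR * (v - sigma) reads
   (E * (v - sigma))' = E, which gives uniqueness and the formula for sigma. For
   that sigma, the derivative in x of the payoff H(x | v) (v - sigma x) is FP x v.

   Under the null predictor and when n = m, q does not depend on y, and the bracket
   in FP vanishes. Under the perfect predictor q s y = 1{F2 s < F1 y}, and
   J_a(x) = int_mu q s x * G s x ^ a satisfies J_(a+1)' = (a + 1) f1 J_a, whence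
   J_a is a multiple of F1 ^ (a + m - n), and RHR = (m - 1) f1 / F1, E = F1 ^ (m - 1). *)
From HB Require Import structures.
Require Import Defs.
From mathcomp Require Import all_boot all_order all_algebra.
From mathcomp Require Import all_classical all_reals all_analysis measurable_realfun.
From mathcomp Require Import ring lra zify.

Set Implicit Arguments.
Unset Strict Implicit.
Unset Printing Implicit Defensive.

Import Order.TTheory GRing.Theory Num.Theory.
Import numFieldNormedType.Exports.
Local Open Scope classical_set_scope.
Local Open Scope ring_scope.

(** The difficulties sit at valuation 0 and at exceptional cutoffs. RHR is not integrable at 0, so
    the discount factor is normalised at 1, the differential equation is solved on ]0, 1], and the
    missing initial condition is replaced by the squeeze 0 <= sigma v <= v. Differentiability of
    sigma at 0 is a separate question, about the limit of int_0^v E / (v * E v). The density f1 is a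
    pointwise derivative and may be discontinuous, so derivatives are taken against increments of
    F1, and it is RHR / f1 that is shown to be continuous on ]0, 1]. For fixed x, continuity of q s
    at x may fail at atoms s of the law of S given V = x. The cutoff law has no atoms, so such s
    form a null set, and identities in s are kept almost everywhere. The null and perfect cases are
    assumptions on the joint CDF only: q is recovered by differentiating G s = F1 - F12(., s). As n
    = m involves no cutoff, the auction is studied for an abstract pair (mu, q) that covers n < m
    and n = m alike. *)

Notation punct01 x := (within `[0, 1] (dnbhs x)).

(** * One-sided calculus on [0, 1] *)

Section calculus01.
Context {R : realType}.
Implicit Types (f g : R -> R) (x y l : R).

Lemma punct01_proper x : x \in `[0, 1] -> ProperFilter (punct01 x).
Proof.
move=> x01; apply: Build_ProperFilter_ex => P [e /= e0 eP].
move: x01; rewrite in_itv/= => /andP[x0 x1].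
(* The nearby point is x + d in the left half of [0, 1] and x - d in the right half; d <= 1/4 keeps
   it inside. *)
pose d := Num.min (e / 2) (1 / 4).
have d0 : 0 < d by rewrite lt_min; apply/andP; split; lra.
have de : d < e by rewrite gt_min; apply/orP; left; lra.
have d4 : d <= 1 / 4 by rewrite ge_min lexx orbT.
have [xh|xh] := leP x (1 / 2).
  exists (x + d); apply: eP => /=.
  - by rewrite opprD addNKr normrN gtr0_norm.
  - by rewrite gt_eqF// ltrDl.
  - rewrite in_itv/=; apply/andP; split; lra.
exists (x - d); apply: eP => /=.
- by rewrite opprB addrC subrK gtr0_norm.
- by rewrite lt_eqF// ltrBlDr ltrDl.
- rewrite in_itv/=; apply/andP; split; lra.
Qed.

Lemma near_punct01 x (P : set R) :
  (forall y, y \in `[0, 1] -> y != x -> P y) -> \forall y \near punct01 x, P y.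
Proof. by move=> h; exists 1 => //= y _ yx y01; exact: h. Qed.

Lemma near_punct01_ball x (e : R) (P : set R) : 0 < e ->
  (forall y, y \in `[0, 1] -> y != x -> `|y - x| < e -> P y) ->
  \forall y \near punct01 x, P y.
Proof. by move=> e0 h; exists e => //= y yx yx' y01; apply: h; rewrite // distrC. Qed.

Lemma cvg_within_punct01 (T : topologicalType) (f : R -> T) x (l : T) :
  f y @[y --> within `[0, 1] (nbhs x)] --> l -> f y @[y --> punct01 x] --> l.
Proof.
move=> fl A /fl [e e0 eA]; exists e => //= y yx yx' y01; exact: eA.
Qed.

(** Dominated convergence speaks of sequences; this transfers it to the punctured filter. *)
Lemma cvg_punct01P f x l : f y @[y --> punct01 x] --> l <->
  (forall u : R^nat, (forall n, u n \in `[0, 1] /\ u n != x) ->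
    u n @[n --> \oo] --> x -> f (u n) @[n --> \oo] --> l).
Proof.
split=> [fl u uin ux|h].
  apply: cvg_comp fl => A [e /= e0 eA].
  have [N _ hN] := (cvgrPdist_lt _ _).1 ux e e0.
  exists N => // k /hN uk; have [u01 ukx] := uin k; exact: eA.
apply: contrapT => fl.
have [e [e0 he]] : exists e : R, 0 < e /\ forall d : R, 0 < d ->
    exists y, [/\ y \in `[0, 1], y != x, `|x - y| < d & e <= `|l - f y|].
  apply: contrapT => H; apply: fl; apply/cvgrPdist_lt => e e0.
  apply: contrapT => H'; apply: H; exists e; split => // d d0.
  apply: contrapT => H''; apply: H'; exists d => //= y yd yx y01.
  rewrite ltNge; apply/negP => ley; apply: H''; exists y; split => //.
pose w n := sval (cid (he n.+1%:R^-1 (ltac:(by rewrite invr_gt0)))).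
have wP n : [/\ w n \in `[0, 1], w n != x, `|x - w n| < n.+1%:R^-1 &
    e <= `|l - f (w n)|] by rewrite /w; case: cid.
have wx : w n @[n --> \oo] --> x.
  apply/cvgrPdist_lt => d d0.
  have /cvgrPdist_lt/(_ d d0)[N _ hN] := @cvg_harmonic R.
  exists N => // k /hN; rewrite /= sub0r normrN gtr0_norm ?invr_gt0// => kd.
  by have [_ _ wk _] := wP k; exact: lt_trans kd.
have /cvgrPdist_lt/(_ e e0)[N _ hN] := h w (fun n => let: And4 a b _ _ := wP n in conj a b) wx.
by have [_ _ _] := wP N; rewrite leNgt (hN N (leqnn N)).
Qed.

Lemma is_deriv01_cvg f x l : is_deriv01 f x l -> f y @[y --> punct01 x] --> f x.
Proof.
move=> fl; rewrite -[X in _ --> X]addr0 -[X in _ --> _ + X](mulr0 l).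
have : f x + (f y - f x) / (y - x) * (y - x) @[y --> punct01 x] --> f x + l * 0.
  apply: cvgD; first exact: cvg_cst.
  apply: cvgM => //.
  rewrite -(subrr x); apply: cvgB; last exact: cvg_cst.
  by move=> A [e e0 eA]; exists e => //= y yx _ _; exact: eA.
apply: cvg_trans; apply: near_eq_cvg; apply: near_punct01 => y _ yx.
by rewrite divfK ?subr_eq0// addrC subrK.
Qed.

Lemma is_deriv01_unique f x l1 l2 : x \in `[0, 1] ->
  is_deriv01 f x l1 -> is_deriv01 f x l2 -> l1 = l2.
Proof. by move=> x01 h1 h2; have pf := punct01_proper x01; exact: (cvg_unique _ h1 h2). Qed.

Lemma deriv01E f x l : x \in `[0, 1] -> is_deriv01 f x l -> deriv01 f x = l.
Proof. by move=> x01 ?; have pf := punct01_proper x01; exact/cvg_lim. Qed.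

Lemma eq_is_deriv01 g f x l : x \in `[0, 1] -> {in `[0, 1], f =1 g} ->
  is_deriv01 f x l -> is_deriv01 g x l.
Proof.
move=> x01 fg; apply: cvg_trans; apply: near_eq_cvg.
by apply: near_punct01 => y y01 _; rewrite !fg.
Qed.

Lemma near_eq_is_deriv01 g f x l (e : R) : 0 < e -> f x = g x ->
  (forall y, y \in `[0, 1] -> `|y - x| < e -> f y = g y) ->
  is_deriv01 f x l -> is_deriv01 g x l.
Proof.
move=> e0 fgx fg; apply: cvg_trans; apply: near_eq_cvg.
by apply: (near_punct01_ball e0) => y y01 _ yx; rewrite fgx fg.
Qed.

Lemma is_deriv01_cst c x : is_deriv01 (fun=> c) x 0.
Proof.
by apply: cvg_near_cst; apply: near_punct01 => y _ _; rewrite subrr mul0r.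
Qed.

Lemma is_deriv01_id x : is_deriv01 id x 1.
Proof.
by apply: cvg_near_cst; apply: near_punct01 => y _ yx; rewrite divff// subr_eq0.
Qed.

Lemma is_deriv01D f g x a b : is_deriv01 f x a -> is_deriv01 g x b ->
  is_deriv01 (fun y => f y + g y) x (a + b).
Proof.
move=> fa gb.
have : (f y - f x) / (y - x) + (g y - g x) / (y - x) @[y --> punct01 x] --> a + b.
  exact: cvgD.
apply: cvg_trans; apply: near_eq_cvg.
by apply: near_punct01 => y _ _; rewrite /= -mulrDl; congr (_ / _); ring.
Qed.

Lemma is_deriv01M f g x a b : is_deriv01 f x a -> is_deriv01 g x b ->
  is_deriv01 (fun y => f y * g y) x (a * g x + f x * b).
Proof.
move=> fa gb.
have : (f y - f x) / (y - x) * g x + f y * ((g y - g x) / (y - x))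
    @[y --> punct01 x] --> a * g x + f x * b.
  apply: cvgD; first by apply: cvgM => //; exact: cvg_cst.
  by apply: cvgM => //; exact: is_deriv01_cvg fa.
apply: cvg_trans; apply: near_eq_cvg.
by apply: near_punct01 => y _ yx; rewrite mulrAC mulrA -mulrDl; congr (_ / _); ring.
Qed.

Lemma is_deriv01Z c f x a : is_deriv01 f x a -> is_deriv01 (fun y => c * f y) x (c * a).
Proof.
move=> fa; have := is_deriv01M (@is_deriv01_cst c x) fa.
by rewrite mul0r add0r.
Qed.

Lemma is_deriv01N f x a : is_deriv01 f x a -> is_deriv01 (fun y => - f y) x (- a).
Proof.
move=> /(@is_deriv01Z (-1)); rewrite mulN1r.
by under [X in is_deriv01 X]eq_fun do rewrite mulN1r.
Qed.

Lemma is_deriv01B f g x a b : is_deriv01 f x a -> is_deriv01 g x b ->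
  is_deriv01 (fun y => f y - g y) x (a - b).
Proof. by move=> fa /is_deriv01N; exact: is_deriv01D. Qed.

Lemma is_deriv01X f x a n : is_deriv01 f x a ->
  is_deriv01 (fun y => f y ^+ n.+1) x (n.+1%:R * f x ^+ n * a).
Proof.
move=> fa; elim: n => [|n IH].
  by rewrite expr0 !mul1r; under [X in is_deriv01 X]eq_fun do rewrite expr1.
under [X in is_deriv01 X]eq_fun do rewrite exprS.
have := is_deriv01M fa IH; congr is_deriv01.
by rewrite [n.+2%:R]mulrS [f x ^+ n.+1]exprS; ring.
Qed.

Lemma is_deriv01V f x a : f x != 0 -> is_deriv01 f x a ->
  is_deriv01 (fun y => (f y)^-1) x (- (a / f x ^+ 2)).
Proof.
move=> fx fa.
have fc := is_deriv01_cvg fa.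
have : - ((f y - f x) / (y - x) / (f y * f x)) @[y --> punct01 x] --> - (a / f x ^+ 2).
  apply: cvgN; apply: cvgM => //; apply: cvgV; first by rewrite mulf_neq0.
  by rewrite expr2; apply: cvgM => //; exact: cvg_cst.
apply: cvg_trans; apply: near_eq_cvg; near=> y.
have fy : f y != 0.
  near: y; have [e0 h] : 0 < `|f x| /\ True by split; rewrite // normr_gt0.
  have /cvgrPdist_lt/(_ _ e0) := fc; apply: filterS => y.
  by apply: contraTneq => ->; rewrite subr0 ltxx.
have -> : (f y)^-1 - (f x)^-1 = - (f y - f x) / (f y * f x) by field; rewrite fy fx.
by ring.
Unshelve. all: by end_near. Qed.

Lemma is_deriv01_comp (phi : R -> R) f x a d : is_derive (f x) 1 phi d ->
  is_deriv01 f x a -> is_deriv01 (fun y => phi (f y)) x (d * a).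
Proof.
move=> phid fa; have fc := is_deriv01_cvg fa.
(* Carathéodory's form of the derivative: the quotient is completed by d at f x, which avoids
   dividing by f y - f x when f y = f x. *)
pose psi z := if z == f x then d else (phi z - phi (f x)) / (z - f x).
have psic : psi z @[z --> f x] --> psi (f x).
  rewrite {2}/psi eqxx; apply/cvgrPdist_lt => e e0.
  have [phi1 phi2] := phid.
  have : h^-1 *: ((phi \o shift (f x)) (h *: 1) - phi (f x)) @[h --> 0^'] --> d.
    by rewrite -phi2; exact: phi1.
  move=> /cvgrPdist_lt/(_ e e0)[r /= r0 hr]; exists r => //= z zr.
  rewrite /psi; case: eqP => [_|/eqP zx]; first by rewrite subrr normr0.
  have := hr (z - f x); rewrite /= sub0r normrN distrC => /(_ zr).
  rewrite subr_eq0 => /(_ zx); rewrite [_%:A]mulr1 subrK.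
  by rewrite [_ *: _]mulrC.
have : psi (f y) * ((f y - f x) / (y - x)) @[y --> punct01 x] --> psi (f x) * a.
  by apply: cvgM => //; exact: cvg_comp psic.
rewrite {2}/psi eqxx; apply: cvg_trans; apply: near_eq_cvg.
apply: near_punct01 => y _ yx; rewrite /psi; case: eqP => [->|/eqP fyx].
  by rewrite !subrr !mul0r mulr0.
by rewrite mulrA divfK// subr_eq0.
Qed.

Lemma is_deriv01_is_derive f x l : x \in `]0, 1[ -> is_deriv01 f x l ->
  is_derive x 1 f l.
Proof.
rewrite in_itv/= => /andP[x0 x1] fl.
have key : h^-1 *: ((f \o shift x) (h *: 1) - f x) @[h --> 0^'] --> l.
  apply/cvgrPdist_lt => e e0.
  have /cvgrPdist_lt/(_ e e0)[r /= r0 hr] := fl.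
  near=> h.
  have h0 : h != 0 by near: h; exact: nbhs_dnbhs_neq.
  have hd : `|h| < Num.min r (Num.min x (1 - x)).
    by near: h; apply: dnbhs0_lt; rewrite !lt_min r0 x0 subr_gt0.
  move: hd; rewrite !lt_min => /and3P[h1 h2 h3].
  have := hr (x + h); rewrite /= opprD addNKr normrN h1 => /(_ isT).
  have -> : (x + h != x) by rewrite -subr_eq0 addrAC subrr add0r.
  move=> /(_ isT); rewrite in_itv/=.
  have -> : (0 <= x + h <= 1).
    move: h2 h3; rewrite !ltr_norml => /andP[? ?] /andP[? ?]; apply/andP; split; lra.
  move=> /(_ isT); rewrite (_ : x + h - x = h); last by ring.
  by rewrite [_%:A]mulr1 [_ *: _]mulrC (addrC h).
split; first by apply/cvg_ex; exists l.
exact: cvg_lim key.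
Unshelve. all: by end_near. Qed.

Lemma punct01_continuous f (a b : R) : 0 <= a -> b <= 1 ->
  (forall x, x \in `[a, b] -> f y @[y --> punct01 x] --> f x) ->
  {within `[a, b], continuous f}.
Proof.
move=> a0 b1 fc; 
apply/subspace_continuousP => x xab; apply/cvgrPdist_lt => e e0.
have /fc/cvgrPdist_lt/(_ e e0)[r /= r0 hr] : x \in `[a, b] by [].
exists r => //= y yr yab; have [->|yx] := eqVneq y x; first by rewrite subrr normr0.
apply: hr => //; move: yab; rewrite /= !in_itv/= => /andP[? ?]; apply/andP; split; lra.
Qed.

Lemma MVT01 f (df : R -> R) (a b : R) : 0 <= a -> a < b -> b <= 1 ->
  (forall x, x \in `]a, b[ -> is_deriv01 f x (df x)) ->
  (forall x, x \in `[a, b] -> f y @[y --> punct01 x] --> f x) ->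
  exists2 c, c \in `]a, b[ & f b - f a = df c * (b - a).
Proof.
move=> a0 ab b1 fd fc; apply: MVT => //; last exact: punct01_continuous.
move=> x xab; apply: is_deriv01_is_derive; last exact: fd.
move: xab; rewrite !in_itv/= => /andP[? ?]; apply/andP; split; lra.
Qed.

Lemma deriv01_nondecreasing f (df : R -> R) (a b : R) : 0 <= a -> a <= b -> b <= 1 ->
  (forall x, x \in `]a, b[ -> is_deriv01 f x (df x)) ->
  (forall x, x \in `]a, b[ -> 0 <= df x) ->
  (forall x, x \in `[a, b] -> f y @[y --> punct01 x] --> f x) ->
  f a <= f b.
Proof.
move=> a0; rewrite le_eqVlt => /predU1P[<-//|ab] b1 fd df0 fc.
have [c cab E] := MVT01 a0 ab b1 fd fc.
by rewrite -subr_ge0 E mulr_ge0 ?df0// subr_ge0 ltW.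
Qed.

Lemma deriv01_increasing f (df : R -> R) (a b : R) : 0 <= a -> a < b -> b <= 1 ->
  (forall x, x \in `]a, b[ -> is_deriv01 f x (df x)) ->
  (forall x, x \in `]a, b[ -> 0 < df x) ->
  (forall x, x \in `[a, b] -> f y @[y --> punct01 x] --> f x) ->
  f a < f b.
Proof.
move=> a0 ab b1 fd df0 fc.
have [c cab E] := MVT01 a0 ab b1 fd fc.
by rewrite -subr_gt0 E mulr_gt0 ?df0// subr_gt0.
Qed.

Lemma deriv01_cst f (a b : R) : 0 <= a -> a <= b -> b <= 1 ->
  (forall x, x \in `]a, b[ -> is_deriv01 f x 0) ->
  (forall x, x \in `[a, b] -> f y @[y --> punct01 x] --> f x) ->
  f a = f b.
Proof.
move=> a0; rewrite le_eqVlt => /predU1P[<-//|ab] b1 fd fc.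
have [c cab] := MVT01 a0 ab b1 fd fc.
by rewrite mul0r => /eqP; rewrite subr_eq0 => /eqP.
Qed.

End calculus01.

(** * Integration *)

(* Lebesgue and Lebesgue-Stieltjes measures live on [measurableTypeR R], whose
   display is not the default one of [R]: they are transported to the default
   display, where products and kernels over [R] are available. *)
Section retype.
Context {R : realType}.
Import HBNNSimple.

Definition ocitv_nnsfun (h : {nnsfun R >-> R}) : measurableTypeR R -> R := h.

HB.instance Definition _ h := isMeasurableFun.Build _ _ (measurableTypeR R) R (ocitv_nnsfun h)
  (@measurable_funPT _ _ _ _ h).

HB.instance Definition _ h := FiniteImage.Build (measurableTypeR R) R (ocitv_nnsfun h)
  (@fimfunP _ _ h).

HB.instance Definition _ h := isNonNegFun.Build (measurableTypeR R) R (ocitv_nnsfun h)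
  (@fun_ge0 _ _ h).

Definition std_nnsfun (h : {nnsfun measurableTypeR R >-> R}) : R -> R := h.

HB.instance Definition _ h := isMeasurableFun.Build _ _ R R (std_nnsfun h)
  (@measurable_funPT _ _ _ _ h).

HB.instance Definition _ h := FiniteImage.Build R R (std_nnsfun h)
  (@fimfunP _ _ h).

HB.instance Definition _ h := isNonNegFun.Build R R (std_nnsfun h)
  (@fun_ge0 _ _ h).

(** Both integrals are differences of suprema over simple functions, and the two displays have the
    same simple functions. *)
Lemma integral_ocitv (mu : {measure set R -> \bar R})
    (nu : {measure set (measurableTypeR R) -> \bar R}) (D : set R) (f : R -> \bar R) :
  (forall A, mu A = nu A) ->
  (\int[nu]_(x in D) f x = \int[mu]_(x in D) f x)%E.
Proof.
move=> munu; have E : (nu : set R -> \bar R) = mu by apply/funext => A; rewrite munu.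
rewrite /integral; congr (_ - _)%E; congr ereal_sup; apply/seteqP; split => _ [h /= hf <-].
- by exists (std_nnsfun h) => //; rewrite -[in LHS]E.
- by exists (ocitv_nnsfun h) => //; rewrite -[in RHS]E.
- by exists (std_nnsfun h) => //; rewrite -[in LHS]E.
- by exists (ocitv_nnsfun h) => //; rewrite -[in RHS]E.
Qed.

End retype.

Definition leb (R : realType) : set R -> \bar R := @lebesgue_measure R.
Arguments leb {R}.

Section leb.
Context {R : realType}.

Let leb0 : leb (set0 : set R) = 0%E. Proof. exact: (measure0 (@lebesgue_measure R)). Qed.

Let leb_ge0 (A : set R) : (0 <= leb A)%E. Proof. exact: (measure_ge0 (@lebesgue_measure R)). Qed.

Let leb_sigma_additive : semi_sigma_additive (@leb R).
Proof. by move=> A mA tA mU; exact: (@measure_semi_sigma_additive _ _ _ (@lebesgue_measure R)). Qed.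

HB.instance Definition _ := isMeasure.Build _ _ _ (@leb R) leb0 leb_ge0 leb_sigma_additive.

Let leb_sigma_finite : sigma_finite setT (@leb R).
Proof. exact: (@sigma_finiteT _ _ _ (@lebesgue_measure R)). Qed.

HB.instance Definition _ := Measure_isSigmaFinite.Build _ _ _ (@leb R) leb_sigma_finite.

Lemma lebE (D : set R) (f : R -> \bar R) : (\int[@lebesgue_measure R]_(x in D) f x = \int[leb]_(x in D) f x)%E.
Proof. exact: integral_ocitv. Qed.

Lemma leb_RintegralE (D : set R) (f : R -> R) : \int[@lebesgue_measure R]_(x in D) f x = \int[leb]_(x in D) f x.
Proof. by rewrite /Rintegral lebE. Qed.

Lemma leb_integrableE (D : set R) (f : R -> \bar R) : leb.-integrable D f -> (@lebesgue_measure R).-integrable D f.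
Proof.
move=> /integrableP[mf fi]; apply/integrableP; split; first exact: mf.
by move: fi; rewrite -lebE.
Qed.

End leb.

Section bounded_integration.
Context d (T : measurableType d) {R : realType} (mu : {finite_measure set T -> \bar R}).

Lemma bounded_integrable (f : T -> R) (C : R) : measurable_fun setT f ->
  (forall s, `|f s| <= C) -> mu.-integrable setT (EFin \o f).
Proof.
move=> mf fC.
apply: (le_integrable measurableT (g := EFin \o cst C)).
- exact/measurable_EFinP.
- by move=> s _; rewrite /= lee_fin (le_trans (fC s))// ler_norm.
- exact: finite_measure_integrable_cst.
Qed.

Lemma dct_seq (phi : nat -> T -> R) (psi : T -> R) (C : R) :
  (forall k, measurable_fun setT (phi k)) -> measurable_fun setT psi ->
  (forall k s, `|phi k s| <= C) ->
  {ae mu, forall s, phi k s @[k --> \oo] --> psi s} ->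
  \int[mu]_s phi k s @[k --> \oo] --> \int[mu]_s psi s.
Proof.
move=> mphi mpsi phiC phipsi.
have [] := @dominated_convergence _ _ _ mu setT measurableT
   (fun k s => (phi k s)%:E) (EFin \o psi) (EFin \o cst C).
- by move=> k; exact/measurable_EFinP.
- exact/measurable_EFinP.
- by apply: filterS phipsi => s h _; apply: cvg_EFin => //; exact: nearW.
- exact: finite_measure_integrable_cst.
- by apply: aeW => s k _; rewrite lee_fin.
move=> ipsi _ h; apply: fine_cvg; rewrite fineK//.
exact: integrable_fin_num.
Qed.

Lemma dct_punct01 (phi : R -> T -> R) (psi : T -> R) (x C : R) :
  (forall y, measurable_fun setT (phi y)) -> measurable_fun setT psi ->
  (\forall y \near punct01 x, forall s, `|phi y s| <= C) ->
  {ae mu, forall s, phi y s @[y --> punct01 x] --> psi s} ->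
  \int[mu]_s phi y s @[y --> punct01 x] --> \int[mu]_s psi s.
Proof.
move=> mphi mpsi [e /= e0 phiC] phipsi.
apply/cvg_punct01P => u uin ux.
have [N _ hN] := (cvgrPdist_lt _ _).1 ux e e0.
(* The domination holds only within distance e of x, hence the shift past the first N terms. *)
rewrite -(cvg_shiftn N); apply: (dct_seq (C := C)) => //.
- move=> k s; have [u01 ukx] := uin (k + N)%N.
  by apply: phiC => //; apply: hN; exact: leq_addl.
- apply: filterS phipsi => s /cvg_punct01P/(_ u uin ux).
  by rewrite -(cvg_shiftn N).
Qed.

(** A vanishing integral would force f = 0 almost everywhere and make B negligible. *)
Lemma Rintegral_gt0 (f : T -> R) (C : R) (B : set T) : measurable_fun setT f ->
  (forall s, 0 <= f s <= C) -> measurable B -> (0 < mu B)%E ->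
  (forall s, B s -> 0 < f s) -> 0 < \int[mu]_s f s.
Proof.
move=> mf fC mB B0 fB.
have f0 s : 0 <= f s by have /andP[] := fC s.
have fi : mu.-integrable setT (EFin \o f).
  by apply: (bounded_integrable (C := C)) => // s; rewrite ger0_norm//; case/andP: (fC s).
rewrite lt_neqAle Rintegral_ge0// andbT; apply/eqP => /esym E.
have E0 : (\int[mu]_s `|(f s)%:E| = 0)%E.
  under eq_integral do rewrite gee0_abs ?lee_fin//.
  by rewrite -[LHS]fineK -/(Rintegral _ _ _) ?E//; exact: integrable_fin_num.
have := (ae_eq_integral_abs mu measurableT (f := EFin \o f) _).1 E0.
move=> /(_ (ltac:(exact/measurable_EFinP))) [N [mN N0 hN]].
have : (mu B <= mu N)%E.
  apply: le_measure; rewrite ?inE// => s Bs; apply: hN => /= /(_ I) [fs].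
  by have := fB s Bs; rewrite fs ltxx.
by rewrite N0 leNgt B0.
Qed.

Lemma ae_eq_Rintegral (f g : T -> R) : measurable_fun setT f ->
  measurable_fun setT g -> {ae mu, forall s, f s = g s} ->
  \int[mu]_s f s = \int[mu]_s g s.
Proof.
move=> mf mg fg; congr fine; apply: ae_eq_integral => //.
- exact/measurable_EFinP.
- exact/measurable_EFinP.
- by apply: filterS fg => s -> _.
Qed.

End bounded_integration.

(** * Primitives of a density on [0, 1], possibly weighted *)

Section density01.
Context {R : realType}.
Notation leb := (@leb R).

(** The integral form serves domination and Tonelli, the pointwise derivative serves h; no
    continuity of f relates the two here. *)
Record density01 (f F : R -> R) : Prop := Density01 {
  density_ge0 : forall x, x \in `[0, 1] -> 0 <= f x ;
  density_integrable : leb.-integrable `[0, 1] (EFin \o f) ;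
  density_primitive : forall x, x \in `[0, 1] -> F x = \int[leb]_(t in `[0, x]) f t ;
  density_deriv : forall x, x \in `[0, 1] -> is_deriv01 F x (f x) }.

Variables (f F : R -> R) (fF : density01 f F).

Lemma weighted_integrable (w : R -> R) (C : R) : measurable_fun (`[0, 1] : set R) w ->
  (forall t, t \in `[0, 1] -> `|w t| <= C) ->
  leb.-integrable `[0, 1] (EFin \o (fun t : R => w t * f t)).
Proof.
move=> mw wC; have fi := density_integrable fF.
apply: (le_integrable _ _ _ (integrableZl _ C fi)) => //.
- apply/measurable_EFinP; apply: measurable_funM => //.
  by move/integrableP : fi => [mf _]; exact/measurable_EFinP.
- move=> t t01; rewrite /= lee_fin !normrM ler_wpM2r//.
  exact: le_trans (wC t t01) (ler_norm _).
Qed.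

Lemma sub_itv01 (a b : itv_bound R) : (BLeft 0 <= a)%O -> (b <= BRight 1)%O ->
  [set` Interval a b] `<=` `[0, 1].
Proof. by move=> a0 b1; apply: subset_itv. Qed.

Lemma primitive_itvB (p : R -> R) (a b : R) : leb.-integrable `[0, 1] (EFin \o p) ->
  0 <= a -> a <= b -> b <= 1 ->
  \int[leb]_(t in `[0, b]) p t - \int[leb]_(t in `[0, a]) p t = \int[leb]_(t in `]a, b]) p t.
Proof.
move=> pi a0 ab b1.
have -> : `[0, b]%classic = `[0, a] `|` `]a, b].
  by rewrite -itv_bndbnd_setU// bnd_simp.
rewrite Rintegral_setU//; first by rewrite addrC addKr.
- apply: integrableS pi => //; first exact: measurableU.
  by rewrite subUset; split; apply: sub_itv01; rewrite bnd_simp// (le_trans ab).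
- by apply/disj_setPS => t [/=]; rewrite !in_itv/= => /andP[_ ta] /andP[]; rewrite ltNge ta.
Qed.

(** Freezing the weight at a constant c costs at most its oscillation times the mass of f on ]a,
    b]. *)
Lemma weighted_increment (w : R -> R) (C c e a b : R) : measurable_fun (`[0, 1] : set R) w ->
  (forall t, t \in `[0, 1] -> `|w t| <= C) ->
  0 <= a -> a <= b -> b <= 1 -> (forall t, t \in `]a, b] -> `|w t - c| <= e) ->
  `|\int[leb]_(t in `[0, b]) (w t * f t) - \int[leb]_(t in `[0, a]) (w t * f t)
    - c * (F b - F a)| <= e * (F b - F a).
Proof.
move=> mw wC a0 ab b1 we.
have wi := weighted_integrable mw wC.
have fi := density_integrable fF.
have sub : `]a, b] `<=` `[0, 1] by apply: sub_itv01; rewrite bnd_simp.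
have wi' : leb.-integrable `]a, b] (EFin \o (fun t : R => w t * f t)) by apply: integrableS wi.
have fi' : leb.-integrable `]a, b] (EFin \o f) by apply: integrableS fi.
have ci k : leb.-integrable `]a, b] (EFin \o (fun t : R => k * f t)) by exact: (integrableZl _ k fi').
rewrite !(density_primitive fF); last 2 first.
- by rewrite in_itv/= a0 (le_trans ab).
- by rewrite in_itv/= b1 (le_trans a0).
have Zf k : k * (\int[leb]_(t in `]a, b]) f t) = \int[leb]_(t in `]a, b]) (k * f t).
  by rewrite RintegralZl.
rewrite (primitive_itvB wi a0 ab b1) (primitive_itvB fi a0 ab b1) (Zf c) (Zf e).
rewrite -(RintegralB _ wi' (ci c))//.
have di : leb.-integrable `]a, b] (EFin \o (fun t => w t * f t - c * f t)).
  exact: integrableB wi' (ci c).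
apply: (le_trans (le_normr_Rintegral _ di)) => //.
apply: le_Rintegral => //.
  exact: (integrable_abse di).
move=> t tab; rewrite -mulrBl normrM (ger0_norm (x := f t)) ?ler_wpM2r ?we//.
- by rewrite (density_ge0 fF)//; apply: sub.
- by rewrite (density_ge0 fF)//; apply: sub.
Qed.

(** A fundamental theorem in which only the weight is continuous at x: the increment of the integral
    is w x * (F y - F x) up to o(F y - F x), and the quotient of F converges by assumption. *)
Lemma weighted_deriv01 (w : R -> R) (C x : R) : measurable_fun (`[0, 1] : set R) w ->
  (forall t, t \in `[0, 1] -> `|w t| <= C) -> x \in `[0, 1] ->
  w y @[y --> punct01 x] --> w x ->
  is_deriv01 (fun y => \int[leb]_(t in `[0, y]) (w t * f t)) x (w x * f x).
Proof.
move=> mw wC x01 wx.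
pose W y := \int[leb]_(t in `[0, y]) (w t * f t).
have Fx := density_deriv fF x01.
have wFx : w x * ((F y - F x) / (y - x)) @[y --> punct01 x] --> w x * f x.
  by apply: cvgM => //; exact: cvg_cst.
rewrite /is_deriv01 -[X in _ --> X]addr0.
have : w x * ((F y - F x) / (y - x)) +
    ((W y - W x) - w x * (F y - F x)) / (y - x) @[y --> punct01 x] --> w x * f x + 0.
  apply: cvgD => //; apply/cvgrPdist_le => e e0.
  have f1 : 0 < f x + 1 by rewrite ltr_wpDl// (density_ge0 fF).
  (* Near x the quotient of F is at most f x + 1 in absolute value, so this tolerance on w yields e
     on the quotient. *)
  have e1 : 0 < e / (f x + 1) by rewrite divr_gt0.
  have [r /= r0 hr] := (cvgrPdist_le _ _).1 wx _ e1.
  have [r' /= r'0 hr'] := (cvgrPdist_le _ _).1 Fx _ ltr01.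
  exists (Num.min r r') => /=; first by rewrite lt_min r0.
  move=> y /= + yx y01; rewrite lt_min => /andP[yr yr'].
  rewrite sub0r normrN normrM normfV.
  have key : `|W y - W x - w x * (F y - F x)| <= e / (f x + 1) * `|F y - F x|.
    move: (x01) (y01); rewrite !in_itv/= => /andP[x0 x1] /andP[y0 y1].
    have [xy|yx'] := leP x y.
      have [Fxy] : 0 <= F y - F x /\ true.
        split => //; rewrite !(density_primitive fF)// primitive_itvB//; last exact: density_integrable fF.
        apply: Rintegral_ge0 => t; rewrite /= in_itv/= => /andP[? ?].
        apply: (density_ge0 fF); rewrite in_itv/=; apply/andP; split; lra.
      move=> _; rewrite (ger0_norm Fxy); apply: (weighted_increment mw wC) => //.
      move=> t; rewrite in_itv/= => /andP[xt ty]; rewrite distrC; apply: hr => /=.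
      - rewrite distrC gtr0_norm ?subr_gt0//; move: yr.
        rewrite distrC ger0_norm ?subr_ge0//; lra.
      - by rewrite gt_eqF.
      - rewrite in_itv/=; apply/andP; split; lra.
    have [Fxy] : 0 <= F x - F y /\ true.
      split => //; rewrite !(density_primitive fF)// primitive_itvB//; [|exact: density_integrable fF|exact: ltW].
      apply: Rintegral_ge0 => t; rewrite /= in_itv/= => /andP[? ?].
      apply: (density_ge0 fF); rewrite in_itv/=; apply/andP; split; lra.
    move=> _; rewrite (distrC (F y)) (ger0_norm Fxy).
    rewrite [X in `|X|](_ : _ = - (W x - W y - w x * (F x - F y))); last by ring.
    rewrite normrN; apply: (weighted_increment mw wC) => //; first exact: ltW.
    move=> t; rewrite in_itv/= => /andP[yt tx]; rewrite distrC.
    have [->|tx'] := eqVneq t x; first by rewrite subrr normr0 ltW.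
    apply: hr => //=.
    - rewrite ger0_norm ?subr_ge0//; move: yr.
      rewrite ger0_norm ?subr_ge0// ?ltW//; lra.
    - rewrite in_itv/=; apply/andP; split; lra.
  have yx0 : 0 < `|y - x| by rewrite normr_gt0 subr_eq0.
  rewrite ler_pdivrMr//; apply: (le_trans key).
  rewrite -ler_pdivlMl ?divr_gt0// invf_div mulrA divfK ?gt_eqF//.
  have := hr' y yr' yx y01; rewrite distrC => h.
  have : `|(F y - F x) / (y - x)| <= f x + 1.
    rewrite -(subrK (f x) (_ / _)); apply: (le_trans (ler_normD _ _)).
    by rewrite addrC (ger0_norm (density_ge0 fF x01)) lerD2l.
  by rewrite normrM normfV ler_pdivrMr.
apply: cvg_trans; apply: near_eq_cvg; apply: near_punct01 => y _ yx.
by rewrite /W; field; rewrite subr_eq0.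
Qed.

End density01.

(** * Iterated integrals of mixtures of product densities *)

Section mixture.
Context {R : realType}.
Notation leb := (@leb R).

Lemma iintS k (A : set R) (f : seq R -> R) :
  iint k.+1 A f = \int[leb]_(x in A) iint k A (fun w => f (x :: w)).
Proof. exact: leb_RintegralE. Qed.

Lemma eq_iint k (A : set R) (f g : seq R -> R) :
  (forall w, size w = k -> {in w, forall y, A y} -> f w = g w) ->
  iint k A f = iint k A g.
Proof.
elim: k f g => [|k IH] f g fg; first exact: fg.
rewrite !iintS; apply: eq_Rintegral => x; rewrite inE => Ax; apply: IH => w wk wA.
by apply: fg => [|y]; rewrite /= ?wk// inE => /predU1P[->//|/wA].
Qed.

Variables (mu : {finite_measure set R -> \bar R}) (q : R -> R -> R).
Hypothesis mq : measurable_fun setT (fun z : R * R => q z.1 z.2).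
Hypothesis q01 : forall s y, 0 <= q s y <= 1.

Lemma measurable_mix y : measurable_fun setT (fun s => q s y).
Proof. by have h := measurableT_comp mq (pair2_measurable y); exact: h. Qed.

Lemma measurable_mixr s : measurable_fun setT (fun y => q s y).
Proof. by have h := measurableT_comp mq (pair1_measurable s); exact: h. Qed.

Lemma measurable_mixC : measurable_fun setT (fun z : R * R => q z.2 z.1).
Proof. by have h := measurableT_comp mq (@measurable_swap _ _ R R); exact: h. Qed.

Let q0 s y : 0 <= q s y. Proof. by case/andP: (q01 s y). Qed.

Let q1 s y : q s y <= 1. Proof. by case/andP: (q01 s y). Qed.

Section weight.
Variables (A : set R) (p : R -> R).
Hypotheses (mA : measurable A) (p0 : forall y, A y -> 0 <= p y)
  (pi : leb.-integrable A (EFin \o p)).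

Definition mixprim s := \int[leb]_(y in A) (q s y * p y).

(** Extension by zero, so that Tonelli applies on the whole line. *)
Let p' := p \_ A.

Let p'0 y : 0 <= p' y.
Proof. by rewrite /p' patchE; case: ifPn => // /set_mem/p0. Qed.

Let mp' : measurable_fun setT p'.
Proof.
move/integrableP : pi => [/measurable_EFinP mp _].
exact/(measurable_restrictT _ mA).
Qed.

Let pi' : leb.-integrable setT (EFin \o p').
Proof. by rewrite /p' -restrict_EFin; apply/(integrable_mkcond _ mA). Qed.

Let qpi s : leb.-integrable setT (EFin \o (fun y => q s y * p' y)).
Proof.
apply: (le_integrable measurableT _ _ pi').
- by apply/measurable_EFinP; apply: measurable_funM => //; exact: measurable_mixr.
- move=> y _; rewrite /= lee_fin normrM !ger0_norm//.
  by rewrite ler_piMl.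
Qed.

Lemma mixprimE s : mixprim s = \int[leb]_y (q s y * p' y).
Proof.
rewrite /mixprim Rintegral_mkcond; congr Rintegral; apply/funext => y.
by rewrite /p' !patchE; case: ifPn => // _; rewrite mulr0.
Qed.

Lemma mixprim_ge0 s : 0 <= mixprim s.
Proof. by rewrite mixprimE; apply: Rintegral_ge0 => y _; rewrite mulr_ge0. Qed.

Lemma mixprim_le s : mixprim s <= \int[leb]_(y in A) p y.
Proof.
rewrite mixprimE [leRHS]Rintegral_mkcond.
apply: (le_Rintegral (f2 := p') measurableT (qpi s) pi') => y _.
by rewrite ler_piMl.
Qed.

Let F (z : R * R) := (q z.2 z.1 * p' z.1)%:E.

Let mF : measurable_fun setT F.
Proof.
apply/measurable_EFinP; apply: measurable_funM.
  exact: measurable_mixC.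
exact: measurableT_comp.
Qed.

Lemma measurable_mixprim : measurable_fun setT mixprim.
Proof.
have -> : mixprim = fine \o (fun s => \int[leb]_y F (y, s))%E.
  by apply/funext => s; rewrite mixprimE.
apply: measurableT_comp => //.
by apply: (measurable_fun_fubini_tonelli_G F mF) => z; rewrite lee_fin mulr_ge0.
Qed.

(** Tonelli exchanges the cutoff with the valuation of one bidder. *)
Lemma mix_swap (chi : R -> R) (C : R) : measurable_fun setT chi ->
  (forall s, 0 <= chi s <= C) ->
  \int[leb]_(y in A) (p y * \int[mu]_s (chi s * q s y)) =
  \int[mu]_s (chi s * mixprim s).
Proof.
move=> mchi chiC.
have chi0 s : 0 <= chi s by case/andP: (chiC s).
have qchii y : mu.-integrable setT (EFin \o (fun s => chi s * q s y)).
  apply: (@bounded_integrable _ _ _ mu _ C).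
    by apply: measurable_funM => //; exact: measurable_mix.
  move=> s; rewrite ger0_norm ?mulr_ge0//.
  by rewrite (le_trans _ (proj2 (andP (chiC s))))// ler_piMr.
rewrite Rintegral_mkcond /Rintegral.
transitivity (fine (\int[leb]_y \int[mu]_s (chi s * q s y * p' y)%:E)%E).
  congr fine; apply: eq_integral => y _.
  transitivity ((\int[mu]_s (chi s * q s y) * p' y)%:E).
    by congr EFin; rewrite /p' !patchE; case: ifPn => _; rewrite ?mulr0// mulrC.
  rewrite -RintegralZr//; rewrite /Rintegral fineK//.
  apply: integrable_fin_num => //.
  have := integrableZr measurableT (p' y) (qchii y).
  by apply: eq_integrable.
rewrite (fubini_tonelli (fun z => (chi z.2 * q z.2 z.1 * p' z.1)%:E)); last 2 first.
- apply/measurable_EFinP; apply: measurable_funM; last exact: measurableT_comp.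
  apply: measurable_funM; first exact: measurableT_comp.
  exact: measurable_mixC.
- by move=> z; rewrite lee_fin !mulr_ge0.
congr fine; apply: eq_integral => s _ /=.
rewrite mixprimE -RintegralZl// /Rintegral.
under [in LHS]eq_integral do rewrite -mulrA.
rewrite fineK//; apply: integrable_fin_num => //.
have := integrableZl measurableT (chi s) (qpi s).
by apply: eq_integrable.
Qed.

End weight.

(** Given s the bidders are independent, so k integrations produce the k-th power of one of them.
    [phi] and [c] are generalised because peeling off a bidder of valuation y multiplies them by q s
    y and p y. *)
Lemma iint_mixture (A : set R) (p : R -> R) (k : nat) : measurable A ->
  (forall y, A y -> 0 <= p y) -> leb.-integrable A (EFin \o p) ->
  forall (phi : R -> R) (C c : R), measurable_fun setT phi ->
  (forall s, 0 <= phi s <= C) -> 0 <= c ->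
  iint k A (fun w => c * (\int[mu]_s (phi s * \prod_(y <- w) q s y)) * \prod_(y <- w) p y) =
  c * \int[mu]_s (phi s * mixprim A p s ^+ k).
Proof.
move=> mA p0 pi; elim: k => [|k IH] phi C c mphi phiC c0.
  rewrite /= big_nil mulr1; congr (_ * _); apply: eq_Rintegral => s _.
  by rewrite big_nil.
have phi0 s : 0 <= phi s by case/andP: (phiC s).
rewrite iintS.
transitivity (\int[leb]_(y in A)
    (c * (p y * \int[mu]_s ((phi s * mixprim A p s ^+ k) * q s y)))).
  apply: eq_Rintegral => y; rewrite inE => Ay.
  transitivity (c * p y * \int[mu]_s (phi s * q s y * mixprim A p s ^+ k)).
    rewrite -(IH _ C); last 3 first.
    - by apply: measurable_funM => //; exact: measurable_mix.
    - move=> s; rewrite mulr_ge0//=.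
      by rewrite (le_trans _ (proj2 (andP (phiC s))))// ler_piMr.
    - by rewrite mulr_ge0// p0.
    apply: eq_iint => w _ _; rewrite big_cons.
    under eq_Rintegral do rewrite big_cons mulrA.
    by ring.
  by rewrite -mulrA; congr (_ * (_ * _)); apply: eq_Rintegral => s _; rewrite mulrAC.
have G0 := mixprim_ge0 p0; have GI := mixprim_le mA p0 pi.
have mG := measurable_mixprim mA p0 pi.
have chiC s : 0 <= phi s * mixprim A p s ^+ k <= C * (\int[leb]_(y in A) p y) ^+ k.
  rewrite mulr_ge0 ?exprn_ge0//= ler_pM ?exprn_ge0//.
    by case/andP: (phiC s).
  by rewrite lerXn2r ?nnegrE// (le_trans (G0 s)).
have mchi : measurable_fun setT (fun s => phi s * mixprim A p s ^+ k).
  by apply: measurable_funM => //; exact: measurable_funX.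
have c' s : 0 <= c * (phi s * mixprim A p s ^+ k) <= c * (C * (\int[leb]_(y in A) p y) ^+ k).
  by case/andP: (chiC s) => ? ?; rewrite mulr_ge0//= ler_wpM2l.
have mc : measurable_fun setT (fun s => c * (phi s * mixprim A p s ^+ k)).
  by apply: measurable_funM.
have bi (f : R -> R) C' : measurable_fun setT f -> (forall s, 0 <= f s <= C') ->
    mu.-integrable setT (EFin \o f).
  move=> mf fC; apply: (@bounded_integrable _ _ _ mu _ C' mf) => s.
  by case/andP: (fC s) => ? ?; rewrite ger0_norm.
transitivity (\int[leb]_(y in A)
    (p y * \int[mu]_s ((c * (phi s * mixprim A p s ^+ k)) * q s y))).
  apply: eq_Rintegral => y _; rewrite mulrCA; congr (_ * _).
  rewrite -RintegralZl//; first by apply: eq_Rintegral => s _; rewrite !mulrA.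
  apply: (bi _ (C * (\int[leb]_(y in A) p y) ^+ k)).
    by apply: measurable_funM => //; exact: measurable_mix.
  move=> s; case/andP: (chiC s) => u0 uC; rewrite mulr_ge0//=.
  by rewrite (le_trans _ uC)// ler_piMr.
rewrite (mix_swap mA p0 pi mc c') -RintegralZl//.
  by apply: eq_Rintegral => s _; rewrite exprSr !mulrA.
apply: (bi _ (C * (\int[leb]_(y in A) p y) ^+ k.+1)).
  by apply: measurable_funM => //; exact: measurable_funX.
move=> s; rewrite mulr_ge0 ?exprn_ge0//= ler_pM ?exprn_ge0//.
  by case/andP: (phiC s).
by rewrite lerXn2r ?nnegrE// (le_trans (G0 s)).
Qed.

End mixture.

(** Bounds the difference quotients of powers of G by those of G, for domination. *)
Lemma ler_dist_exp {R : realDomainType} (u v : R) k : 0 <= u <= 1 -> 0 <= v <= 1 ->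
  `|u ^+ k - v ^+ k| <= k%:R * `|u - v|.
Proof.
move=> /andP[u0 u1] /andP[v0 v1]; elim: k => [|k IH].
  by rewrite !expr0 subrr normr0 mul0r.
have -> : u ^+ k.+1 - v ^+ k.+1 = u * (u ^+ k - v ^+ k) + (u - v) * v ^+ k.
  by rewrite !exprS; ring.
have -> : k.+1%:R * `|u - v| = k%:R * `|u - v| + `|u - v| by rewrite mulrSr mulrDl mul1r.
rewrite (le_trans (ler_normD _ _))// lerD//.
  by rewrite normrM (ger0_norm u0) (le_trans _ IH)// ler_piMl.
by rewrite normrM ler_piMr// ger0_norm ?exprn_ge0// exprn_ile1.
Qed.

Lemma cvgX1 {R : realType} (T : Type) (D : set_system T) (FD : Filter D) (f : T -> R) (l : R) k :
  f y @[y --> D] --> l -> f y ^+ k @[y --> D] --> l ^+ k.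
Proof.
move=> fl; elim: k => [|k IH].
  by under eq_fun do rewrite expr0; rewrite expr0; exact: cvg_cst.
by under eq_fun do rewrite exprS; rewrite exprS; exact: cvgM.
Qed.

Section density_theory.
Context {R : realType}.
Implicit Types (x y v w s t : R).
Notation leb := (@leb R).
Variables (f F : R -> R) (fF : density01 f F).

Lemma density_F0 : F 0 = 0.
Proof.
rewrite (density_primitive fF) ?in_itv/= ?lexx ?ler01//.
by rewrite -leb_RintegralE set_itv1 Rintegral_set1.
Qed.

Lemma density_nondecreasing x y : 0 <= x -> x <= y -> y <= 1 -> F x <= F y.
Proof.
move=> x0 xy y1; rewrite -subr_ge0 !(density_primitive fF) ?in_itv/=; last 2 first.
- by rewrite x0 (le_trans xy).
- by rewrite y1 (le_trans x0).
rewrite primitive_itvB//; last exact: density_integrable fF.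
apply: Rintegral_ge0 => t; rewrite /= in_itv/= => /andP[? ?].
apply: (density_ge0 fF); rewrite in_itv/=; apply/andP; split; lra.
Qed.

(** The bound does not depend on the weight; applied to w = q s it is uniform in the cutoff s. *)
Lemma weighted_dist (w : R -> R) x y : measurable_fun (`[0, 1] : set R) w ->
  (forall t, t \in `[0, 1] -> 0 <= w t <= 1) -> x \in `[0, 1] -> y \in `[0, 1] ->
  `|\int[leb]_(t in `[0, y]) (w t * f t) - \int[leb]_(t in `[0, x]) (w t * f t)|
  <= `|F y - F x|.
Proof.
move=> mw w01; wlog xy : x y / x <= y => [h x01 y01|].
  have [/h->//|/ltW/h] := leP x y.
  by rewrite distrC (distrC (F y)); apply.
move=> x01 y01; move: (x01) (y01); rewrite !in_itv/= => /andP[x0 x1] /andP[y0 y1].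
have wn t : t \in `[0, 1] -> `|w t| <= 1.
  by move=> /w01/andP[? ?]; rewrite ger0_norm.
have := @weighted_increment _ _ _ fF w 1 0 1 x y mw wn x0 xy y1.
rewrite !mul0r subr0 mul1r => h; apply: (le_trans (h _)); last exact: ler_norm.
move=> t; rewrite in_itv/= => /andP[xt ty]; rewrite subr0; apply: wn.
by rewrite in_itv/=; apply/andP; split; lra.
Qed.

End density_theory.

(** * Screened bidders *)

Section model.
Context {R : realType}.
Implicit Types (x y v w s t : R).
Notation leb := (@leb R).

(* [mu] is the law of the cutoff signal and [q s y] the probability that a bidder
   with valuation y has a signal above s. *)
Record screening (f F : R -> R) (mu : {finite_measure set R -> \bar R})
    (q : R -> R -> R) : Prop := Screening {
  scr_density : density01 f F ;
  scr_f_gt0 : forall x : R, x \in `[0, 1] -> 0 < f x ;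
  scr_F1 : F 1 = 1 ;
  scr_measurable : measurable_fun setT (fun z : R * R => q z.1 z.2) ;
  scr_01 : forall s y, 0 <= q s y <= 1 ;
  scr_cont : forall x : R, x \in `[0, 1] ->
    {ae mu, forall s, q s y @[y --> punct01 x] --> q s x} ;
  scr_pos : forall v x : R, v \in `]0, 1] -> x \in `]0, 1] ->
    exists B : set R, [/\ measurable B, (0 < mu B)%E &
      forall s, B s -> [/\ 0 < q s v, 0 < q s x & 0 < mixprim q `[0, x] f s]] }.

Variables (f F : R -> R) (mu : {finite_measure set R -> \bar R}) (q : R -> R -> R).
Hypothesis scr : screening f F mu q.

Let fF := scr_density scr.

Let mq := scr_measurable scr.

Let q01 := scr_01 scr.

Let q0 s y : 0 <= q s y. Proof. by case/andP: (q01 s y). Qed.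

Let q1 s y : q s y <= 1. Proof. by case/andP: (q01 s y). Qed.

Definition tailprim s x := mixprim q `[0, x] f s.

Local Notation G := tailprim.

Definition winK k x v := \int[mu]_s (q s v * G s x ^+ k).

Definition winM k x v := \int[mu]_s (q s v * (q s x * G s x ^+ k)).

Let f0 x : x \in `[0, 1] -> 0 <= f x. Proof. exact: (density_ge0 fF). Qed.

Let fi x : x <= 1 -> leb.-integrable `[0, x] (EFin \o f).
Proof.
move=> x1; apply: integrableS (density_integrable fF) => //.
by apply: sub_itv01; rewrite bnd_simp.
Qed.

Let f0' x : x <= 1 -> forall y, `[0, x]%classic y -> 0 <= f y.
Proof.
move=> x1 y; rewrite /= in_itv/= => /andP[? ?]; apply: f0.
by rewrite in_itv/=; apply/andP; split; lra.
Qed.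

Let le1 x : x \in `[0, 1] -> x <= 1. Proof. by rewrite in_itv/= => /andP[]. Qed.

Lemma tailprim_ge0 s x : x <= 1 -> 0 <= G s x.
Proof. by move=> x1; exact: mixprim_ge0 (f0' x1) s. Qed.

Lemma tailprim_le s x : x \in `[0, 1] -> G s x <= F x.
Proof.
move=> x01; rewrite (density_primitive fF)//.
by apply: mixprim_le => //; [exact: f0' (le1 x01)|exact: fi (le1 x01)].
Qed.

Lemma tailprim_01 s x : x \in `[0, 1] -> 0 <= G s x <= 1.
Proof.
move=> x01; rewrite (tailprim_ge0 s (le1 x01))/= (le_trans (tailprim_le s x01))//.
by rewrite -(scr_F1 scr) (density_nondecreasing fF)//; move: x01; rewrite in_itv/= => /andP[].
Qed.

Lemma measurable_tailprim x : x <= 1 -> measurable_fun setT (fun s => G s x).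
Proof. by move=> x1; exact: (measurable_mixprim mq q01 _ (f0' x1) (fi x1)). Qed.

Lemma tailprim0 s : G s 0 = 0.
Proof.
have o01 : (0 : R) \in `[0, 1] by rewrite in_itv/= lexx ler01.
apply/eqP; rewrite eq_le tailprim_ge0// andbT.
by have := tailprim_le s o01; rewrite (density_F0 fF).
Qed.

Lemma tailprim_dist s x y : x \in `[0, 1] -> y \in `[0, 1] ->
  `|G s y - G s x| <= `|F y - F x|.
Proof.
move=> x01 y01; apply: (weighted_dist fF) => //.
exact: (measurable_funTS (measurable_mixr mq s)).
Qed.

Lemma tailprim_deriv s x : x \in `[0, 1] -> q s y @[y --> punct01 x] --> q s x ->
  is_deriv01 (G s) x (q s x * f x).
Proof.
move=> x01 qx; apply: (@weighted_deriv01 _ _ _ fF _ 1) => //.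
  exact: (measurable_funTS (measurable_mixr mq s)).
by move=> t _; rewrite ger0_norm.
Qed.

Lemma tailprim_cvg s x : x \in `[0, 1] -> G s y @[y --> punct01 x] --> G s x.
Proof.
move=> x01; apply/cvgrPdist_le => e e0.
have := (cvgrPdist_le _ _).1 (is_deriv01_cvg (density_deriv fF x01)) e e0.
move=> [r r0 hr]; exists r => // y yr yx y01.
by rewrite (le_trans (tailprim_dist s y01 x01))//; exact: hr.
Qed.

Lemma measurable_qG k x v : x <= 1 -> measurable_fun setT (fun s => q s v * G s x ^+ k).
Proof.
move=> x1; apply: measurable_funM; first exact: measurable_mix.
by apply: measurable_funX; exact: measurable_tailprim.
Qed.

Lemma measurable_qqG k x v w : x <= 1 -> measurable_fun setT (fun s => q s v * (q s w * G s x ^+ k)).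
Proof. by move=> x1; apply: measurable_funM; [exact: measurable_mix|exact: measurable_qG]. Qed.

Lemma qG_01 k s x v : x \in `[0, 1] -> 0 <= q s v * G s x ^+ k <= 1.
Proof.
move=> /(tailprim_01 s)/andP[G0 G1].
rewrite mulr_ge0 ?exprn_ge0//= mulr_ile1 ?exprn_ge0//.
exact: exprn_ile1.
Qed.

Lemma qqG_01 k s x v w : x \in `[0, 1] -> 0 <= q s v * (q s w * G s x ^+ k) <= 1.
Proof.
move=> /(@qG_01 k s x w)/andP[G0 G1].
by rewrite mulr_ge0//= mulr_ile1.
Qed.

Lemma integrable01 (phi : R -> R) : measurable_fun setT phi -> (forall s, 0 <= phi s <= 1) ->
  mu.-integrable setT (EFin \o phi).
Proof.
move=> mphi h; apply: (@bounded_integrable _ _ _ mu _ 1) => // s.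
by case/andP: (h s) => ? ?; rewrite ger0_norm.
Qed.

Lemma winK_ge0 k x v : x \in `[0, 1] -> 0 <= winK k x v.
Proof. by move=> x01; apply: Rintegral_ge0 => s _; case/andP: (@qG_01 k s x v x01). Qed.

Lemma winM_ge0 k x v : x \in `[0, 1] -> 0 <= winM k x v.
Proof. by move=> x01; apply: Rintegral_ge0 => s _; case/andP: (@qqG_01 k s x v x x01). Qed.

Lemma winK0 k v : winK k.+1 0 v = 0.
Proof.
rewrite /winK; under eq_Rintegral do rewrite tailprim0 expr0n mulr0.
by rewrite Rintegral_cst// mul0r.
Qed.

Let oc01 x : x \in `]0, 1] -> x \in `[0, 1].
Proof. by rewrite !in_itv/= => /andP[/ltW-> ->]. Qed.

Lemma winK_gt0 k x v : x \in `]0, 1] -> v \in `]0, 1] -> 0 < winK k x v.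
Proof.
move=> x01 v01; have [B [mB B0 hB]] := scr_pos scr v01 x01.
apply: (@Rintegral_gt0 _ _ _ mu _ 1 B) => //.
- by apply: measurable_qG; exact: le1 (oc01 x01).
- by move=> s; exact: qG_01 (oc01 x01).
- by move=> s /hB[qv qx Gx]; rewrite mulr_gt0 ?exprn_gt0.
Qed.

Lemma winM_gt0 k x v : x \in `]0, 1] -> v \in `]0, 1] -> 0 < winM k x v.
Proof.
move=> x01 v01; have [B [mB B0 hB]] := scr_pos scr v01 x01.
apply: (@Rintegral_gt0 _ _ _ mu _ 1 B) => //.
- by apply: measurable_qqG; exact: le1 (oc01 x01).
- by move=> s; exact: qqG_01 (oc01 x01).
- by move=> s /hB[qv qx Gx]; rewrite !mulr_gt0 ?exprn_gt0.
Qed.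

(** Differentiation under the integral sign. The quotients of G s are dominated by those of F
    uniformly in s, and for almost every s the function q s is continuous at x, so that G s has
    derivative q s x * f x there. *)
Lemma winK_deriv k x v : x \in `[0, 1] ->
  is_deriv01 (fun y => winK k.+1 y v) x (k.+1%:R * f x * winM k x v).
Proof.
move=> x01.
(* The value 0 off [0, 1] makes phi y measurable in s for every real y. *)
pose phi (y s : R) := if y \in `[0, 1] then
  (q s v * G s y ^+ k.+1 - q s v * G s x ^+ k.+1) / (y - x) else 0.
pose psi s := k.+1%:R * f x * (q s v * (q s x * G s x ^+ k)).
have : \int[mu]_s phi y s @[y --> punct01 x] --> \int[mu]_s psi s.
  have F' := density_deriv fF x01.
  apply: (@dct_punct01 _ _ _ mu phi psi x (k.+1%:R * (f x + 1))).
  - move=> y; have [y01|/negbTE y01] := boolP (y \in `[0, 1]); rewrite /phi y01//.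
    apply: measurable_funM => //; apply: measurable_funB; apply: measurable_qG; exact: le1.
  - by apply: measurable_funM => //; apply: measurable_qqG; exact: le1.
  - have [r /= r0 hr] := (cvgrPdist_le _ _).1 F' _ ltr01.
    exists r => //= y yr yx y01 s; rewrite /phi y01 -mulrBr.
    have : `|(F y - F x) / (y - x)| <= f x + 1.
      rewrite -(subrK (f x) (_ / _)); apply: (le_trans (ler_normD _ _)).
      by rewrite addrC (ger0_norm (f0 x01)) lerD2l distrC; exact: hr.
    rewrite !normrM => h; rewrite (ger0_norm (q0 _ _)).
    rewrite -mulrA; apply: (@le_trans _ _ (`|G s y ^+ k.+1 - G s x ^+ k.+1| * `|(y - x)^-1|)).
      by rewrite ler_piMl// mulr_ge0.
    apply: (@le_trans _ _ (k.+1%:R * `|F y - F x| * `|(y - x)^-1|)).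
      rewrite ler_wpM2r//; apply: (le_trans (ler_dist_exp _ (tailprim_01 s y01) (tailprim_01 s x01))).
      by rewrite ler_wpM2l// tailprim_dist.
    by rewrite -mulrA ler_wpM2l.
  - apply: filterS (scr_cont scr x01) => s qs.
    have := is_deriv01Z (c := q s v) (is_deriv01X (n := k) (tailprim_deriv x01 qs)).
    rewrite (_ : _ * _ = psi s); last by rewrite /psi; ring.
    apply: cvg_trans; apply: near_eq_cvg; apply: near_punct01 => y y01 _.
    by rewrite /phi y01.
rewrite [X in _ --> X](_ : _ = k.+1%:R * f x * winM k x v); last first.
  rewrite /psi RintegralZl//; apply: integrable01; first by apply: measurable_qqG; exact: le1.
  by move=> s; exact: qqG_01.
apply: cvg_trans; apply: near_eq_cvg; apply: near_punct01 => y y01 _.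
rewrite /phi y01 RintegralZr//; last first.
  have := integrableB measurableT (integrable01 (@measurable_qG k.+1 y v (le1 y01)) (fun s => qG_01 _ _ _ y01))
     (integrable01 (@measurable_qG k.+1 x v (le1 x01)) (fun s => qG_01 _ _ _ x01)).
  by apply: eq_integrable.
rewrite RintegralB//; apply: integrable01 => //; try (by apply: measurable_qG; exact: le1); by move=> s; exact: qG_01.
Qed.

(** RHR lives on the diagonal, where both arguments move; continuity of q s at x is again available
    for almost every s only. *)
Lemma winK_diag_cvg k x : x \in `[0, 1] -> winK k y y @[y --> punct01 x] --> winK k x x.
Proof.
move=> x01.
have : \int[mu]_s (if y \in `[0, 1] then q s y * G s y ^+ k else 0) @[y --> punct01 x]
    --> winK k x x.
  apply: (@dct_punct01 _ _ _ mu (fun y s => if y \in `[0, 1] then q s y * G s y ^+ k else 0) _ x 1).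
  - by move=> y; have [y01|/negbTE y01] := boolP (y \in `[0, 1]) => //; apply: measurable_qG; exact: le1.
  - by apply: measurable_qG; exact: le1.
  - apply: near_punct01 => y y01 _ s; rewrite y01.
    by have /andP[? ?] := @qG_01 k s y y y01; rewrite ger0_norm.
  - apply: filterS (scr_cont scr x01) => s qs.
    have : q s y * G s y ^+ k @[y --> punct01 x] --> q s x * G s x ^+ k.
      by apply: cvgM => //; apply: cvgX1; exact: tailprim_cvg.
    apply: cvg_trans; apply: near_eq_cvg; apply: near_punct01 => y y01 _.
    by rewrite y01.
apply: cvg_trans; apply: near_eq_cvg; apply: near_punct01 => y y01 _.
by apply: eq_Rintegral => s _; rewrite y01.
Qed.

Lemma winM_diag_cvg k x : x \in `[0, 1] -> winM k y y @[y --> punct01 x] --> winM k x x.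
Proof.
move=> x01.
have : \int[mu]_s (if y \in `[0, 1] then q s y * (q s y * G s y ^+ k) else 0) @[y --> punct01 x]
    --> winM k x x.
  apply: (@dct_punct01 _ _ _ mu (fun y s => if y \in `[0, 1] then q s y * (q s y * G s y ^+ k) else 0) _ x 1).
  - by move=> y; have [y01|/negbTE y01] := boolP (y \in `[0, 1]) => //; apply: measurable_qqG; exact: le1.
  - by apply: measurable_qqG; exact: le1.
  - apply: near_punct01 => y y01 _ s; rewrite y01.
    by have /andP[? ?] := @qqG_01 k s y y y y01; rewrite ger0_norm.
  - apply: filterS (scr_cont scr x01) => s qs.
    have : q s y * (q s y * G s y ^+ k) @[y --> punct01 x] --> q s x * (q s x * G s x ^+ k).
      by apply: cvgM => //; apply: cvgM => //; apply: cvgX1; exact: tailprim_cvg.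
    apply: cvg_trans; apply: near_eq_cvg; apply: near_punct01 => y y01 _.
    by rewrite y01.
apply: cvg_trans; apply: near_eq_cvg; apply: near_punct01 => y y01 _.
by apply: eq_Rintegral => s _; rewrite y01.
Qed.

End model.

(** * Lebesgue integrals over subintervals of [0, 1] *)

Section half_open.
Context {R : realType}.
Notation leb := (@leb R).
Implicit Types (x y v s t : R).

Lemma leb_itv0 x : 0 <= x -> leb (`[0, x]%classic : set R) = x%:E.
Proof.
move=> x0; rewrite /leb lebesgue_measure_itv/= lte_fin -EFinB subr0.
by case: ltP => // x0'; congr EFin; apply/eqP; rewrite eq_le x0 x0'.
Qed.

Lemma density01_id : density01 (fun=> 1) (@id R).
Proof.
split.
- by [].
- apply/integrableP; split; first exact/measurable_EFinP.
  under eq_integral do rewrite gee0_abs ?lee_fin//.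
  by rewrite integral_cst// mul1e [X in (X < _)%E]leb_itv0// ltry.
- move=> x; rewrite in_itv/= => /andP[x0 x1].
  by rewrite Rintegral_cst// mul1r [X in fine X]leb_itv0.
- by move=> x _; exact: is_deriv01_id.
Qed.

Lemma Rintegral_leb_set1 (p : R -> R) x : \int[leb]_(t in `[x, x]) p t = 0.
Proof. by rewrite -leb_RintegralE set_itv1 Rintegral_set1. Qed.

(** Allows a formula known only off the left endpoint, typically off 0, to be integrated over the
    closed interval. *)
Lemma leb_itv_obnd_cbnd (p : R -> R) x y : measurable_fun (`]x, y] : set R) p ->
  (\int[leb]_(t in `[x, y]) (p t)%:E = \int[leb]_(t in `]x, y]) (p t)%:E)%E.
Proof.
by move=> mp; rewrite -!lebE -integral_itv_obnd_cbnd//; exact/measurable_EFinP.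
Qed.

Lemma in01_oc x : x \in `]0, 1] -> x \in `[0, 1].
Proof. by rewrite !in_itv/= => /andP[/ltW-> ->]. Qed.

Lemma punct01_bounded (w : R -> R) : (forall x, x \in `[0, 1] -> 0 <= w x) ->
  (forall x, x \in `[0, 1] -> w y @[y --> punct01 x] --> w x) ->
  measurable_fun (`[0, 1] : set R) w /\ exists C, forall x, x \in `[0, 1] -> `|w x| <= C.
Proof.
move=> w0 wc.
have cw : {within `[0, 1], continuous w} by exact: punct01_continuous.
split; first exact: subspace_continuous_measurable_fun.
have [c c01 hc] := EVT_max ler01 cw; exists (w c) => x x01.
by rewrite ger0_norm ?hc ?w0.
Qed.

End half_open.

(** * The bidding differential equation *)

Section shading.
Context {R : realType}.
Notation leb := (@leb R).
Implicit Types (x y v s t : R).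
Variables (f F rho r : R -> R).
Hypotheses (fF : density01 f F) (f_gt0 : forall x, x \in `[0, 1] -> 0 < f x).
Hypothesis rho_gt0 : forall x, x \in `]0, 1] -> 0 < rho x.
Hypothesis rho_cvg : forall x, x \in `]0, 1] -> rho y @[y --> punct01 x] --> rho x.
Hypothesis rE : forall x, x \in `]0, 1] -> r x = f x * rho x.

Definition shade x v := fine (expeR (- \int[leb]_(t in `[x, v]) (r t)%:E)).

Lemma r_gt0 x : x \in `]0, 1] -> 0 < r x.
Proof. by move=> x01; rewrite rE// mulr_gt0 ?rho_gt0 ?f_gt0// in01_oc. Qed.

Lemma max01 x e : 0 < e <= 1 -> x \in `[0, 1] -> Num.max x e \in `]0, 1].
Proof.
move=> /andP[e0 e1]; rewrite !in_itv/= => /andP[x0 x1].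
by rewrite lt_max e0 orbT ge_max x1 e1.
Qed.

Lemma clip_cvg e x : 0 < e <= 1 -> x \in `[0, 1] ->
  rho (Num.max y e) @[y --> punct01 x] --> rho (Num.max x e).
Proof.
move=> e01 x01; have x'01 := max01 e01 x01.
apply/cvgrPdist_lt => d d0.
have [k /= k0 hk] := (cvgrPdist_lt _ _).1 (rho_cvg x'01) d d0.
apply: (near_punct01_ball k0) => y y01 yx yk.
have [->|yx'] := eqVneq (Num.max y e) (Num.max x e); first by rewrite subrr normr0.
apply: hk => //=; last exact: in01_oc (max01 e01 y01).
apply: le_lt_trans yk; move: yx'; rewrite /Num.max.
case: ltP => ye; case: ltP => xe; rewrite ?eqxx// => _.
- by rewrite (distrC y) !ger0_norm; lra.
- by rewrite distrC !ger0_norm; lra.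
- by rewrite distrC.
Qed.

(** Since r may fail to be integrable at 0, rho is frozen below e at its value rho e. The clipped
    weight is continuous, hence bounded, and its primitive against f computes [shade] on [e, 1]. *)
Lemma shade_exists e : 0 < e <= 1 -> exists W : R -> R,
  [/\ forall x, x \in `[0, 1] -> is_deriv01 W x (rho (Num.max x e) * f x) &
      forall t v, e <= t -> t <= v -> v <= 1 -> shade t v = expR (W t - W v)].
Proof.
move=> e01; have /andP[e0 e1] := e01.
pose w y := rho (Num.max y e).
have wc x : x \in `[0, 1] -> w y @[y --> punct01 x] --> w x by exact: clip_cvg.
have [|mw [C wC]] := punct01_bounded _ wc.
  by move=> x x01; rewrite /w ltW// rho_gt0// max01.
exists (fun x => \int[leb]_(t in `[0, x]) (w t * f t)); split => [x x01|t v et tv v1].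
  by apply: (weighted_deriv01 fF mw wC) => //; exact: wc.
have wi := weighted_integrable fF mw wC.
have t0 : 0 <= t by rewrite ltW// (lt_le_trans e0).
have wr y : y \in `]t, v] -> (w y * f y) = r y.
  rewrite in_itv/= => /andP[ty yv]; rewrite rE; last first.
    by rewrite in_itv/= (lt_trans _ ty) ?(lt_le_trans e0)//= (le_trans yv).
  by rewrite /w max_l 1?mulrC// (le_trans et)// ltW.
rewrite /shade -opprB primitive_itvB//.
have sub : `]t, v] `<=` `[0, 1] by apply: sub_itv01; rewrite bnd_simp.
have wi' : leb.-integrable `]t, v] (EFin \o (fun y => w y * f y)).
  by apply: integrableS wi.
have mr : measurable_fun (`]t, v] : set R) r.
  apply: (eq_measurable_fun (fun y => w y * f y)).
    by move=> y; rewrite inE => /wr.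
  by move/integrableP : wi' => [/measurable_EFinP].
rewrite leb_itv_obnd_cbnd// /Rintegral.
under [in RHS]eq_integral.
  move=> y; rewrite inE => /wr ->; over.
have : (\int[leb]_(y in `]t, v]) (r y)%:E)%E \is a fin_num.
  apply: integrable_fin_num => //; apply: eq_integrable wi' => //.
  by move=> y; rewrite inE => /wr /= ->.
by case: (\int[_]_(_ in _) _)%E.
Qed.

Lemma shadexx v : v \in `]0, 1] -> shade v v = 1.
Proof.
rewrite in_itv/= => /andP[v0 v1].
have [W [_ ->]] := @shade_exists v (introT andP (conj v0 v1)); rewrite ?lexx//.
by rewrite subrr expR0.
Qed.

(** Based at 1 because the integral of r from 0 may diverge. The value 0 on the left keeps E
    nondecreasing on the whole line. *)
Definition discount t : R := if 0 < t then shade t 1 else 0.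

Local Notation E := discount.

Lemma discountE t : 0 < t -> E t = shade t 1. Proof. by rewrite /E => ->. Qed.

Lemma discount1 : E 1 = 1.
Proof. by rewrite discountE ?ltr01// shadexx// in_itv/= ltr01 lexx. Qed.

Lemma discount_gt0 t : t \in `]0, 1] -> 0 < E t.
Proof.
rewrite in_itv/= => /andP[t0 t1]; rewrite discountE//.
have [W [_ ->]] := @shade_exists t (introT andP (conj t0 t1)); rewrite ?lexx//.
exact: expR_gt0.
Qed.

Lemma shade_discount t v : 0 < t -> t <= v -> v <= 1 -> shade t v = E t / E v.
Proof.
move=> t0 tv v1; have v0 := lt_le_trans t0 tv.
rewrite !discountE//.
have [W [_ WE]] := @shade_exists t (introT andP (conj t0 (le_trans tv v1))).
rewrite !WE ?lexx// ?(le_trans tv)// -expRN -expRD; congr expR; ring.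
Qed.

Lemma discount_deriv x : x \in `]0, 1] -> is_deriv01 E x (r x * E x).
Proof.
move=> x01'; move: (x01'); rewrite in_itv/= => /andP[x0 x1].
have x01 := in01_oc x01'.
(* Clipping at x / 2 leaves r unchanged near x, where E is therefore the exponential of a
   differentiable function. *)
have x2 : 0 < x / 2 by rewrite divr_gt0.
have e01 : 0 < x / 2 <= 1 by rewrite x2/=; lra.
have [W [Wd WE]] := shade_exists e01.
have EW y : y \in `[0, 1] -> `|y - x| < x / 2 -> expR (W y - W 1) = E y.
  rewrite in_itv/= ltr_norml => /andP[y0 y1] /andP[h1 h2].
  by rewrite discountE; [rewrite WE//; lra|lra].
apply: (near_eq_is_deriv01 x2 _ EW); first by apply: EW => //; rewrite subrr normr0.
rewrite mulrC -EW ?subrr ?normr0//.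
have := is_deriv01B (Wd x x01) (@is_deriv01_cst _ (W 1) x); rewrite subr0.
move=> /(is_deriv01_comp (f := fun y => W y - W 1) (is_derive_expR _)).
by rewrite rE// mulrC max_l 1?(mulrC (f x)) ?(mulrC (expR _))//; lra.
Qed.

Lemma discount_cvg x : x \in `]0, 1] -> E y @[y --> punct01 x] --> E x.
Proof. by move=> x01; exact: is_deriv01_cvg (discount_deriv x01). Qed.

(** Proved on all of R, since measurability of E is deduced from monotonicity. *)
Lemma discount_nondecreasing : {homo E : x y / x <= y}.
Proof.
move=> x y xy; have [x0|x0] := leP x 0.
  rewrite {1}/E ltNge x0/= /E; case: ifP => // _.
  by rewrite fine_ge0// expeR_ge0.
have y0 := lt_le_trans x0 xy.
have E1 z : 1 < z -> E z = 1.
  move=> z1; rewrite discountE ?(lt_trans ltr01)// /shade set_itv_ge ?bnd_simp -?ltNge//.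
  by rewrite integral_set0 oppe0 /= expR0.
have mono a b : 0 < a -> a <= b -> b <= 1 -> E a <= E b.
  move=> a0 ab b1.
  apply: (@deriv01_nondecreasing _ E (fun z => r z * E z) a b) => //; first exact: ltW.
  - move=> z; rewrite in_itv/= => /andP[az zb]; apply: discount_deriv.
    by rewrite in_itv/=; apply/andP; split; lra.
  - move=> z; rewrite in_itv/= => /andP[az zb].
    have z01 : z \in `]0, 1] by rewrite in_itv/=; apply/andP; split; lra.
    by rewrite mulr_ge0// ltW// ?r_gt0 ?discount_gt0.
  - move=> z; rewrite in_itv/= => /andP[az zb]; apply: discount_cvg.
    by rewrite in_itv/=; apply/andP; split; lra.
have [y1|y1] := leP y 1; first exact: mono.
have [x1|x1] := leP x 1; last by rewrite !E1.
by rewrite (E1 y)// -discount1; exact: mono.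
Qed.

Lemma discount_ge0 t : 0 <= E t.
Proof. by rewrite /E; case: ifP => // _; rewrite fine_ge0// expeR_ge0. Qed.

Lemma discount_le1 t : t <= 1 -> E t <= 1.
Proof. by rewrite -{2}discount1; exact: discount_nondecreasing. Qed.

Let mE (D : set R) : measurable D -> measurable_fun D E.
Proof. by move=> mD; exact: nondecreasing_measurable discount_nondecreasing. Qed.

Let E01 t : t \in `[0, 1] -> `|E t| <= 1.
Proof. by rewrite in_itv/= => /andP[_ t1]; rewrite ger0_norm ?discount_ge0// discount_le1. Qed.

Definition cumdisc v := \int[leb]_(t in `[0, v]) E t.

Local Notation N := cumdisc.

Let iE v : v <= 1 -> leb.-integrable `[0, v] (EFin \o E).
Proof.
move=> v1.
have h : leb.-integrable `[0, 1] (EFin \o E).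
  apply: eq_integrable (weighted_integrable density01_id (mE _) E01) => //.
  by move=> t _ /=; rewrite mulr1.
apply: integrableS h => //.
by apply: sub_itv01; rewrite bnd_simp.
Qed.

Lemma cumdisc_deriv v : v \in `]0, 1] -> is_deriv01 N v (E v).
Proof.
move=> v01; have v01' := in01_oc v01.
have := weighted_deriv01 density01_id (mE _) E01 v01' (discount_cvg v01).
rewrite mulr1 => /(_ ltac:(by [])); congr is_deriv01.
by apply/funext => y; rewrite /N; apply: eq_Rintegral => t _; rewrite mulr1.
Qed.

Lemma cumdisc0 : N 0 = 0. Proof. exact: Rintegral_leb_set1. Qed.

Lemma cumdisc_ge0 v : 0 <= N v.
Proof. by apply: Rintegral_ge0 => t _; exact: discount_ge0. Qed.

Lemma cumdisc_le v : v \in `[0, 1] -> N v <= v * E v.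
Proof.
rewrite in_itv/= => /andP[v0 v1].
have -> : v * E v = \int[leb]_(t in `[0, v]) E v.
  rewrite Rintegral_cst// mulrC; congr (_ * _).
  have := density_primitive density01_id (x := v); rewrite in_itv/= v0 v1 => /(_ isT).
  by rewrite Rintegral_cst// mul1r.
apply: le_Rintegral => //; first exact: iE.
- have h : leb.-integrable `[0, 1] (EFin \o (fun=> E v)).
    apply: eq_integrable (weighted_integrable density01_id (w := fun=> E v) (C := `|E v|) _ _) => //.
    by move=> t _ /=; rewrite mulr1.
  apply: integrableS h => //.
  by apply: sub_itv01; rewrite bnd_simp.
- by move=> t; rewrite /= in_itv/= => /andP[_ tv]; exact: discount_nondecreasing.
Qed.

Lemma cumdisc_le_id v : v \in `[0, 1] -> N v <= v.
Proof.
move=> v01; apply: (le_trans (cumdisc_le v01)).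
by move: v01; rewrite in_itv/= => /andP[v0 v1]; rewrite ler_piMr// discount_le1.
Qed.

(** Replaces differentiability as the source of continuity at 0, where the differential equation
    says nothing. *)
Lemma cvg_le_id (p : R -> R) : (forall y, y \in `[0, 1] -> 0 <= p y <= y) ->
  p y @[y --> punct01 (0 : R)] --> p 0.
Proof.
move=> p01; have p0 : p 0 = 0.
  have /andP[? ?] : 0 <= p 0 <= 0 by apply: p01; rewrite in_itv/= lexx ler01.
  by apply/eqP; rewrite eq_le; apply/andP.
apply/cvgrPdist_lt => e e0; apply: (near_punct01_ball e0) => y y01 _.
rewrite p0 sub0r normrN subr0; have /andP[py0 pyy] := p01 y y01.
by apply: le_lt_trans; rewrite !ger0_norm// (le_trans py0).
Qed.

Lemma cumdisc_cvg v : v \in `[0, 1] -> N y @[y --> punct01 v] --> N v.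
Proof.
move=> v01; have := v01; rewrite in_itv/= => /andP[v0 v1].
have [v0'|v0'] := ltP 0 v.
  by apply: is_deriv01_cvg (cumdisc_deriv _); rewrite in_itv/= v0'.
have -> : v = 0 by apply/eqP; rewrite eq_le v0 v0'.
by apply: cvg_le_id => y y01; rewrite cumdisc_ge0 cumdisc_le_id.
Qed.

Lemma cumdisc_gt0 v : v \in `]0, 1] -> 0 < N v.
Proof.
rewrite in_itv/= => /andP[v0 v1]; apply: (le_lt_trans (cumdisc_ge0 0)).
apply: (@deriv01_increasing _ N E 0 v) => //.
- move=> x; rewrite in_itv/= => /andP[x0 xv]; apply: cumdisc_deriv.
  by rewrite in_itv/=; apply/andP; split; lra.
- move=> x; rewrite in_itv/= => /andP[x0 xv]; apply: discount_gt0.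
  by rewrite in_itv/=; apply/andP; split; lra.
- move=> x; rewrite in_itv/= => /andP[x0 xv]; apply: cumdisc_cvg.
  by rewrite in_itv/=; apply/andP; split; lra.
Qed.

Lemma shade_integral v : v \in `]0, 1] -> \int[leb]_(t in `[0, v]) shade t v = N v / E v.
Proof.
move=> v01; have := v01; rewrite in_itv/= => /andP[v0 v1].
have shE t : t \in `]0, v] -> shade t v = E t / E v.
  by rewrite in_itv/= => /andP[t0 tv]; exact: shade_discount.
rewrite /N -RintegralZr//; last exact: iE.
(* [shE] excludes t = 0, so both integrals are moved to ]0, v] before being compared. *)
have mEv : measurable_fun (`]0, v] : set R) (fun t => E t / E v).
  by apply: measurable_funM => //; exact: mE.
rewrite /Rintegral !leb_itv_obnd_cbnd//.
  by congr fine; apply: eq_integral => t; rewrite inE => /shE ->.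
by apply: (eq_measurable_fun (fun t => E t / E v)) => // t; rewrite inE => /shE ->.
Qed.

Definition shaded v := v - \int[leb]_(t in `[0, v]) shade t v.

Lemma shaded0 : shaded 0 = 0.
Proof. by rewrite /shaded Rintegral_leb_set1 subrr. Qed.

Lemma shadedE v : v \in `]0, 1] -> shaded v = v - N v / E v.
Proof. by move=> v01; rewrite /shaded shade_integral. Qed.

Lemma shaded_bounds v : v \in `[0, 1] -> 0 <= shaded v <= v.
Proof.
move=> v01; have := v01; rewrite in_itv/= => /andP[v0 v1].
have [v0'|v0'] := ltP 0 v; last first.
  have -> : v = 0 by apply/eqP; rewrite eq_le v0 v0'.
  by rewrite shaded0 lexx.
have v01' : v \in `]0, 1] by rewrite in_itv/= v0'.
have E0 := discount_gt0 v01'.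
rewrite shadedE// subr_ge0 ler_pdivrMr// cumdisc_le//=.
by rewrite lerBlDr lerDl divr_ge0 ?cumdisc_ge0// ltW.
Qed.

Lemma shaded_lt v : v \in `]0, 1] -> shaded v < v.
Proof.
move=> v01; rewrite shadedE// ltrBlDr ltrDl divr_gt0 ?cumdisc_gt0//.
exact: discount_gt0.
Qed.

(** With E' = r * E and N' = E, the function N / E has derivative 1 - r * (N / E), and N / E is v -
    shaded v. *)
Lemma shaded_deriv v : v \in `]0, 1] -> is_deriv01 shaded v (r v * (v - shaded v)).
Proof.
move=> v01; have := v01; rewrite in_itv/= => /andP[v0 v1].
have E0 := discount_gt0 v01.
have E1 : E v != 0 by rewrite gt_eqF.
have h := is_deriv01B (@is_deriv01_id _ v)
  (is_deriv01M (cumdisc_deriv v01) (is_deriv01V E1 (discount_deriv v01))).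
have h2 : is_deriv01 (fun y => y - N y / E y) v (r v * (v - shaded v)).
  by move: h; congr is_deriv01; rewrite shadedE//; field.
apply: (near_eq_is_deriv01 v0 _ _ h2); first by rewrite shadedE.
move=> y; rewrite in_itv/= ltr_norml => /andP[y0 y1] /andP[h1 h3].
by rewrite shadedE// in_itv/= y1 andbT; lra.
Qed.

Lemma shaded_cvg v : v \in `[0, 1] -> shaded y @[y --> punct01 v] --> shaded v.
Proof.
move=> v01; have := v01; rewrite in_itv/= => /andP[v0 v1].
have [v0'|v0'] := ltP 0 v.
  by apply: is_deriv01_cvg (shaded_deriv _); rewrite in_itv/= v0'.
have -> : v = 0 by apply/eqP; rewrite eq_le v0 v0'.
by apply: cvg_le_id => y; exact: shaded_bounds.
Qed.

Lemma shaded_increasing x y : 0 <= x -> x < y -> y <= 1 -> shaded x < shaded y.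
Proof.
move=> x0 xy y1.
apply: (@deriv01_increasing _ shaded (fun v => r v * (v - shaded v)) x y) => //.
- move=> z; rewrite in_itv/= => /andP[xz zy]; apply: shaded_deriv.
  by rewrite in_itv/=; apply/andP; split; lra.
- move=> z; rewrite in_itv/= => /andP[xz zy].
  have z01 : z \in `]0, 1] by rewrite in_itv/=; apply/andP; split; lra.
  by rewrite mulr_gt0 ?r_gt0// subr_gt0 shaded_lt.
- move=> z; rewrite in_itv/= => /andP[xz zy]; apply: shaded_cvg.
  by rewrite in_itv/=; apply/andP; split; lra.
Qed.

(** For a solution s, Phi = E * (id - s) - N has derivative 0. No initial condition is imposed at
    the singular point 0: as 0 <= s e <= e, both terms of Phi e lie in [0, e], so the constant is
    0. *)
Lemma shaded_unique (s : R -> R) : (forall v, v \in `[0, 1] -> 0 <= s v <= v) ->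
  (forall v, v \in `]0, 1] -> s y @[y --> punct01 v] --> s v) ->
  (forall v, v \in `]0, 1[ -> is_deriv01 s v (r v * (v - s v))) ->
  forall v, v \in `[0, 1] -> s v = shaded v.
Proof.
move=> s01 sc sd v v01; have := v01; rewrite in_itv/= => /andP[v0 v1].
have [v0'|v0'] := ltP 0 v; last first.
  have -> : v = 0 by apply/eqP; rewrite eq_le v0 v0'.
  have /andP[? ?] : 0 <= s 0 <= 0 by apply: s01; rewrite in_itv/= lexx ler01.
  by rewrite shaded0; apply/eqP; rewrite eq_le; apply/andP.
have v01' : v \in `]0, 1] by rewrite in_itv/= v0'.
pose Phi x := E x * (x - s x) - N x.
have Phi_small e : 0 < e <= v -> `|Phi e| <= e.
  move=> /andP[e0 ev]; have e1 := le_trans ev v1.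
  have e01 : e \in `[0, 1] by rewrite in_itv/= e1 ltW.
  have /andP[se0 see] := s01 e e01.
  have N0 := cumdisc_ge0 e; have N1 := cumdisc_le_id e01.
  have E0 := discount_ge0 e; have E1 := discount_le1 e1.
  have : 0 <= E e * (e - s e) <= e.
    rewrite mulr_ge0 ?subr_ge0//= (le_trans (y := 1 * e))// ?mul1r//.
    by rewrite -[leRHS]mul1r ler_pM ?subr_ge0// lerBlDr lerDl.
  by move=> /andP[? ?]; rewrite /Phi ler_norml; apply/andP; split; lra.
have Phi_cst e : 0 < e <= v -> Phi e = Phi v.
  move=> /andP[e0 ev]; apply: (@deriv01_cst _ Phi e v) => //; first exact: ltW.
    move=> x; rewrite in_itv/= => /andP[ex xv].
    have x01 : x \in `]0, 1] by rewrite in_itv/=; apply/andP; split; lra.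
    have x01' : x \in `]0, 1[ by rewrite in_itv/=; apply/andP; split; lra.
    have := is_deriv01B (is_deriv01M (discount_deriv x01)
      (is_deriv01B (@is_deriv01_id _ x) (sd x x01'))) (cumdisc_deriv x01).
    by congr is_deriv01; ring.
  move=> x; rewrite in_itv/= => /andP[ex xv].
  have x01 : x \in `]0, 1] by rewrite in_itv/=; apply/andP; split; lra.
  apply: cvgB; last exact: cumdisc_cvg (in01_oc x01).
  apply: cvgM; first exact: discount_cvg.
  by apply: cvgB; [exact: is_deriv01_cvg (is_deriv01_id x)|exact: sc].
have Phi0 : Phi v = 0.
  apply/eqP; rewrite -normr_le0 leNgt; apply/negP => P0.
  (* At this e the constant value gives |Phi v| = |Phi e| <= e <= |Phi v| / 2, which is absurd. *)
  pose e := Num.min v (`|Phi v| / 2).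
  have e0 : 0 < e by rewrite lt_min v0' divr_gt0.
  have ev : 0 < e <= v by rewrite e0 ge_min lexx.
  have := Phi_small e ev; rewrite (Phi_cst e ev).
  have : e <= `|Phi v| / 2 by rewrite ge_min lexx orbT.
  by move=> h1 h2; lra.
rewrite shadedE//; have E0 := discount_gt0 v01'.
move: Phi0; rewrite /Phi => /eqP; rewrite subr_eq0 => /eqP <-.
by rewrite mulrAC divff ?gt_eqF// mul1r opprB addrC subrK.
Qed.

Lemma F_gt0 x : x \in `]0, 1] -> 0 < F x.
Proof.
rewrite in_itv/= => /andP[x0 x1]; rewrite -(density_F0 fF).
apply: (@deriv01_increasing _ F f 0 x) => //.
- move=> y; rewrite in_itv/= => /andP[y0 yx]; apply: (density_deriv fF).
  by rewrite in_itv/=; apply/andP; split; lra.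
- move=> y; rewrite in_itv/= => /andP[y0 yx]; apply: f_gt0.
  by rewrite in_itv/=; apply/andP; split; lra.
- move=> y; rewrite in_itv/= => /andP[y0 yx]; apply: is_deriv01_cvg (density_deriv fF _).
  by rewrite in_itv/=; apply/andP; split; lra.
Qed.

(** When r = (k + 1) f / F, the quotient E / F ^ (k + 1) has derivative 0. *)
Lemma shade_power k : (forall x, x \in `]0, 1] -> r x = k.+1%:R * f x / F x) ->
  forall x v, 0 < x -> x <= v -> v <= 1 -> shade x v = F x ^+ k.+1 / F v ^+ k.+1.
Proof.
move=> rk x v x0 xv v1.
have Fd y : y \in `]0, 1] -> is_deriv01 F y (f y).
  by move=> y01; apply: (density_deriv fF); exact: in01_oc.
have Q y : y \in `]0, 1] -> is_deriv01 (fun y => E y / F y ^+ k.+1) y 0.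
  move=> y01; have Fy := F_gt0 y01.
  have Fk : F y ^+ k.+1 != 0 by rewrite expf_neq0// gt_eqF.
  have := is_deriv01M (discount_deriv y01) (is_deriv01V (f := fun z => F z ^+ k.+1) Fk
    (is_deriv01X (n := k) (Fd y y01))).
  congr is_deriv01; rewrite rk// exprS; field.
  by rewrite expf_neq0 ?gt_eqF.
have : E x / F x ^+ k.+1 = E v / F v ^+ k.+1.
  apply: (@deriv01_cst _ (fun y => E y / F y ^+ k.+1)) => //; first exact: ltW.
    move=> y; rewrite in_itv/= => /andP[? ?]; apply: Q.
    by rewrite in_itv/=; apply/andP; split; lra.
  move=> y; rewrite in_itv/= => /andP[? ?]; apply: is_deriv01_cvg (Q _ _).
  by rewrite in_itv/=; apply/andP; split; lra.
have x01 : x \in `]0, 1] by rewrite in_itv/=; apply/andP; split; lra.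
have v01 : v \in `]0, 1] by rewrite in_itv/=; apply/andP; split; lra.
have Fx := F_gt0 x01; have Fv := F_gt0 v01.
have Ev := discount_gt0 v01.
have Fx0 : F x ^+ k.+1 != 0 by rewrite expf_neq0 ?gt_eqF.
have Fv0 : F v ^+ k.+1 != 0 by rewrite expf_neq0 ?gt_eqF.
have Ev0 : E v != 0 by rewrite gt_eqF.
move=> /eqP; rewrite eqr_div// => /eqP EF.
by rewrite shade_discount//; apply/eqP; rewrite eqr_div// EF mulrC.
Qed.

(* The derivative of F * E is f * E * (1 + r F / f): comparing it with that of
   Nf = int f E turns the limit l of 1 / (1 + r F / f) into Nf ~ l F E at 0. *)
Lemma slope_cvg (c : \bar R) :
  (r t / (f t / F t))%:E @[t --> (0 : R)^'+] --> c ->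
  exists l, 0 <= l <= 1 /\ forall e, 0 < e -> exists2 d, 0 < d &
    forall t, 0 < t -> t < d -> t <= 1 -> `|(1 + r t / (f t / F t))^-1 - l| <= e.
Proof.
pose k t := r t / (f t / F t).
have k0 t : t \in `]0, 1] -> 0 <= k t.
  by move=> t01; rewrite /k !divr_ge0 ?(ltW (r_gt0 t01)) ?(ltW (F_gt0 t01))// ltW ?f_gt0// in01_oc.
have mem d : 0 < d -> exists t, [/\ 0 < t, t < d, t <= 1 & t \in `]0, 1]].
  move=> d0; exists (Num.min (d / 2) 1); rewrite in_itv/= ge_min lexx orbT.
  have m0 : 0 < Num.min (d / 2) 1 by rewrite lt_min ltr01 divr_gt0.
  by split; rewrite ?m0// gt_min; apply/orP; left; lra.
(* A finite limit x gives l = 1 / (1 + x), the limit +oo gives l = 0, and -oo contradicts the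
   nonnegativity of k. *)
case: c => [x||].
- move=> /fine_cvgP[_ kx].
  have kx' : forall e, 0 < e -> exists2 d, 0 < d &
      forall t, 0 < t -> t < d -> `|x - k t| <= e.
    move=> e e0; have [d /= d0 hd] := (cvgrPdist_le _ _).1 kx e e0.
    by exists d => // t t0 td; apply: hd; rewrite //= sub0r normrN gtr0_norm.
  have x0 : 0 <= x.
    rewrite leNgt; apply/negP => x0; have e0 : 0 < - x / 2 by lra.
    have [d d0 hd] := kx' _ e0; have [t [t0 td t1 t01]] := mem d d0.
    by have := hd t t0 td; have := k0 t t01; rewrite ler_norml => ? /andP[? ?]; lra.
  exists (1 + x)^-1; split.
    by rewrite invr_ge0 addr_ge0//= invf_le1 ?lerDl// ltr_wpDr.
  move=> e e0; have [d d0 hd] := kx' e e0; exists d => // t t0 td t1.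
  have kt : 0 <= k t by apply: k0; rewrite in_itv/= t0.
  have a0 : 0 < 1 + k t by rewrite ltr_wpDr.
  have b0 : 0 < 1 + x by rewrite ltr_wpDr.
  rewrite -/(k t) (_ : _ - _ = (x - k t) / ((1 + k t) * (1 + x))); last first.
    by field; rewrite !gt_eqF.
  rewrite normrM normfV (gtr0_norm (mulr_gt0 a0 b0)) ler_pdivrMr ?mulr_gt0//.
  apply: (le_trans (hd t t0 td)); rewrite ler_peMr// ?(ltW e0)//.
  by rewrite -[leLHS]mul1r ler_pM// lerDl.
- move=> /cvgeyPge kx; exists 0; split; first by rewrite lexx ler01.
  move=> e e0; have [d /= d0 hd] := kx e^-1; exists d => // t t0 td t1.
  have := hd t; rewrite /= sub0r normrN gtr0_norm// => /(_ td t0); rewrite lee_fin => kt.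
  have kt0 : 0 < k t by apply: lt_le_trans kt; rewrite invr_gt0.
  rewrite subr0 gtr0_norm ?invr_gt0 ?ltr_wpDl// -[leRHS]invrK lef_pV2 ?posrE ?invr_gt0 ?ltr_wpDl//.
  by apply: (le_trans kt); rewrite lerDr.
- move=> /cvgeNyPle kx; have [d /= d0 hd] := kx (- 1).
  have [t [t0 td t1 t01]] := mem d d0.
  have := hd t; rewrite /= sub0r normrN gtr0_norm// => /(_ td t0); rewrite lee_fin.
  by have := k0 t t01; rewrite /k => ? ?; lra.
Qed.

Let Nf v := \int[leb]_(t in `[0, v]) (E t * f t).

Let Nf0 : Nf 0 = 0. Proof. exact: Rintegral_leb_set1. Qed.

Let Nf_deriv x : x \in `]0, 1] -> is_deriv01 Nf x (E x * f x).
Proof.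
by move=> x01; apply: (weighted_deriv01 fF (mE _) E01 (in01_oc x01)) => //; exact: discount_cvg.
Qed.

Let Nf_cvg x : x \in `[0, 1] -> Nf y @[y --> punct01 x] --> Nf x.
Proof.
move=> x01; apply/cvgrPdist_le => e e0.
have [d d0 hd] := (cvgrPdist_le _ _).1 (is_deriv01_cvg (density_deriv fF x01)) e e0.
exists d => // y yd yx y01; apply: le_trans (hd y yd yx y01).
apply: (weighted_dist fF) => //; first exact: mE.
by move=> t; rewrite in_itv/= => /andP[_ t1]; rewrite discount_ge0 discount_le1.
Qed.

Let oc_of_lt x v : 0 < x -> x < v -> v <= 1 -> x \in `]0, 1].
Proof. by move=> *; rewrite in_itv/=; apply/andP; split; lra. Qed.

Let FE_cvg x : x \in `[0, 1] -> F y * E y @[y --> punct01 x] --> F x * E x.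
Proof.
move=> x01; have := x01; rewrite in_itv/= => /andP[x0 x1].
have Fc := is_deriv01_cvg (density_deriv fF x01).
have [x0'|x0'] := ltP 0 x.
  by apply: cvgM => //; apply: discount_cvg; rewrite in_itv/= x0'.
have x00 : x = 0 by apply/eqP; rewrite eq_le x0 x0'.
rewrite x00 (density_F0 fF) mul0r; apply/cvgrPdist_le => e e0.
rewrite x00 in Fc; have [d d0 hd] := (cvgrPdist_le _ _).1 Fc e e0.
exists d => // y yd yx y01; apply: le_trans (hd y yd yx y01).
rewrite (density_F0 fF) !sub0r !normrN normrM ler_piMr// ger0_norm ?discount_ge0//.
by apply: discount_le1; move: y01; rewrite /= in_itv/= => /andP[].
Qed.

Let idE_cvg x : x \in `[0, 1] -> y * E y @[y --> punct01 x] --> x * E x.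
Proof.
move=> x01; have := x01; rewrite in_itv/= => /andP[x0 x1].
have [x0'|x0'] := ltP 0 x.
  apply: cvgM; first exact: is_deriv01_cvg (is_deriv01_id x).
  by apply: discount_cvg; rewrite in_itv/= x0'.
have -> : x = 0 by apply/eqP; rewrite eq_le x0 x0'.
apply: (@cvg_le_id (fun y => y * E y)) => y; rewrite in_itv/= => /andP[y0 y1].
by rewrite mulr_ge0 ?discount_ge0//= ler_piMr// discount_le1.
Qed.

(** Both functions vanish at 0, so it is enough that (l + e) F E - Nf and Nf - (l - e) F E have
    nonnegative derivatives on ]0, v[; this is the hypothesis multiplied by (F E)'. *)
Lemma weighted_cumdisc_le l e v : v \in `[0, 1] ->
  (forall t, 0 < t -> t < v -> `|(1 + r t / (f t / F t))^-1 - l| <= e) ->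
  `|Nf v - l * (F v * E v)| <= e * (F v * E v).
Proof.
rewrite in_itv/= => /andP[v0 v1] le.
have FE_deriv x : x \in `]0, 1] ->
    is_deriv01 (fun y => F y * E y) x (E x * f x * (1 + r x / (f x / F x))).
  move=> x01; have fx := f_gt0 (in01_oc x01); have Fx := F_gt0 x01.
  have := is_deriv01M (density_deriv fF (in01_oc x01)) (discount_deriv x01).
  by congr is_deriv01; field; rewrite !gt_eqF.
have FE0 : F 0 * E 0 = 0 by rewrite (density_F0 fF) mul0r.
have Efx x : x \in `]0, 1] -> 0 <= E x * f x.
  by move=> x01; rewrite mulr_ge0 ?discount_ge0// ltW// f_gt0// in01_oc.
have kx x : x \in `]0, 1] -> 0 < 1 + r x / (f x / F x).
  move=> x01; rewrite ltr_wpDr// !divr_ge0 ?(ltW (r_gt0 x01)) ?(ltW (F_gt0 x01))//.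
  by rewrite ltW ?f_gt0// in01_oc.
have up : 0 <= (l + e) * (F v * E v) - Nf v.
  have -> : 0 = (l + e) * (F 0 * E 0) - Nf 0 by rewrite FE0 Nf0 mulr0 subr0.
  apply: (@deriv01_nondecreasing _ (fun y => (l + e) * (F y * E y) - Nf y)
    (fun x => E x * f x * ((l + e) * (1 + r x / (f x / F x)) - 1))) => //.
  - move=> x; rewrite in_itv/= => /andP[x0 xv]; have x01 := oc_of_lt x0 xv v1.
    have := is_deriv01B (is_deriv01Z (c := l + e) (FE_deriv x x01)) (Nf_deriv x01).
    by congr is_deriv01; ring.
  - move=> x; rewrite in_itv/= => /andP[x0 xv]; have x01 := oc_of_lt x0 xv v1.
    rewrite mulr_ge0 ?Efx// subr_ge0 -ler_pdivrMr ?kx// mul1r.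
    by have := le x x0 xv; rewrite ler_norml => /andP[? ?]; lra.
  - move=> x; rewrite in_itv/= => /andP[x0 xv].
    have x01 : x \in `[0, 1] by rewrite in_itv/= x0 (le_trans xv).
    by apply: cvgB; [apply: cvgM; [exact: cvg_cst|exact: FE_cvg]|exact: Nf_cvg].
have lo : 0 <= Nf v - (l - e) * (F v * E v).
  have -> : 0 = Nf 0 - (l - e) * (F 0 * E 0) by rewrite FE0 Nf0 mulr0 subr0.
  apply: (@deriv01_nondecreasing _ (fun y => Nf y - (l - e) * (F y * E y))
    (fun x => E x * f x * (1 - (l - e) * (1 + r x / (f x / F x))))) => //.
  - move=> x; rewrite in_itv/= => /andP[x0 xv]; have x01 := oc_of_lt x0 xv v1.
    have := is_deriv01B (Nf_deriv x01) (is_deriv01Z (c := l - e) (FE_deriv x x01)).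
    by congr is_deriv01; ring.
  - move=> x; rewrite in_itv/= => /andP[x0 xv]; have x01 := oc_of_lt x0 xv v1.
    rewrite mulr_ge0 ?Efx// subr_ge0 -ler_pdivlMr ?kx// mul1r.
    by have := le x x0 xv; rewrite ler_norml => /andP[? ?]; lra.
  - move=> x; rewrite in_itv/= => /andP[x0 xv].
    have x01 : x \in `[0, 1] by rewrite in_itv/= x0 (le_trans xv).
    by apply: cvgB; [exact: Nf_cvg|apply: cvgM; [exact: cvg_cst|exact: FE_cvg]].
by rewrite ler_norml; apply/andP; split; lra.
Qed.

(* Integrating by parts, f 0 * N - Nf - (f 0 * v - F v) * E has derivative
   - r E (f 0 * v - F v), dominated by that of e * v * E. *)
Lemma cumdisc_weighted_le e v : v \in `[0, 1] ->
  (forall t, 0 < t -> t < v -> `|f 0 * t - F t| <= e * t) ->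
  `|f 0 * N v - Nf v - (f 0 * (v * E v) - F v * E v)| <= e * (v * E v).
Proof.
rewrite in_itv/= => /andP[v0 v1] fe.
pose Z y := f 0 * N y - Nf y - (f 0 * (y * E y) - F y * E y).
have Z0 : Z 0 = 0 by rewrite /Z cumdisc0 Nf0 (density_F0 fF) !mul0r mulr0 !subr0.
have Zd x : x \in `]0, 1] -> is_deriv01 Z x (- (r x * E x * (f 0 * x - F x))).
  move=> x01; have Ed := discount_deriv x01.
  have := is_deriv01B (is_deriv01B (is_deriv01Z (c := f 0) (cumdisc_deriv x01)) (Nf_deriv x01))
    (is_deriv01B (is_deriv01Z (c := f 0) (is_deriv01M (@is_deriv01_id _ x) Ed))
      (is_deriv01M (density_deriv fF (in01_oc x01)) Ed)).
  by congr is_deriv01; ring.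
have Zc x : x \in `[0, 1] -> Z y @[y --> punct01 x] --> Z x.
  move=> x01; apply: cvgB; apply: cvgB.
  - by apply: cvgM; [exact: cvg_cst|exact: cumdisc_cvg].
  - exact: Nf_cvg.
  - by apply: cvgM; [exact: cvg_cst|exact: idE_cvg].
  - exact: FE_cvg.
have idEd x : x \in `]0, 1] -> is_deriv01 (fun y => e * (y * E y)) x (e * (E x + x * (r x * E x))).
  move=> x01; have := is_deriv01Z (c := e) (is_deriv01M (@is_deriv01_id _ x) (discount_deriv x01)).
  by rewrite mul1r.
(* The sign (-1) ^ b treats the upper and the lower bound together. *)
have key (b : bool) : 0 <= e * (v * E v) + (-1) ^+ b * Z v.
  have -> : 0 = e * (0 * E 0) + (-1) ^+ b * Z 0 by rewrite Z0 !mul0r !mulr0 addr0.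
  apply: (@deriv01_nondecreasing _ (fun y => e * (y * E y) + (-1) ^+ b * Z y)
    (fun x => e * (E x + x * (r x * E x)) + (-1) ^+ b * - (r x * E x * (f 0 * x - F x)))) => //.
  - move=> x; rewrite in_itv/= => /andP[x0 xv]; have x01 := oc_of_lt x0 xv v1.
    by apply: is_deriv01D; [exact: idEd|apply: is_deriv01Z; exact: Zd].
  - move=> x; rewrite in_itv/= => /andP[x0 xv]; have x01 := oc_of_lt x0 xv v1.
    have rE0 : 0 <= r x * E x by rewrite mulr_ge0 ?discount_ge0// ltW// r_gt0.
    have ex := fe x x0 xv.
    have e0 : 0 <= e by have := le_trans (normr_ge0 _) ex; rewrite pmulr_lge0.
    have -> : e * (E x + x * (r x * E x)) + (-1) ^+ b * - (r x * E x * (f 0 * x - F x)) =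
      e * E x + r x * E x * (e * x - (-1) ^+ b * (f 0 * x - F x)) by ring.
    apply: addr_ge0; first by rewrite mulr_ge0 ?discount_ge0.
    rewrite mulr_ge0// subr_ge0.
    by apply: le_trans ex; rewrite (le_trans (ler_norm _))// normrM normr_sign mul1r.
  - move=> x; rewrite in_itv/= => /andP[x0 xv].
    have x01 : x \in `[0, 1] by rewrite in_itv/= x0 (le_trans xv).
    by apply: cvgD; apply: cvgM; [exact: cvg_cst|exact: idE_cvg|exact: cvg_cst|exact: Zc].
have := key true; have := key false; rewrite expr0 expr1 mul1r mulN1r => h1 h2.
by rewrite -/(Z v) ler_norml; apply/andP; split; lra.
Qed.

(** As shaded v / v = 1 - N v / (v * E v), the claim amounts to N ~ l * v * E. It follows from Nf ~
    l * F * E, from F ~ f 0 * v, and from integration by parts, which relates f 0 * N to Nf. *)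
Lemma shaded_deriv0 (c : \bar R) :
  (r t / (f t / F t))%:E @[t --> (0 : R)^'+] --> c -> exists l, is_deriv01 shaded 0 l.
Proof.
move=> /slope_cvg[l [/andP[l0 l1] lP]]; exists (1 - l).
have o01 : (0 : R) \in `[0, 1] by rewrite in_itv/= lexx ler01.
have f00 : 0 < f 0 := f_gt0 o01.
apply/cvgrPdist_le => e e0.
(* Four errors are added below: three of size e1 * v * E v, and one of size e1 * F v * E v, at most
   e1 * (f 0 + 1) * v * E v because e1 <= 1. Hence f 0 + 4; the factor f 0 clears the final
   denominator. *)
pose e1 := Num.min 1 (e * f 0 / (f 0 + 4)).
have f04 : 0 < f 0 + 4 by lra.
have e10 : 0 < e1 by rewrite lt_min ltr01 divr_gt0// mulr_gt0.
have e11 : e1 <= 1 by rewrite ge_min lexx.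
have e1e : e1 * (f 0 + 4) <= e * f 0 by rewrite -ler_pdivlMr// ge_min lexx orbT.
have [d1 d10 hd1] := lP e1 e10.
have [d2 /= d20 hd2] := (cvgrPdist_le _ _).1 (density_deriv fF o01) e1 e10.
have d0 : 0 < Num.min d1 d2 by rewrite lt_min d10 d20.
apply: (near_punct01_ball d0) => v v01 vn0; rewrite subr0.
have := v01; rewrite in_itv/= => /andP[v0 v1].
have v0' : 0 < v by rewrite lt_neqAle eq_sym vn0 v0.
have v01' : v \in `]0, 1] by rewrite in_itv/= v0'.
rewrite gtr0_norm// lt_min => /andP[vd1 vd2].
have Fle t : 0 < t -> t <= v -> `|f 0 * t - F t| <= e1 * t.
  move=> t0 tv; have := hd2 t; rewrite /= sub0r normrN gtr0_norm// gt_eqF//.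
  move=> /(_ (le_lt_trans tv vd2) isT); rewrite in_itv/= (ltW t0) (le_trans tv v1).
  move=> /(_ isT); rewrite (density_F0 fF) !subr0.
  have -> : f 0 * t - F t = (f 0 - F t / t) * t by field; rewrite gt_eqF.
  by rewrite normrM (gtr0_norm t0) ler_pM2r.
have h1 := @weighted_cumdisc_le l e1 v v01
  (fun t ht htv => hd1 t ht (lt_trans htv vd1) (le_trans (ltW htv) v1)).
have h2 := @cumdisc_weighted_le e1 v v01 (fun t ht htv => Fle t ht (ltW htv)).
have h3 := Fle v v0' (lexx v).
have E0 := discount_gt0 v01'.
have vE0 : 0 < v * E v by rewrite mulr_gt0.
rewrite shaded0 subr0 shadedE//.
have -> : 1 - l - (v - N v / E v) / v = (f 0 * N v - l * (f 0 * (v * E v))) / (f 0 * (v * E v)).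
  by field; rewrite !gt_eqF.
have fvE0 : 0 < f 0 * (v * E v) by rewrite mulr_gt0.
rewrite normrM normfV (gtr0_norm fvE0) ler_pdivrMr// [leRHS]mulrA.
apply: (@le_trans _ _ (e1 * (f 0 + 4) * (v * E v))); last by rewrite ler_pM2r.
have FE : F v * E v <= (f 0 + 1) * (v * E v).
  rewrite mulrA ler_pM2r// mulrDl mul1r.
  have : e1 * v <= v by rewrite ler_piMl// ltW.
  by move: h3; rewrite ler_norml => /andP[? ?] ?; lra.
have D0 : 0 <= E v * `|f 0 * v - F v| <= e1 * (v * E v).
  by rewrite mulr_ge0 ?(ltW E0)//= mulrC mulrA ler_pM2r.
have D1 : `|f 0 * (v * E v) - F v * E v| <= e1 * (v * E v).
  have -> : f 0 * (v * E v) - F v * E v = E v * (f 0 * v - F v) by ring.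
  by rewrite normrM (gtr0_norm E0); case/andP: D0.
have D2 : `|l * (f 0 * (v * E v) - F v * E v)| <= e1 * (v * E v).
  by rewrite normrM (ger0_norm l0) (le_trans _ D1)// ler_piMl.
have D3 : e1 * (F v * E v) <= e1 * ((f 0 + 1) * (v * E v)) by rewrite ler_pM2l.
have -> : e1 * (f 0 + 4) * (v * E v) =
  e1 * (v * E v) + e1 * (v * E v) + e1 * ((f 0 + 1) * (v * E v)) + e1 * (v * E v) by ring.
have -> : f 0 * N v - l * (f 0 * (v * E v)) =
  (f 0 * N v - Nf v - (f 0 * (v * E v) - F v * E v)) + (f 0 * (v * E v) - F v * E v)
  + (Nf v - l * (F v * E v)) - l * (f 0 * (v * E v) - F v * E v) by ring.
move: h1 h2 D1 D2; rewrite !ler_norml => /andP[? ?] /andP[? ?] /andP[? ?] /andP[? ?].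
by apply/andP; split; lra.
Qed.

End shading.

(** * The auction *)

Section auction.
Context {R : realType}.
Notation leb := (@leb R).
Implicit Types (x y v b t : R) (sigma : R -> R).
Variables (m k : nat) (P : predictor R) (mu : {finite_measure set R -> \bar R})
  (q : R -> R -> R).
Hypotheses (knm : (k.+2 <= m)%N) (scr : screening (f1 P) (F1 P) mu q).
Hypothesis psiE : forall w, psi m k.+2 P w = \int[mu]_s \prod_(y <- w) q s y.

Local Notation n := k.+2.
Local Notation K := (winK (f1 P) mu q k.+1).
Local Notation M := (winM (f1 P) mu q k).

Let fF := scr_density scr.

Let mq := scr_measurable scr.

Let q01 := scr_01 scr.

Let f_gt0 := scr_f_gt0 scr.

Let one01 : (1 : R) \in `[0, 1]. Proof. by rewrite in_itv/= lexx ler01. Qed.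

Let one01' : (1 : R) \in `]0, 1]. Proof. by rewrite in_itv/= lexx ltr01. Qed.

Let zero01 : (0 : R) \in `[0, 1]. Proof. by rewrite in_itv/= lexx ler01. Qed.

Let Cf_neq0 v : v \in `[0, 1] -> 'C(m, n)%:R * f1 P v != 0.
Proof. by move=> v01; rewrite mulf_neq0 ?pnatr_eq0 -?lt0n ?bin_gt0// gt_eqF ?f_gt0. Qed.

(** Only X is required to be nonzero: K 1 v may vanish at v = 0, where the identity survives by the
    convention x / 0 = 0. *)
Let oneK (X K1 Kx : R) : X != 0 -> X / (X * K1) * Kx = Kx / K1.
Proof. by move=> X0; rewrite invfM mulrA divff// mul1r mulrC. Qed.

Lemma g_cons v w : g m n P (v :: w) = 'C(m, n)%:R * f1 P v *
  (\int[mu]_s (q s v * \prod_(y <- w) q s y)) * \prod_(y <- w) f1 P y.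
Proof.
rewrite /g psiE big_cons; under eq_Rintegral do rewrite big_cons.
by ring.
Qed.

Lemma iint_g v : v \in `[0, 1] ->
  iint k.+1 `[0, 1] (fun u => g m n P (v :: u)) = 'C(m, n)%:R * f1 P v * K 1 v.
Proof.
move=> v01.
have C0 : 0 <= 'C(m, n)%:R * f1 P v by rewrite mulr_ge0// (density_ge0 fF).
rewrite -(@iint_mixture _ mu _ mq q01 `[0, 1] (f1 P) k.+1 _ _ (density_integrable fF)
  (fun s => q s v) 1 _ (measurable_mix mq v) (fun s => q01 s v) C0)//.
  by apply: eq_iint => w _ _; exact: g_cons.
by move=> y y01; exact: (density_ge0 fF).
Qed.

(** Beating all rivals is an event of product form, so the mixture formula applies with f1 replaced
    by ind * f1. *)
Lemma iint_belief (ind : R -> R) v : v \in `[0, 1] -> measurable_fun setT ind ->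
  (forall y, 0 <= ind y <= 1) ->
  iint k.+1 `[0, 1] (fun w => \prod_(y <- w) ind y * belief m n P v w) =
  (\int[mu]_s (q s v * mixprim q `[0, 1] (fun y => ind y * f1 P y) s ^+ k.+1)) / K 1 v.
Proof.
move=> v01 mind ind01.
have ind0 y : 0 <= ind y by case/andP: (ind01 y).
have wi := weighted_integrable fF (measurable_funTS mind) (C := 1)
  (fun t _ => ltac:(by rewrite ger0_norm//; case/andP: (ind01 t))).
set c := 'C(m, n)%:R * f1 P v / ('C(m, n)%:R * f1 P v * K 1 v).
have c0 : 0 <= c.
  rewrite /c divr_ge0// ?mulr_ge0 ?(density_ge0 fF)//.
  exact: winK_ge0 scr _ _ _ one01.
have p0 y : `[0, 1]%classic y -> 0 <= ind y * f1 P y.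
  by move=> y01; rewrite mulr_ge0// (density_ge0 fF).
transitivity (c * \int[mu]_s (q s v * mixprim q `[0, 1] (fun y => ind y * f1 P y) s ^+ k.+1)).
  rewrite -(@iint_mixture _ mu _ mq q01 `[0, 1] _ k.+1 _ p0 wi
    (fun s => q s v) 1 _ (measurable_mix mq v) (fun s => q01 s v) c0)//.
  apply: eq_iint => w _ _; rewrite /belief iint_g// g_cons /c big_split/=.
  by rewrite -/K; ring.
by rewrite /c oneK// Cf_neq0.
Qed.

Lemma H_E x v : x \in `[0, 1] -> v \in `[0, 1] -> H m n P x v = K x v / K 1 v.
Proof.
move=> x01 v01.
have x1 : x <= 1 by move: x01; rewrite in_itv/= => /andP[].
have xi : leb.-integrable `[0, x] (EFin \o f1 P).
  by apply: integrableS (density_integrable fF) => //; apply: sub_itv01; rewrite bnd_simp.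
set c := 'C(m, n)%:R * f1 P v / ('C(m, n)%:R * f1 P v * K 1 v).
have c0 : 0 <= c.
  rewrite /c divr_ge0// ?mulr_ge0 ?(density_ge0 fF)//.
  exact: winK_ge0 scr _ _ _ one01.
have p0 y : `[0, x]%classic y -> 0 <= f1 P y.
  rewrite /= in_itv/= => /andP[y0 yx]; apply: (density_ge0 fF).
  by rewrite in_itv/= y0 (le_trans yx).
rewrite /H; transitivity (c * K x v); last by rewrite /c oneK// Cf_neq0.
rewrite /winK -(@iint_mixture _ mu _ mq q01 `[0, x] _ k.+1 _ p0 xi
    (fun s => q s v) 1 _ (measurable_mix mq v) (fun s => q01 s v) c0)//.
by apply: eq_iint => w _ _; rewrite /belief iint_g// g_cons /c; ring.
Qed.

Lemma h_deriv x v : x \in `[0, 1] -> v \in `[0, 1] ->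
  is_deriv01 (fun y => H m n P y v) x (k.+1%:R * f1 P x * M x v / K 1 v).
Proof.
move=> x01 v01.
apply: (@eq_is_deriv01 _ _ (fun y => (K 1 v)^-1 * K y v)) => //.
  by move=> y y01; rewrite H_E// mulrC.
by rewrite mulrC; apply: is_deriv01Z; exact: (winK_deriv scr).
Qed.

Lemma h_E x v : x \in `[0, 1] -> v \in `[0, 1] ->
  h m n P x v = k.+1%:R * f1 P x * M x v / K 1 v.
Proof. by move=> x01 v01; apply: deriv01E => //; exact: h_deriv. Qed.

(** The continuous factor RHR / f1, which plays the part of rho in the differential equation. *)
Definition hazard_factor x := k.+1%:R * M x x / K x x.

Lemma RHR_E x : x \in `]0, 1] -> RHR m n P x = f1 P x * hazard_factor x.
Proof.
move=> x01; have x01' := in01_oc x01.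
have K1 : 0 < K 1 x by exact: (winK_gt0 scr).
have Kx : 0 < K x x by exact: (winK_gt0 scr).
have alg (a b c d e : R) : d != 0 -> e != 0 -> a * b * c / d / (e / d) = b * (a * c / e).
  by move=> d0 e0; field; rewrite d0 e0.
rewrite /RHR (H_E x01' x01') (h_E x01' x01') /hazard_factor.
exact: alg (lt0r_neq0 K1) (lt0r_neq0 Kx).
Qed.

Lemma hazard_factor_gt0 x : x \in `]0, 1] -> 0 < hazard_factor x.
Proof.
by move=> x01; rewrite divr_gt0 ?mulr_gt0 ?(winK_gt0 scr) ?(winM_gt0 scr).
Qed.

Lemma hazard_factor_cvg x : x \in `]0, 1] ->
  hazard_factor y @[y --> punct01 x] --> hazard_factor x.
Proof.
move=> x01; have x01' := in01_oc x01.
apply: cvgM.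
  by apply: cvgM; [exact: cvg_cst|exact: (winM_diag_cvg scr)].
by apply: cvgV; [rewrite gt_eqF ?(winK_gt0 scr)|exact: (winK_diag_cvg scr)].
Qed.

Let r := RHR m n P.

Lemma L_shade x v : L m n P x v = shade r x v.
Proof. by rewrite /L lebE. Qed.

Lemma sigmaFP_shaded v : sigmaFP m n P v = shaded r v.
Proof.
rewrite /sigmaFP leb_RintegralE /shaded; congr (_ - _).
by apply: eq_Rintegral => t _; rewrite L_shade.
Qed.

Lemma H_ge0 x v : x \in `[0, 1] -> v \in `[0, 1] -> 0 <= H m n P x v.
Proof. by move=> x01 v01; rewrite H_E// divr_ge0 ?(winK_ge0 scr). Qed.

Lemma H_gt0 x v : x \in `]0, 1] -> v \in `]0, 1] -> 0 < H m n P x v.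
Proof.
by move=> x01 v01; rewrite H_E ?in01_oc// divr_gt0 ?(winK_gt0 scr).
Qed.

Lemma H0 v : v \in `[0, 1] -> H m n P 0 v = 0.
Proof. by move=> v01; rewrite H_E// (winK0 scr) mul0r. Qed.

(** Rivals strictly below x fill [0, x[, which differs from [0, x] by a null set. *)
Lemma mixprim_below x s : x \in `[0, 1] ->
  mixprim q `[0, 1] (fun y => (y < x)%R%:R * f1 P y) s = tailprim (f1 P) q s x.
Proof.
move=> x01; have := x01; rewrite in_itv/= => /andP[x0 x1].
rewrite /tailprim /mixprim.
have -> : (fun y => q s y * ((y < x)%R%:R * f1 P y)) =
    (fun y => q s y * f1 P y) \_ [set y | y < x].
  apply/funext => y; rewrite patchE; case: ifPn => [/set_mem/= ->|/negP yx].
    by rewrite mul1r.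
  have [yx'|_] := ltP y x; first by exfalso; apply: yx; rewrite inE.
  by rewrite mul0r mulr0.
rewrite -Rintegral_mkcondr.
have -> : `[0, 1] `&` [set y | y < x] = `[0, x[%classic.
  apply/seteqP; split => y; rewrite /= !in_itv/=; first by move=> [/andP[-> _] ->].
  by move=> /andP[-> yx]; rewrite yx (le_trans (ltW yx)).
rewrite -!leb_RintegralE Rintegral_itv_bndo_bndc//.
apply: leb_integrableE.
have h := weighted_integrable fF (measurable_funTS (measurable_mixr mq s)) (C := 1)
  (fun t _ => ltac:(by case/andP: (q01 s t) => ? ?; rewrite ger0_norm)).
by apply: integrableS h => //; apply: sub_itv01; rewrite bnd_simp.
Qed.

Lemma all_prod sigma b w :
  (all (fun y => sigma y < b) w)%:R = \prod_(y <- w) (sigma y < b)%R%:R :> R.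
Proof.
elim: w => [|y w IH]; first by rewrite big_nil.
by rewrite /= big_cons -IH; case: (sigma y < b); rewrite ?mul1r ?mul0r.
Qed.

Lemma win_prob_ind sigma b (ind : R -> R) v : v \in `[0, 1] ->
  (forall y, y \in `[0, 1] -> (sigma y < b)%R%:R = ind y) ->
  win_prob m n P sigma v b =
  iint k.+1 `[0, 1] (fun w => \prod_(y <- w) ind y * belief m n P v w).
Proof.
move=> v01 indE; apply: eq_iint => w _ w01; rewrite all_prod; congr (_ * _).
by rewrite !big_seq; apply: eq_bigr => y yw; apply: indE; exact: w01.
Qed.

Section strategy.
Variable sigma : R -> R.
Hypothesis sigma0 : forall v, v \in `[0, 1] -> 0 <= sigma v.
Hypothesis sigma_inc : forall v w : R, v \in `[0, 1] -> w \in `[0, 1] ->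
    v < w -> sigma v < sigma w.

Let sigma_lt x y : x \in `[0, 1] -> y \in `[0, 1] -> (sigma y < sigma x) = (y < x).
Proof.
move=> x01 y01; have [yx|xy|->] := ltgtP y x; last by rewrite ltxx.
- by rewrite sigma_inc.
- by apply/negbTE; rewrite -leNgt ltW// sigma_inc.
Qed.

Lemma win_prob_sigma x v : x \in `[0, 1] -> v \in `[0, 1] ->
  win_prob m n P sigma v (sigma x) = H m n P x v.
Proof.
move=> x01 v01.
pose ind (y : R) : R := (y < x)%R%:R.
have ind01 y : 0 <= ind y <= 1 by rewrite /ind; case: (y < x)%R; rewrite ?lexx ?ler01.
have mind : measurable_fun setT ind.
  have -> : ind = \1_[set y | y < x].
    apply/funext => y; rewrite indicE /ind; congr (nat_of_bool _)%:R.
    by apply/idP/idP => [yx|]; rewrite ?inE.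
  apply: measurable_indic.
  rewrite (_ : [set _ | _] = `]-oo, x[%classic); first exact: measurable_itv.
  by apply/seteqP; split => y; rewrite /= in_itv.
have indE y : y \in `[0, 1] -> (sigma y < sigma x)%R%:R = ind y.
  by move=> y01; rewrite sigma_lt.
rewrite (win_prob_ind v01 indE) (iint_belief v01 mind ind01) (H_E x01 v01).
have E s : mixprim q `[0, 1] (fun y => ind y * f1 P y) s = tailprim (f1 P) q s x.
  exact: mixprim_below.
by under eq_Rintegral do rewrite E.
Qed.

Lemma win_prob_high b v : v \in `[0, 1] -> sigma 1 < b ->
  win_prob m n P sigma v b = H m n P 1 v.
Proof.
move=> v01 sb; pose ind (y : R) : R := 1.
have ind01 y : 0 <= ind y <= 1 by rewrite ler01 lexx.
have mind : measurable_fun setT ind by exact: measurable_cst.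
have indE y : y \in `[0, 1] -> (sigma y < b)%R%:R = ind y.
  move=> y01; suff -> : sigma y < b by [].
  apply: le_lt_trans sb; have [->|y1] := eqVneq y 1; first exact: lexx.
  by rewrite ltW// sigma_inc// lt_neqAle y1; move: y01; rewrite in_itv/= => /andP[].
rewrite (win_prob_ind v01 indE) (iint_belief v01 mind ind01) (H_E one01 v01).
have E s : mixprim q `[0, 1] (fun y => ind y * f1 P y) s = tailprim (f1 P) q s 1.
  by apply: eq_Rintegral => y _; rewrite mul1r.
by under eq_Rintegral do rewrite E.
Qed.

End strategy.

(** Bidding one's own valuation earns 0, while sigma v wins with positive probability for v > 0;
    hence sigma v <= v. Imitating type y cannot pay, so y |-> H(y | x) (x - sigma y) is maximal at
    the interior point x, and the first-order condition is the differential equation. *)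
Lemma SSM0_unique sigma : SSM0 m n P sigma ->
  forall v, v \in `[0, 1] -> sigma v = sigmaFP m n P v.
Proof.
move=> [s0 sinc sder sbest].
have win x v := @win_prob_sigma sigma sinc x v.
have sle v : v \in `]0, 1] -> sigma v <= v.
  move=> v01; have v01' := in01_oc v01.
  have v0 : 0 <= v by move: v01'; rewrite in_itv/= => /andP[].
  have := sbest v v01' v v0; rewrite /payoff subrr mulr0 win//.
  by rewrite pmulr_rge0 ?H_gt0// subr_ge0.
have s01 v : v \in `[0, 1] -> 0 <= sigma v <= v.
  move=> v01; rewrite s0//=; have := v01; rewrite in_itv/= => /andP[v0 v1].
  have [v0'|v0'] := ltP 0 v; first by apply: sle; rewrite in_itv/= v0'.
  have -> : v = 0 by apply/eqP; rewrite eq_le v0 v0'.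
  rewrite leNgt; apply/negP => sgt0.
  (* If sigma 0 were positive, this type would bid at most w < sigma 0, against monotonicity. *)
  pose w := Num.min 1 (sigma 0 / 2).
  have w0 : 0 < w by rewrite lt_min ltr01 divr_gt0.
  have w01 : w \in `]0, 1] by rewrite in_itv/= w0 ge_min lexx.
  have := sinc 0 w zero01 (in01_oc w01) w0; have := sle w w01.
  have : w <= sigma 0 / 2 by rewrite ge_min lexx orbT.
  by lra.
move=> v v01; rewrite sigmaFP_shaded.
apply: (shaded_unique fF f_gt0 hazard_factor_gt0 hazard_factor_cvg RHR_E) => //.
  move=> x x01; have [l sl] := sder x ltac:(by []).
  exact: is_deriv01_cvg sl.
move=> x x01; have x01' : x \in `]0, 1].
  by move: x01; rewrite !in_itv/= => /andP[-> /ltW].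
have x01'' := in01_oc x01'.
pose U y := H m n P y x * (x - sigma y).
have Ud y : y \in `]0, 1] -> exists l, is_deriv01 sigma y l /\
    is_deriv01 U y (h m n P y x * (x - sigma y) - H m n P y x * l).
  move=> y01; have [l sl] := sder y ltac:(by []); exists l; split => //.
  have Hd := h_deriv (in01_oc y01) x01''; rewrite -h_E// ?in01_oc// in Hd.
  have := is_deriv01M Hd (is_deriv01B (@is_deriv01_cst _ x y) sl).
  by congr is_deriv01; ring.
have oo_oc y : y \in `]0, 1[ -> y \in `]0, 1] by rewrite !in_itv/= => /andP[-> /ltW].
have Umax : is_derive x 1 U 0.
  apply: (@derive1_at_max _ U 0 1 x ler01) => //.
    move=> y y01; have [l [_ Ul]] := Ud y (oo_oc y y01).
    by have [] := is_deriv01_is_derive y01 Ul.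
  move=> y y01; have y01' := in01_oc (oo_oc y y01).
  have := sbest x x01'' (sigma y) (s0 y y01').
  by rewrite /payoff !win.
have [l [sl Ul]] := Ud x x01'.
have [_ E1] := is_deriv01_is_derive x01 Ul.
have [_] := Umax; rewrite E1 => /eqP; rewrite subr_eq0 => /eqP E2.
have Hx := H_gt0 x01' x01'.
suff -> : RHR m n P x * (x - sigma x) = l by [].
by rewrite /RHR mulrAC E2 mulrC mulKf ?gt_eqF.
Qed.

(** The integral in FP is x - shaded x. The right-hand side is the derivative of H(x | v) (v -
    shaded x), the equation having replaced shaded' by r * (x - shaded x). *)
Lemma FP_E x v : x \in `]0, 1] -> v \in `]0, 1] ->
  FP m n P x v = h m n P x v * (v - shaded r x) - H m n P x v * (r x * (x - shaded r x)).
Proof.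
move=> x01 v01; have Hxv := H_gt0 x01 v01; have Hxx := H_gt0 x01 x01.
rewrite /FP leb_RintegralE.
have -> : \int[leb]_(t in `[0, x]) L m n P t x = x - shaded r x.
  rewrite /shaded opprB addrC subrK.
  by apply: eq_Rintegral => t _; rewrite L_shade.
have alg (h H h' H' a b c : R) : H != 0 -> h * (a - b) + H * (b - c) * (h / H - h' / H') =
    h * (a - c) - H * (h' / H' * (b - c)).
  move=> H_neq0; move: (h' / H') => z.
  by field.
rewrite /r /RHR; exact: alg (lt0r_neq0 Hxv).
Qed.

Let sh_cvg v : v \in `[0, 1] -> shaded r y @[y --> punct01 v] --> shaded r v.
Proof. exact: (shaded_cvg fF f_gt0 hazard_factor_gt0 hazard_factor_cvg RHR_E). Qed.

Let sh_bounds v : v \in `[0, 1] -> 0 <= shaded r v <= v.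
Proof. exact: (shaded_bounds fF f_gt0 hazard_factor_gt0 hazard_factor_cvg RHR_E). Qed.

Let sh_inc : forall v w : R, v \in `[0, 1] -> w \in `[0, 1] -> v < w -> shaded r v < shaded r w.
Proof.
move=> v w; rewrite !in_itv/= => /andP[v0 _] /andP[_ w1] vw.
exact: (shaded_increasing fF f_gt0 hazard_factor_gt0 hazard_factor_cvg RHR_E).
Qed.

Let sh_deriv v : v \in `]0, 1] -> is_deriv01 (shaded r) v (r v * (v - shaded r v)).
Proof. exact: (shaded_deriv fF f_gt0 hazard_factor_gt0 hazard_factor_cvg RHR_E). Qed.

Lemma FP_best_reply v x : FP_condition m n P -> v \in `]0, 1] -> x \in `[0, 1] ->
  H m n P x v * (v - shaded r x) <= H m n P v v * (v - shaded r v).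
Proof.
move=> FPc v01 x01; have v01' := in01_oc v01.
have [FPlo FPhi] := FPc v v01'.
pose U y := H m n P y v * (v - shaded r y).
have Ud y : y \in `]0, 1] -> is_deriv01 U y (FP m n P y v).
  move=> y01; rewrite FP_E//.
  have Hd := h_deriv (in01_oc y01) v01'; rewrite -h_E// ?in01_oc// in Hd.
  have := is_deriv01M Hd (is_deriv01B (@is_deriv01_cst _ v y) (sh_deriv y01)).
  by congr is_deriv01; ring.
have Uc y : y \in `[0, 1] -> U z @[z --> punct01 y] --> U y.
  move=> y01; apply: cvgM; first exact: is_deriv01_cvg (h_deriv y01 v01').
  by apply: cvgB; [exact: cvg_cst|exact: sh_cvg].
have := x01; have := v01; rewrite !in_itv/= => /andP[v0 v1] /andP[x0 x1].
have [xv|vx] := leP x v.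
  apply: (@deriv01_nondecreasing _ U (fun y => FP m n P y v) x v) => //.
  - move=> y; rewrite in_itv/= => /andP[xy yv]; apply: Ud.
    by rewrite in_itv/=; apply/andP; split; lra.
  - move=> y; rewrite in_itv/= => /andP[xy yv]; apply: FPlo.
    by rewrite in_itv/=; apply/andP; split; lra.
  - move=> y; rewrite in_itv/= => /andP[xy yv]; apply: Uc.
    by rewrite in_itv/=; apply/andP; split; lra.
rewrite -lerN2.
apply: (@deriv01_nondecreasing _ (fun y => - U y) (fun y => - FP m n P y v) v x) => //.
- exact: ltW.
- exact: ltW.
- move=> y; rewrite in_itv/= => /andP[vy yx]; apply: is_deriv01N; apply: Ud.
  by rewrite in_itv/=; apply/andP; split; lra.
- move=> y; rewrite in_itv/= => /andP[vy yx]; rewrite oppr_ge0; apply: FPhi.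
  by rewrite in_itv/=; apply/andP; split; lra.
- move=> y; rewrite in_itv/= => /andP[vy yx]; apply: cvgN; apply: Uc.
  by rewrite in_itv/=; apply/andP; split; lra.
Qed.

(** Every bid is reduced to the imitation of some type. The set of differentiability points is a
    parameter, since optimality is proved in the same way for [SSM] and [SSM0]. *)
Lemma FP_SSM_on (D : set R) : FP_condition m n P ->
  (forall v, D v -> exists l, is_deriv01 (shaded r) v l) -> SSM_on D m n P (shaded r).
Proof.
move=> FPc Dd; split => //.
  by move=> v /sh_bounds/andP[].
have sh0 v : v \in `[0, 1] -> 0 <= shaded r v by move=> /sh_bounds/andP[].
have win x v := @win_prob_sigma (shaded r) sh_inc x v.
move=> v v01 b b0; rewrite /payoff (win v v v01 v01).
have := v01; rewrite in_itv/= => /andP[v0 v1].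
(* A bid above the top bid wins no more often than the top bid and costs more; a bid in
   [0, shaded 1] is attained by the intermediate value theorem, as shaded 0 = 0. *)
have [b_le|b_gt] := leP b (shaded r 1); last first.
  rewrite (win_prob_high sh_inc v01 b_gt).
  have [v0'|v0'] := ltP 0 v.
    have v01' : v \in `]0, 1] by rewrite in_itv/= v0'.
    apply: le_trans (FP_best_reply FPc v01' one01).
    by rewrite ler_wpM2l ?H_ge0// lerD2l lerN2 ltW.
  (* Type 0 earns 0 in equilibrium and cannot gain from a nonnegative bid. *)
  have -> : v = 0 by apply/eqP; rewrite eq_le v0 v0'.
  rewrite (H0 zero01) mul0r; apply: mulr_ge0_le0; first exact: H_ge0.
  by rewrite sub0r oppr_le0.
have shc : {within `[0, 1], continuous (shaded r)} by exact: punct01_continuous.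
have [x x01 bE] : exists2 x, x \in `[0, 1] & shaded r x = b.
  apply: (IVT ler01 shc).
  by rewrite (shaded0 r) ge_min le_max b0 b_le orbT.
rewrite -bE (win x v x01 v01).
have [v0'|v0'] := ltP 0 v.
  by apply: (FP_best_reply FPc _ x01); rewrite in_itv/= v0'.
have -> : v = 0 by apply/eqP; rewrite eq_le v0 v0'.
rewrite (H0 zero01) mul0r; apply: mulr_ge0_le0; first exact: H_ge0.
by rewrite sub0r oppr_le0 sh0.
Qed.

Lemma FP_SSM0 : FP_condition m n P -> SSM0 m n P (sigmaFP m n P).
Proof.
move=> FPc; rewrite (_ : sigmaFP m n P = shaded r); last by apply/funext => v; exact: sigmaFP_shaded.
by apply: FP_SSM_on => // v v01; eexists; exact: sh_deriv.
Qed.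

Lemma FP_SSM : FP_condition m n P -> RHR_regular_at0 m n P -> SSM m n P (sigmaFP m n P).
Proof.
move=> FPc [c rc]; rewrite (_ : sigmaFP m n P = shaded r); last by apply/funext => v; exact: sigmaFP_shaded.
apply: FP_SSM_on => // v; rewrite /= in_itv/= => /andP[v0 v1].
have [v0'|v0'] := ltP 0 v; first by eexists; apply: sh_deriv; rewrite in_itv/= v0'.
have -> : v = 0 by apply/eqP; rewrite eq_le v0 v0'.
exact: (shaded_deriv0 fF f_gt0 hazard_factor_gt0 hazard_factor_cvg RHR_E rc).
Qed.

Lemma sigmaFP_power N : (forall x, x \in `]0, 1] -> RHR m n P x = N.+1%:R * f1 P x / F1 P x) ->
  forall v, v \in `[0, 1] -> sigmaFP m n P v =
    v - \int[leb]_(x in `[0, v]) (F1 P x ^+ N.+1 / F1 P v ^+ N.+1).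
Proof.
move=> rN v; rewrite in_itv/= => /andP[v0 v1]; rewrite sigmaFP_shaded /shaded; congr (_ - _).
have pow := shade_power fF f_gt0 hazard_factor_gt0 hazard_factor_cvg RHR_E rN.
have mF1 : measurable_fun (`]0, v] : set R) (F1 P).
  have h : measurable_fun (`[0, 1] : set R) (F1 P).
    apply: subspace_continuous_measurable_fun => //; apply: punct01_continuous => // x x01.
    exact: is_deriv01_cvg (density_deriv fF x01).
  by apply: measurable_funS h => //; apply: sub_itv01; rewrite bnd_simp.
have mF : measurable_fun (`]0, v] : set R) (fun x => F1 P x ^+ N.+1 / F1 P v ^+ N.+1).
  apply: measurable_funM => //; apply: measurable_funX.
  exact: mF1.
have E x : x \in `]0, v] -> shade r x v = F1 P x ^+ N.+1 / F1 P v ^+ N.+1.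
  by rewrite in_itv/= => /andP[x0 xv]; exact: pow.
rewrite /Rintegral !leb_itv_obnd_cbnd//.
  by congr fine; apply: eq_integral => t; rewrite inE => /E ->.
by apply: (eq_measurable_fun (fun x => F1 P x ^+ N.+1 / F1 P v ^+ N.+1)) => // x; rewrite inE => /E ->.
Qed.

End auction.

(** * Predictors as screenings *)

Section density_measure.
Context {R : realType}.
Notation leb := (@leb R).

Lemma leb_itv_co (c : R) : 0 <= c -> leb (`[0, c[%classic : set R) = c%:E.
Proof.
move=> c0; rewrite /leb lebesgue_measure_itv/= lte_fin -EFinB subr0.
by case: ltP => // c0'; congr EFin; apply/eqP; rewrite eq_le c0 c0'.
Qed.

(* Layer cake: phi y is the length of [0, phi y[, and Tonelli reduces the
   change of measure to the superlevel sets of phi. *)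
Lemma integral_density (nu : {finite_measure set R -> \bar R}) (f phi : R -> R) :
  measurable_fun setT f -> (forall y, 0 <= f y) ->
  (forall A, measurable A -> nu A = \int[leb]_(y in A) (f y)%:E)%E ->
  measurable_fun setT phi -> (forall y, 0 <= phi y) ->
  (\int[nu]_y (phi y)%:E = \int[leb]_y (phi y * f y)%:E)%E.
Proof.
move=> mf f0 nuE mphi phi0.
pose A := [set z : R * R | 0 <= z.2] `&` [set z | z.2 < phi z.1].
have mA : measurable A.
  apply: measurableI.
    have := measurable_fun_ler (D := setT) (f := fun z : R * R => 0) (g := snd)
      (measurable_cst _) measurable_snd.
    move=> /(_ measurableT [set true] ltac:(by [])); rewrite setTI.
    by congr measurable; apply/seteqP; split.
  have m1 : measurable_fun setT (fun z : R * R => phi z.1) by exact: measurableT_comp.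
  have := measurable_fun_ltr (D := setT) (f := snd) (g := fun z : R * R => phi z.1)
      measurable_snd m1.
  move=> /(_ measurableT [set true] ltac:(by [])); rewrite setTI.
  by congr measurable; apply/seteqP; split.
pose S y := [set t : R | A (y, t)]; pose T t := [set y : R | A (y, t)].
have SE y : S y = `[0, phi y[%classic.
  apply/seteqP; split => [t []|t]; rewrite /S /A /= in_itv/=; first by move=> -> ->.
  by move=> /andP[].
have mT t : measurable (T t).
  have := measurable_ysection t mA; congr measurable.
  by apply/seteqP; split => y; rewrite /ysection /= inE.
have phiE y : ((phi y)%:E = \int[leb]_t (\1_A (y, t))%:E)%E.
  rewrite (_ : (fun t => _) = (fun t => (\1_(S y) t)%:E)); last first.
    by apply/funext => t; rewrite !indicE; congr (nat_of_bool _)%:R%:E; apply/idP/idP; rewrite !inE.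
  by rewrite integral_indic ?setIT ?SE// [RHS]leb_itv_co.
under eq_integral do rewrite phiE.
rewrite (fubini_tonelli (fun z : R * R => (\1_A z)%:E)); last 2 first.
- by apply/measurable_EFinP; exact: measurable_indic.
- by move=> z; rewrite lee_fin.
transitivity (\int[leb]_t \int[leb]_y (\1_A (y, t) * f y)%:E)%E.
  apply: eq_integral => t _.
  have E : (fun y => \1_A (y, t)) = \1_(T t) :> (R -> R).
    by apply/funext => y; rewrite !indicE; congr (nat_of_bool _)%:R; apply/idP/idP; rewrite !inE.
  transitivity (\int[nu]_y (\1_(T t) y)%:E)%E.
    by apply: eq_integral => y _; rewrite -E.
  transitivity (nu (T t)); first by rewrite integral_indic ?setIT//; exact: mT.
  rewrite nuE; last exact: mT.
  rewrite integral_mkcond; apply: eq_integral => y _.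
  have -> : \1_A (y, t) = \1_(T t) y :> R by rewrite -E.
  by rewrite patchE indicE; case: ifPn => _; rewrite ?mul1r ?mul0r.
rewrite -(fubini_tonelli (fun z : R * R => (\1_A z * f z.1)%:E)); last 2 first.
- apply/measurable_EFinP; apply: measurable_funM; first exact: measurable_indic.
  exact: measurableT_comp.
- by move=> z; rewrite lee_fin mulr_ge0.
apply: eq_integral => y _.
transitivity (\int[leb]_t ((\1_A (y, t) : R)%:E * (f y)%:E))%E; first by [].
have mAy : measurable_fun setT (fun t => (\1_A (y, t) : R)).
  have := measurableT_comp (@measurable_indic _ _ R setT A mA) (pair1_measurable (T2 := R) y).
  by move=> hc; exact: hc.
rewrite ge0_integralZr ?lee_fin//; first by rewrite -phiE EFinM.
exact/measurable_EFinP.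
Qed.

(** The intervals [D n] shrink to s, so their masses tend to nu {s} = 0, and they bound the
    increments of the distribution function around s. *)
Lemma cdf_continuous_at (nu : {finite_measure set R -> \bar R}) (s : R) :
  nu [set s] = 0%E -> {for s, continuous (fun x => fine (nu `]-oo, x]%classic))}.
Proof.
move=> nus; apply/cvgrPdist_lt => e e0.
pose D (n : nat) : set R := `]s - n.+1%:R^-1, s + n.+1%:R^-1]%classic.
have mD n : measurable (D n) by exact: measurable_itv.
have capD : \bigcap_n D n = [set s].
  apply/seteqP; split => [x Dx|_ ->] /=; last first.
    by move=> n _; rewrite /D /= in_itv/= ltrBlDr ltrDl lerDl invr_gt0 ltr0n/= invr_ge0.
  apply/eqP; rewrite eq_sym -subr_eq0 -normr_eq0; apply/eqP/le_anti.
  rewrite normr_ge0 andbT leNgt; apply/negP => h.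
  have /cvgrPdist_lt/(_ _ h)[N _ hN] := @cvg_harmonic R.
  have := hN N (leqnn N); rewrite /= sub0r normrN gtr0_norm ?invr_gt0//.
  have := Dx N I; rewrite /D /= in_itv/= => /andP[h1 h2] h3.
  by move: h3; rewrite ltNge => /negP; apply; rewrite ler_norml lerNl opprB lerBlDl h2 lerBlDr -lerBlDl ltW.
have : nu (D n) @[n --> \oo] --> nu (\bigcap_n D n).
  apply: nonincreasing_cvg_mu => //; first by rewrite ltey_eq fin_num_measure.
    exact: bigcap_measurable.
  move=> i j ij; apply/subsetPset => x; rewrite /D /= !in_itv/= => /andP[h1 h2].
  have ji : j.+1%:R^-1 <= i.+1%:R^-1 :> R by rewrite lef_pV2 ?posrE// ler_nat.
  rewrite (le_lt_trans _ h1) ?lerB//=; apply: le_trans h2 _; exact: lerD.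
rewrite capD nus => /fine_cvgP[_] /cvgrPdist_lt/(_ e e0)[N _ hN].
have := hN N (leqnn N); rewrite /= sub0r normrN ger0_norm ?fine_ge0// => DN.
have N0 : 0 < N.+1%:R^-1 :> R by rewrite invr_gt0.
have key x y : x <= y -> s - N.+1%:R^-1 <= x -> y <= s + N.+1%:R^-1 ->
    `|fine (nu `]-oo, y]%classic) - fine (nu `]-oo, x]%classic)| < e.
  move=> xy sx ys; apply: le_lt_trans DN.
  have -> : `]-oo, y]%classic = `]-oo, x] `|` `]x, y] :> set R.
    by rewrite -itv_bndbnd_setU// bnd_simp.
  rewrite measureU//; last first.
    by apply/seteqP; split => z //=; rewrite !in_itv/= => -[zx /andP[]]; rewrite ltNge zx.
  rewrite fineD ?fin_num_measure// addrC addKr ger0_norm ?fine_ge0// fine_le ?fin_num_measure//.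
  apply: le_measure; rewrite ?inE//.
  move=> z; rewrite /D /= !in_itv/= => /andP[h1 h2].
  by rewrite (le_lt_trans sx)// (le_trans h2).
exists N.+1%:R^-1 => //= y /=; rewrite ltr_norml => /andP[h1 h2].
have [ys|sy] := leP y s.
  by apply: (key _ _ ys); [rewrite lerBlDr -lerBlDl ltW|rewrite lerDl ltW].
rewrite distrC; apply: (key _ _ (ltW sy)); first by rewrite gerBl ltW.
by rewrite -lerBlDl -opprB lerNl ltW.
Qed.

(** By Tonelli, int nu {s} dmu(s) is the mass of the diagonal under the product of mu and nu, which
    also equals int mu {z} dnu(z) = 0. Thus weak continuity of the conditional law applies at almost
    every cutoff. *)
Lemma ae_no_atom (mu nu : {finite_measure set R -> \bar R}) :
  (forall z, mu [set z] = 0%E) -> {ae mu, forall s, nu [set s] = 0%E}.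
Proof.
move=> mu0.
pose A := [set z : R * R | z.1 == z.2].
have mA : measurable A.
  have := measurable_fun_eqr (D := setT) (@measurable_fst _ _ R R) (@measurable_snd _ _ R R).
  move=> /(_ measurableT [set true] ltac:(by [])); rewrite setTI.
  by congr measurable; apply/seteqP; split.
have nuE s : (nu [set s] = \int[nu]_z (\1_A (s, z))%:E)%E.
  rewrite (_ : (fun z => _) = (fun z => (\1_[set s] z)%:E)); last first.
    apply/funext => z; rewrite !indicE; congr (nat_of_bool _)%:R%:E.
    by apply/idP/idP; rewrite !inE /A /=; [move=> /eqP ->|move=> ->].
  by rewrite integral_indic// setIT.
have muE z : (mu [set z] = \int[mu]_s (\1_A (s, z))%:E)%E.
  rewrite (_ : (fun s => _) = (fun s => (\1_[set z] s)%:E)); last first.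
    apply/funext => s; rewrite !indicE; congr (nat_of_bool _)%:R%:E.
    by apply/idP/idP; rewrite !inE /A /=; [move=> /eqP ->|move=> ->].
  by rewrite integral_indic// setIT.
have mIA : measurable_fun setT (fun z : R * R => (\1_A z : R)%:E).
  by apply/measurable_EFinP; exact: measurable_indic.
have IA0 (z : R * R) : (0 <= (\1_A z : R)%:E)%E by rewrite lee_fin.
have int0 : (\int[mu]_s `|nu [set s]| = 0)%E.
  under eq_integral do rewrite gee0_abs// nuE.
  rewrite (fubini_tonelli _ mIA IA0).
  by under eq_integral do rewrite -muE mu0; rewrite integral0.
have mnu : measurable_fun setT (fun s => nu [set s]).
  have := measurable_fun_fubini_tonelli_F (m2 := nu) _ mIA IA0.
  by congr measurable_fun; apply/funext => s; rewrite nuE.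
have := (ae_eq_integral_abs mu measurableT mnu).1 int0.
by apply: filterS => s /(_ I).
Qed.

End density_measure.

(** * Distribution functions, conditional law and cutoff law of a predictor *)

Section predictor_theory.
Context {R : realType}.
Notation leb := (@leb R).
Variable P : predictor R.
Implicit Types (s t x y v : R).

Lemma f1_integrable : leb.-integrable `[0, 1] (EFin \o f1 P).
Proof.
apply/integrableP; split; first by apply/measurable_EFinP; exact: measurable_f1.
rewrite (eq_integral (EFin \o f1 P)); last first.
  by move=> y; rewrite inE /= => y01; rewrite -[RHS]gee0_abs//= lee_fin ltW// f1_gt0.
have := f1_density P measurableT; rewrite setTI lebE preimage_setT probability_setT => E.
suff : (\int[leb]_(y in `[0%R, 1%R]) (f1 P y)%:E < +oo)%E by [].
by rewrite -E ltry.
Qed.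

Lemma F1_integral x : x \in `[0, 1] -> F1 P x = \int[leb]_(t in `[0, x]) f1 P t.
Proof.
rewrite in_itv/= => /andP[x0 x1].
rewrite /F1 /margCDF1 /cdf /distribution /pushforward f1_density// lebE.
rewrite (_ : _ `&` _ = `[0, x]%classic)//.
apply/seteqP; split => y; rewrite /= !in_itv/=; first by move=> [-> /andP[->]].
by move=> /andP[y0 yx]; rewrite yx y0 (le_trans yx).
Qed.

Lemma density01_f1 : density01 (f1 P) (F1 P).
Proof.
split.
- by move=> x x01; rewrite ltW// f1_gt0.
- exact: f1_integrable.
- exact: F1_integral.
- exact: f1_deriv.
Qed.

Lemma F1_1 : F1 P 1 = 1.
Proof.
rewrite F1_integral ?in_itv/= ?ler01 ?lexx// /Rintegral.
have := f1_density P measurableT; rewrite setTI lebE preimage_setT probability_setT => <-.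
by [].
Qed.

Lemma F2E s : F2 P s = fine (law P (snd @^-1` `]-oo, s]%classic)).
Proof. by []. Qed.

Lemma signal_atom s : law P (snd @^-1` [set s]) = 0%E.
Proof.
rewrite f2_density//.
have [s01|s01] := boolP (s \in `[0, 1]).
  by rewrite setIidl ?integral_set1// => _ ->.
rewrite (_ : _ `&` _ = set0) ?integral_set0//.
by apply/seteqP; split => y //= [->]; apply/negP.
Qed.

Lemma F2_continuous : continuous (F2 P).
Proof.
by move=> s; exact: (@cdf_continuous_at _ (distribution (law P) (snd : {RV (law P) >-> R})) s (signal_atom s)).
Qed.

Lemma F2_le0 s : s <= 0 -> F2 P s = 0.
Proof.
move=> s0; rewrite F2E f2_density//.
have sub : `]-oo, s] `&` `[0, 1] `<=` [set (0 : R)].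
  by move=> y /=; rewrite !in_itv/= => -[ys /andP[y0 _]]; apply/eqP; rewrite eq_le y0 (le_trans ys).
have := subset_set1 sub => -[->|->]; first by rewrite integral_set0.
by rewrite integral_set1.
Qed.

Lemma F2_1 : F2 P 1 = 1.
Proof.
rewrite F2E f2_density// (_ : _ `&` _ = setT `&` `[0, 1]); last first.
  by apply/seteqP; split => y /=; rewrite !in_itv/= => -[_ /andP[-> ->]].
by rewrite -f2_density// preimage_setT probability_setT.
Qed.

Lemma measurable_snd_preimage (B : set R) : measurable B ->
  measurable (snd @^-1` B : set (R * R)).
Proof. by move=> mB; rewrite -[X in measurable X]setTI; exact: measurable_snd. Qed.

Lemma f2_integral_gt0 s t : 0 <= s -> s < t -> t <= 1 ->
  (0 < \int[leb]_(y in `]s, t]) (f2 P y)%:E)%E.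
Proof.
move=> s0 st t1.
have sub : `]s, t] `<=` `[0, 1] by apply: sub_itv01; rewrite bnd_simp.
have f20 y : `]s, t]%classic y -> 0 < f2 P y by move=> /sub; exact: f2_gt0.
rewrite lt_neqAle integral_ge0 ?andbT; last by move=> y yst; rewrite lee_fin ltW// f20.
apply/eqP => /esym E.
have mf : measurable_fun (`]s, t]%classic : set R) (EFin \o f2 P).
  by apply/measurable_EFinP; apply: measurable_funS (measurable_f2 P).
have : (\int[leb]_(y in `]s, t]) `|(EFin \o f2 P) y| = 0)%E.
  rewrite -E; apply: eq_integral => y; rewrite inE => yst.
  by rewrite gee0_abs// lee_fin ltW// f20.
move=> /(ae_eq_integral_abs leb (measurable_itv _) mf)[N [mN N0 sN]].
have : (leb (`]s, t]%classic : set R) <= leb N)%E.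
  apply: (@le_measure _ _ _ leb); [by rewrite inE; exact: measurable_itv|by rewrite inE|].
  move=> y yst; apply: sN => /(_ yst) /= [] f0.
  by have := f20 y yst; rewrite f0 ltxx.
by rewrite N0 /leb lebesgue_measure_itv/= lte_fin st -EFinB lee_fin leNgt subr_gt0 st.
Qed.

Lemma F2_increasing s t : 0 <= s -> s < t -> t <= 1 -> F2 P s < F2 P t.
Proof.
move=> s0 st t1.
have mpre := measurable_snd_preimage.
have sub : `]s, t] `<=` `[0, 1] by apply: sub_itv01; rewrite bnd_simp.
have -> : F2 P t = F2 P s + fine (law P (snd @^-1` `]s, t]%classic)).
  rewrite !F2E -fineD; last 2 first.
    by apply: fin_num_measure; apply: mpre.
    by apply: fin_num_measure; apply: mpre.
  rewrite -measureU; [|exact: mpre|exact: mpre|]; last first.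
    by apply/seteqP; split => z //=; rewrite !in_itv/= => -[zx /andP[]]; rewrite ltNge zx.
  by rewrite -preimage_setU -itv_bndbnd_setU// bnd_simp// ltW.
rewrite ltrDl fine_gt0// ltey_eq fin_num_measure ?andbT; last exact: mpre.
rewrite f2_density// lebE setIidl//; exact: f2_integral_gt0.
Qed.

Lemma F21_01 s v : 0 <= F21 P s v <= 1.
Proof.
rewrite /F21 fine_ge0//= -lee_fin fineK.
  by rewrite -(prob_kernel (s := sigker P) v) le_measure ?inE.
by rewrite ge0_fin_numE// (@le_lt_trans _ _ 1%E) ?ltry// -(prob_kernel (s := sigker P) v) le_measure ?inE.
Qed.

Lemma measurable_F21 s : measurable_fun setT (F21 P s).
Proof.
by apply: measurableT_comp => //; exact: (measurable_kernel (sigker P)).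
Qed.

Lemma F1_distribution A : measurable A ->
  distribution (law P) (fst : {RV (law P) >-> R}) A =
  (\int[leb]_(y in A) ((f1 P \_ `[0, 1]%classic) y)%:E)%E.
Proof.
move=> mA; transitivity (law P (fst @^-1` A)); first by [].
rewrite f1_density// lebE integral_mkcondr; apply: eq_integral => y _.
by rewrite !patchE; case: ifP.
Qed.

(** Disintegration of the joint law along V, whose law has density f1. *)
Lemma F21_integral x s : x \in `[0, 1] ->
  \int[leb]_(y in `[0, x]) (F21 P s y * f1 P y) = F12 P x s.
Proof.
rewrite in_itv/= => /andP[x0 x1].
rewrite /F12 /jointCDF sigker_law// /Rintegral; congr fine.
pose phi y := F21 P s y * \1_(`]-oo, x]%classic) y.
have mphi : measurable_fun setT phi.
  by apply: measurable_funM; [exact: measurable_F21|exact: measurable_indic].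
have phi0 y : 0 <= phi y by rewrite mulr_ge0//; case/andP: (F21_01 s y).
transitivity (\int[leb]_y (phi y * (f1 P \_ `[0, 1]%classic) y)%:E)%E.
  rewrite integral_mkcond; apply: eq_integral => y _.
  rewrite /phi patchE indicE patchE !mem_setE /= !in_itv/=.
  have [y0|y0] := leP 0 y; have [yx|yx] := leP y x; rewrite ?mulr1 ?mulr0 ?mul0r//.
  by rewrite (le_trans yx x1).
rewrite -(integral_density _ _ F1_distribution mphi phi0); last 2 first.
- apply: (measurable_restrictT _ _).1 => //; exact: measurable_f1.
- by move=> y; rewrite patchE; case: ifPn => //; rewrite inE => y01; rewrite ltW// f1_gt0.
rewrite ge0_integral_distribution; last 2 first.
- exact/measurable_EFinP.
- by move=> y; rewrite lee_fin.
rewrite [RHS]integral_mkcond; apply: eq_integral => -[y z] _.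
rewrite patchE /= /phi indicE /=.
have -> : ((y, z) \in fst @^-1` `]-oo, x]%classic) = (y \in `]-oo, x]%classic) by [].
case: (y \in _); rewrite ?mulr0// mulr1 /F21 fineK// ge0_fin_numE//.
by rewrite (@le_lt_trans _ _ 1%E) ?ltry// -(prob_kernel (s := sigker P) y) le_measure ?inE.
Qed.

Lemma F12_le_F2 x s : F12 P x s <= F2 P s.
Proof.
rewrite /F12 /jointCDF F2E; apply: fine_le.
- by apply: fin_num_measure; exact: measurableX.
- by apply: fin_num_measure; exact: measurable_snd_preimage.
apply: le_measure; rewrite ?inE; [exact: measurableX|exact: measurable_snd_preimage|].
by move=> z [].
Qed.

(** G depends on the predictor only through its CDFs, whichever version of the conditional law is
    chosen; the null and perfect assumptions therefore determine it. *)
Lemma mixprim_F21 x s : x \in `[0, 1] ->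
  mixprim (fun s y => 1 - F21 P s y) `[0, x] (f1 P) s = F1 P x - F12 P x s.
Proof.
move=> x01; rewrite /mixprim -F21_integral// F1_integral//.
have sub : `[0, x] `<=` `[0, 1].
  by move: x01; rewrite in_itv/= => /andP[x0 x1]; apply: sub_itv01; rewrite bnd_simp.
have fi : leb.-integrable `[0, x] (EFin \o f1 P) by apply: integrableS f1_integrable => //.
have Fi : leb.-integrable `[0, x] (EFin \o (fun y => F21 P s y * f1 P y)).
  have xint := @weighted_integrable _ _ _ density01_f1 (F21 P s) 1.
  apply: integrableS (xint _ _) => //.
  - exact: measurable_funS (measurable_F21 s).
  - by move=> y _; case/andP: (F21_01 s y) => ? ?; rewrite ger0_norm.
rewrite -RintegralB//; apply: eq_Rintegral => y _.
by rewrite mulrBl mul1r.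
Qed.

(* The section of [{(p, z) | z <= p.1}] at [p] is [`]-oo, p.1]], so that joint
   measurability of F21 is that of a kernel evaluated at sections. *)
Definition sigker_snd (p : R * R) := sigker P p.2.

Let measurable_sigker_snd U : measurable U -> measurable_fun setT (sigker_snd ^~ U).
Proof.
move=> mU; have := measurableT_comp (measurable_kernel (sigker P) U mU) (@measurable_snd _ _ R R).
by move=> hc; exact: hc.
Qed.

HB.instance Definition _ := isKernel.Build _ _ (R * R)%type R R sigker_snd measurable_sigker_snd.

Let sigker_snd_prob p : sigker_snd p setT = 1%E.
Proof. exact: prob_kernel. Qed.

HB.instance Definition _ := Kernel_isProbability.Build _ _ (R * R)%type R R sigker_snd sigker_snd_prob.

Lemma measurable_F21_joint : measurable_fun setT (fun p : R * R => F21 P p.1 p.2).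
Proof.
apply: measurableT_comp => //.
pose A := [set z : (R * R) * R | z.2 <= z.1.1].
have mA : measurable A.
  have m1 : measurable_fun setT (fun z : (R * R) * R => z.1.1).
    by have := measurableT_comp (@measurable_fst _ _ R R) (@measurable_fst _ _ (R * R)%type R).
  have := measurable_fun_ler (D := setT) (f := snd) (g := fun z : (R * R) * R => z.1.1)
    measurable_snd m1.
  move=> /(_ measurableT [set true] ltac:(by [])); rewrite setTI.
  by congr measurable; apply/seteqP; split.
have := @measurable_fun_xsection_finite_kernel _ _ (R * R)%type R R sigker_snd A.
rewrite inE => /(_ mA); congr measurable_fun; apply/funext => p.
by congr (sigker P p.2 _); apply/seteqP; split => z; rewrite /xsection /= !inE /A /=.
Qed.

Definition condlaw v : set R -> \bar R := sigker P v.

HB.instance Definition _ v := Measure.copy (condlaw v) (sigker P v).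

Let condlawT v : condlaw v setT = 1%E.
Proof. exact: prob_kernel. Qed.

HB.instance Definition _ v := Measure_isProbability.Build _ _ R (condlaw v) (condlawT v).

Lemma F21_nondecreasing v s t : s <= t -> F21 P s v <= F21 P t v.
Proof.
move=> st; apply: fine_le.
- exact: (fin_num_measure (condlaw v)).
- exact: (fin_num_measure (condlaw v)).
apply: (@le_measure _ _ _ (condlaw v)); rewrite ?inE//.
by apply: subitvPr; rewrite bnd_simp.
Qed.

Let idR : R -> R := idfun.

#[local] HB.instance Definition _ :=
  @isMeasurableFun.Build _ _ _ _ idR (@measurable_id _ _ setT).

Lemma F21_right_continuous v : right_continuous (F21 P ^~ v).
Proof.
move=> s; apply: fine_cvg; rewrite fineK; last exact: (fin_num_measure (condlaw v)).
have := @cdf_right_continuous _ _ _ (condlaw v) (idR : {RV (condlaw v) >-> R}) s.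
by [].
Qed.

Lemma F21_continuous_at v s : condlaw v [set s] = 0%E ->
  {for s, continuous (F21 P ^~ v)}.
Proof. exact: cdf_continuous_at. Qed.

Section cutoff_measure.
Variable k : nat.

(** For k = m - n this is the law of the highest of the rejected signals, a maximum of k independent
    draws from F2, cut down to [0, 1] and placed on the default display. *)
Definition cutoff (A : set R) : \bar R :=
  lebesgue_stieltjes_measure (F2pow P k) (A `&` `[0, 1]%classic).

Let mu01 : {measure set (measurableTypeR R) -> \bar R} :=
  mrestr (lebesgue_stieltjes_measure (F2pow P k)) (@measurable_itv R `[0, 1]).

Let cutoff0 : cutoff set0 = 0%E. Proof. exact: (measure0 mu01). Qed.

Let cutoff_ge0 A : (0 <= cutoff A)%E. Proof. exact: (measure_ge0 mu01). Qed.

Let cutoff_sigma_additive : semi_sigma_additive cutoff.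
Proof. by move=> A mA tA mU; exact: (@measure_semi_sigma_additive _ _ _ mu01). Qed.

HB.instance Definition _ := isMeasure.Build _ _ _ cutoff cutoff0 cutoff_ge0 cutoff_sigma_additive.

Lemma F2pow_increment s t : s <= t ->
  lebesgue_stieltjes_measure (F2pow P k) `]s, t]%classic = (F2pow P k t - F2pow P k s)%:E.
Proof.
move=> st; rewrite /lebesgue_stieltjes_measure /measure_extension/=.
by rewrite measurable_mu_extE/= ?wlength_itv_bnd//; exact: is_ocitv.
Qed.

Let cutoff_fin : fin_num_fun cutoff.
Proof.
move=> A mA; rewrite ge0_fin_numE//.
apply: (@le_lt_trans _ _ (lebesgue_stieltjes_measure (F2pow P k) `]-1, 1]%classic)).
  apply: le_measure; rewrite ?inE//; first exact: measurableI.
  by move=> y [_] /=; rewrite !in_itv/= => /andP[y0 ->]; rewrite andbT (lt_le_trans _ y0)// ltrN10.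
by rewrite F2pow_increment ?ltry// lerNl (le_trans _ ler01).
Qed.

HB.instance Definition _ := Measure_isFinite.Build _ _ _ cutoff cutoff_fin.

Lemma cutoff_itv s t : 0 <= s -> s <= t -> t <= 1 ->
  cutoff `]s, t]%classic = (F2 P t ^+ k - F2 P s ^+ k)%:E.
Proof.
move=> s0 st t1; rewrite /cutoff setIidl ?F2pow_increment//.
by apply: sub_itv01; rewrite bnd_simp.
Qed.

Lemma cutoff_atom s : cutoff [set s] = 0%E.
Proof.
apply/eqP; rewrite eq_le measure_ge0 andbT; apply/lee_addgt0Pr => e e0; rewrite add0e.
have : F2pow P k x @[x --> s^'-] --> F2pow P k s.
  apply: cvg_at_left_filter; rewrite /F2pow; apply: cvgX1.
  exact: F2_continuous.
move=> /cvgrPdist_lt/(_ _ e0) He.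
have [t ht] : exists t, t < s /\ `|F2pow P k s - F2pow P k t| < e.
  near s^'- => t; exists t; split; near: t => //.
  exact: nbhs_left_lt.
case: ht => ts te.
apply: (@le_trans _ _ (lebesgue_stieltjes_measure (F2pow P k) `]t, s]%classic)).
  apply: le_measure; rewrite ?inE//; first exact: measurableI.
  by move=> y [-> _] /=; rewrite in_itv/= ts lexx.
rewrite F2pow_increment ?(ltW ts)// lee_fin ltW//.
by apply: le_lt_trans te; exact: ler_norm.
Unshelve. all: by end_near. Qed.

Lemma cutoff_integral (f : R -> \bar R) : measurable_fun setT f -> (forall y, 0 <= f y)%E ->
  (\int[lebesgue_stieltjes_measure (F2pow P k)]_(x in `[0%R, 1%R]) f x = \int[cutoff]_x f x)%E.
Proof.
move=> mf f0.
have c0 : cutoff (~` `[0, 1]%classic) = 0%E.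
  by rewrite /cutoff setICl; exact: (measure0 (lebesgue_stieltjes_measure (F2pow P k))).
transitivity (\int[mu01]_(x in `[0%R, 1%R]) f x)%E.
  by apply: eq_measure_integral => A mA A01; rewrite /mu01 /= /mrestr setIidl.
transitivity (\int[cutoff]_(x in `[0%R, 1%R]) f x)%E; first exact: integral_ocitv.
have := @ge0_negligible_integral _ _ _ cutoff setT (~` `[0, 1]) f _ measurableT mf _ _.
move=> ->; last 3 first.
- exact: measurableC.
- by move=> y _.
- exact: c0.
by rewrite setTD setCK.
Qed.

Lemma cutoff_support : {ae cutoff, forall s, s \in `[0, 1]}.
Proof.
exists (~` `[0, 1]%classic); split; first exact: measurableC.
  by rewrite /cutoff setICl; exact: (measure0 (lebesgue_stieltjes_measure (F2pow P k))).
by move=> s.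
Qed.

End cutoff_measure.

Section screening_instance.
Variable k : nat.
Hypotheses (k_gt0 : (0 < k)%N) (regP : regular P).

Let q s y := 1 - F21 P s y.

Let q01 s y : 0 <= q s y <= 1.
Proof. by case/andP: (F21_01 s y) => ? ?; rewrite subr_ge0 gerBl; apply/andP. Qed.

Let mq : measurable_fun setT (fun z : R * R => q z.1 z.2).
Proof. by apply: measurable_funB => //; exact: measurable_F21_joint. Qed.

Lemma F1_gt0 x : x \in `]0, 1] -> 0 < F1 P x.
Proof. by move=> x01; apply: (F_gt0 density01_f1 _ x01) => y; exact: f1_gt0. Qed.

(** Continuity in y holds at cutoffs that are not atoms of the conditional law, hence almost surely.
    Positivity comes from small cutoffs, by [nondegenerate] and right continuity at 0. *)
Lemma screening_cutoff : screening (f1 P) (F1 P) (cutoff k) q.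
Proof.
split => //; [exact: density01_f1|exact: f1_gt0|exact: F1_1| |].
- move=> x x01; have := ae_no_atom (condlaw x) (cutoff_atom k).
  apply: filterS => s /F21_continuous_at sc; apply: cvgB; first exact: cvg_cst.
  by apply: cvg_within_punct01; exact: (weak_continuity regP).
- move=> v x v01 x01.
  have near_lt1 y : y \in `]0, 1] -> \forall s \near 0^'+, F21 P s y < 1.
    move=> y01; have := F21_right_continuous (v := y) (x := (0 : R)).
    by move=> /cvgr_lt; apply; exact: (Defs.nondegenerate regP).
  have near_F2 : \forall s \near 0^'+, F2 P s < F1 P x.
    have := @F2_right_continuous R P (0 : R).
    by move=> /cvgr_lt; apply; rewrite F2_le0// F1_gt0.
  have [d [d0 d1 dv dx dF]] : exists d, [/\ 0 < d, d <= 1, F21 P d v < 1, F21 P d x < 1 & F2 P d < F1 P x].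
    near (0 : R)^'+ => d; exists d; split; near: d => //.
    - exact: nbhs_right_gt.
    - exact: nbhs_right_le.
    - exact: near_lt1.
    - exact: near_lt1.
  (* This set has mass F2 d ^ k > 0. On it F21 stays below 1 at v and at x, and F2 d < F1 x gives G
     s x >= F1 x - F2 s > 0. *)
  exists `]0, d]%classic; split => //.
    have : (0 < (F2 P d ^+ k - F2 P 0 ^+ k)%:E)%E.
      rewrite lte_fin (F2_le0 (lexx 0)) expr0n gtn_eqF// subr0.
      by rewrite exprn_gt0// -(F2_le0 (lexx 0)) F2_increasing.
    by rewrite -(@cutoff_itv k 0 d (lexx 0) (ltW d0) d1).
  move=> s /=; rewrite in_itv/= => /andP[s0 sd]; split.
  - by rewrite subr_gt0 (le_lt_trans _ dv)// F21_nondecreasing.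
  - by rewrite subr_gt0 (le_lt_trans _ dx)// F21_nondecreasing.
  - rewrite mixprim_F21 ?subr_gt0; last exact: in01_oc.
    by apply: le_lt_trans (F12_le_F2 _ _) _; apply: le_lt_trans dF; exact: F2_nondecreasing.
Unshelve. all: by end_near. Qed.

Lemma psi_cutoff m n w : (n < m)%N -> k = (m - n)%N ->
  psi m n P w = \int[cutoff k]_s \prod_(y <- w) q s y.
Proof.
move=> nm ->; rewrite /psi nm /Rintegral cutoff_integral//.
- apply/measurable_EFinP; elim: w => [|y w IH].
    by under eq_fun do rewrite big_nil; exact: measurable_cst.
  under eq_fun do rewrite big_cons; apply: measurable_funM => //.
  exact: measurable_mix mq y.
- by move=> s; rewrite lee_fin; apply: prodr_ge0 => y _; case/andP: (q01 s y).
Qed.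

End screening_instance.

(** With nobody rejected, admission is certain; a unit mass carries the constant mixture. *)
Lemma screening_all : screening (f1 P) (F1 P) (dirac (0 : R)) (fun _ _ : R => 1).
Proof.
split => //; [exact: density01_f1|exact: f1_gt0|exact: F1_1|by move=> *; rewrite ler01 lexx| |].
- by move=> x x01; apply: aeW => s; exact: cvg_cst.
- move=> v x v01 x01; exists setT; split => //; first by rewrite /= /dirac indicE in_setT lte01.
  move=> s _; split => //; rewrite /mixprim.
  under eq_Rintegral do rewrite mul1r.
  by rewrite -F1_integral ?F1_gt0//; exact: in01_oc.
Qed.

Lemma psi_all m w : psi m m P w = \int[dirac (0 : R)]_s \prod_(y <- w) (1 : R).
Proof.
rewrite /psi ltnn; under eq_Rintegral do rewrite big1_eq.
by rewrite /Rintegral integral_cst//= /dirac indicE in_setT /= ?mulr1.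
Qed.

End predictor_theory.

(** * Null and perfect predictors *)

Section auction_comparison.
Context {R : realType}.
Notation leb := (@leb R).
Implicit Types (x y v t : R).
Variables (m k : nat) (P : predictor R) (mu : {finite_measure set R -> \bar R})
  (q : R -> R -> R).
Hypotheses (knm : (k.+2 <= m)%N) (scr : screening (f1 P) (F1 P) mu q).
Hypothesis psiE : forall w, psi m k.+2 P w = \int[mu]_s \prod_(y <- w) q s y.

Local Notation n := k.+2.
Local Notation K := (winK (f1 P) mu q k.+1).
Local Notation M := (winM (f1 P) mu q k).

(* The last bracket in FP is, up to a positive factor, M x v / K x v - M x x / K x x. *)
Lemma FP_condition_compare :
  (forall x v, x \in `]0, 1] -> v \in `[0, 1] ->
    (x <= v -> M x x * K x v <= M x v * K x x) /\
    (v <= x -> M x v * K x x <= M x x * K x v)) ->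
  FP_condition m n P.
Proof.
move=> cmp.
have h_ge0 x v : x \in `[0, 1] -> v \in `[0, 1] -> 0 <= h m n P x v.
  move=> x01 v01; rewrite (h_E knm scr psiE x01 v01).
  have K1 : 0 <= K 1 v by apply: (winK_ge0 scr); rewrite in_itv/= ler01 lexx.
  rewrite mulr_ge0 ?invr_ge0//; rewrite mulr_ge0//; last exact: (winM_ge0 scr).
  by rewrite mulr_ge0// ltW// (scr_f_gt0 scr).
have FP0 v : v \in `[0, 1] -> FP m n P 0 v = h m n P 0 v * v.
  by move=> v01; rewrite /FP (H0 knm scr psiE v01) mul0r mul0r addr0 subr0.
have L_ge0 x : 0 <= \int[lebesgue_measure]_(t in `[0, x]) L m n P t x.
  by apply: Rintegral_ge0 => t _; rewrite fine_ge0// expeR_ge0.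
have main x v : x \in `]0, 1] -> v \in `[0, 1] ->
    (x <= v -> 0 <= FP m n P x v) /\ (v <= x -> FP m n P x v <= 0).
  move=> x01' v01; have x01 := in01_oc x01'.
  have hxv := h_ge0 _ _ x01 v01; have Hxv := H_ge0 knm scr psiE x01 v01.
  have Kxx : 0 < K x x by exact: (winK_gt0 scr).
  have f0 := scr_f_gt0 scr x01.
  have Ix := L_ge0 x; move: Ix; set I := (X in 0 <= X) => Ix.
  have -> : FP m n P x v = h m n P x v * (v - x) +
    H m n P x v * I * (h m n P x v / H m n P x v - RHR m n P x) by exact: erefl.
  (* H(x | v) can vanish only for v = 0, and then the bracket term of FP is 0. Otherwise K 1 v and K
     x v are nonzero and the quotients can be compared. *)
  have [Hz|Hnz] := eqVneq (H m n P x v) 0.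
    rewrite Hz !mul0r addr0; split => xv; first by rewrite mulr_ge0// subr_ge0.
    by rewrite mulr_ge0_le0// subr_le0.
  have quot (y z : R) : 0 <= y -> y / z != 0 -> z != 0 /\ 0 < y.
    by move=> y0; rewrite mulf_eq0 invr_eq0 negb_or lt_neqAle y0 eq_sym => /andP[-> ->].
  have [K1 Kxv0] : K 1 v != 0 /\ 0 < K x v.
    apply: quot; first exact: (winK_ge0 scr).
    by move: Hnz; rewrite (H_E knm scr psiE x01 v01).
  have Kxv := lt0r_neq0 Kxv0.
  have alg (a b c d e : R) : c != 0 -> d != 0 -> a * b * e / c / (d / c) = a * b * (e / d).
    by move=> c0 d0; field; rewrite c0 d0.
  have alg2 (a b c d e : R) : b * (a * c / d) = a * b * (c / d) by ring.
  have -> : h m n P x v / H m n P x v - RHR m n P x =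
      k.+1%:R * f1 P x * (M x v / K x v - M x x / K x x).
    rewrite (RHR_E knm scr psiE x01') /hazard_factor (h_E knm scr psiE x01 v01).
    rewrite (H_E knm scr psiE x01 v01) (alg _ _ _ _ _ K1 Kxv) mulrBr.
    by congr (_ - _); exact: alg2 0.
  have kf : 0 <= k.+1%:R * f1 P x by rewrite mulr_ge0// ltW.
  have [c1 c2] := cmp x v x01' v01.
  split => xv.
    rewrite addr_ge0//; first by rewrite mulr_ge0// subr_ge0.
    rewrite mulr_ge0//; first exact: mulr_ge0.
    rewrite mulr_ge0// subr_ge0 ler_pdivlMr// mulrAC ler_pdivrMr//; exact: c1.
  rewrite -[leRHS](addr0 0); apply: lerD; first by rewrite mulr_ge0_le0// subr_le0.
  rewrite mulr_ge0_le0//; first exact: mulr_ge0.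
  rewrite mulr_ge0_le0// subr_le0 ler_pdivrMr// mulrAC ler_pdivlMr//; exact: c2.
move=> v v01; move: (v01); rewrite in_itv/= => /andP[v0 v1].
split=> x; rewrite in_itv/= => /andP[x0 xv].
  have [x0'|x0'] := ltP 0 x.
    by apply: (main x v _ v01).1 => //; rewrite in_itv/= x0' (le_trans xv).
  have -> : x = 0 by apply/eqP; rewrite eq_le x0 x0'.
  by rewrite FP0// mulr_ge0// h_ge0// in_itv/= lexx ler01.
have [x0'|x0'] := ltP 0 x.
  by apply: (main x v _ v01).2 => //; rewrite in_itv/= x0'.
have xE : x = 0 by apply/eqP; rewrite eq_le x0' (le_trans v0).
have vE : v = 0 by apply/eqP; rewrite eq_le v0 -xE x0.
by rewrite xE FP0// {2}vE mulr0.
Qed.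

Lemma RHR_power N :
  (forall x, x \in `]0, 1] -> k.+1%:R * M x x * F1 P x = N.+1%:R * K x x) ->
  forall x, x \in `]0, 1] -> RHR m n P x = N.+1%:R * f1 P x / F1 P x.
Proof.
move=> MK x x01; rewrite (RHR_E knm scr psiE x01) /hazard_factor.
have Kxx : K x x != 0 by rewrite gt_eqF// (winK_gt0 scr).
have F0 : F1 P x != 0 by rewrite gt_eqF// F1_gt0.
have alg (a b c d e : R) : b != 0 -> d != 0 -> c * d = e * b -> a * (c / b) = e * a / d.
  move=> b0 d0 E; have -> : c = e * b / d by rewrite -E mulfK.
  by field; rewrite b0 d0.
exact: alg Kxx F0 (MK x x01).
Qed.

Lemma RHR_power_regular N :
  (forall x, x \in `]0, 1] -> RHR m n P x = N.+1%:R * f1 P x / F1 P x) ->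
  RHR_regular_at0 m n P.
Proof.
move=> RP; exists (N.+1%:R%:E); apply: cvg_near_cst.
near=> x; have x01 : x \in `]0, 1].
  by rewrite in_itv/=; apply/andP; split; near: x; [exact: nbhs_right_gt|exact: nbhs_right_le].
have F0 : F1 P x != 0 by rewrite gt_eqF// F1_gt0.
have f0 : f1 P x != 0 by rewrite gt_eqF// f1_gt0// in01_oc.
by rewrite RP//; congr EFin; field; rewrite F0 f0.
Unshelve. all: by end_near. Qed.

(** The common conclusion of the special cases: ordered ratios M / K yield the FP condition, and
    proportionality of F1 * M and K on the diagonal yields RHR, with it the regularity at 0 and the
    closed form. *)
Lemma power_equilibrium N :
  (forall x v, x \in `]0, 1] -> v \in `[0, 1] ->
    (x <= v -> M x x * K x v <= M x v * K x x) /\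
    (v <= x -> M x v * K x x <= M x x * K x v)) ->
  (forall x, x \in `]0, 1] -> k.+1%:R * M x x * F1 P x = N.+1%:R * K x x) ->
  [/\ FP_condition m n P, SSM m n P (sigmaFP m n P) &
    forall v, v \in `[0, 1] -> sigmaFP m n P v =
      v - \int[@lebesgue_measure R]_(x in `[0, v]) (F1 P x ^+ N.+1 / F1 P v ^+ N.+1)].
Proof.
move=> cmp pw; have FPc := FP_condition_compare cmp; have RP := RHR_power pw.
split => //; first exact: (FP_SSM knm scr psiE FPc (RHR_power_regular RP)).
by move=> v v01; rewrite (sigmaFP_power knm scr psiE RP v01) leb_RintegralE.
Qed.

End auction_comparison.

Lemma ae_le_Rintegral d (T : measurableType d) (R : realType)
    (mu : {finite_measure set T -> \bar R}) (f g : T -> R) (C : R) :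
  measurable_fun setT f -> measurable_fun setT g ->
  (forall s, 0 <= f s <= C) -> (forall s, 0 <= g s <= C) ->
  {ae mu, forall s, f s <= g s} -> \int[mu]_s f s <= \int[mu]_s g s.
Proof.
move=> mf mg f0C g0C fg.
have int (p : T -> R) : measurable_fun setT p -> (forall s, 0 <= p s <= C) ->
    mu.-integrable setT (EFin \o p).
  move=> mp p0C; apply: (@bounded_integrable _ _ _ mu _ C) => // s.
  by case/andP: (p0C s) => ? ?; rewrite ger0_norm.
apply: fine_le; try by apply: integrable_fin_num => //; exact: int.
apply: ae_ge0_le_integral => //.
- by move=> s _; rewrite lee_fin; case/andP: (f0C s).
- exact/measurable_EFinP.
- by move=> s _; rewrite lee_fin; case/andP: (g0C s).
- exact/measurable_EFinP.
- by apply: filterS fg => s h _; rewrite lee_fin.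
Qed.

(** * Screenings with independent signals and with a threshold *)

Section screening_special.
Context {R : realType}.
Implicit Types (x y v s : R).
Variables (f F : R -> R) (mu : {finite_measure set R -> \bar R}) (q : R -> R -> R).
Hypothesis scr : screening f F mu q.

Local Notation G := (tailprim f q).
Local Notation K := (winK f mu q).
Local Notation M := (winM f mu q).

Let le1 x : x \in `[0, 1] -> x <= 1. Proof. by rewrite in_itv/= => /andP[]. Qed.

(** Reads off the pointwise value q s x from G, as G' = q * f with f > 0. *)
Lemma tailprim_deriv_unique s x (l : R) : x \in `[0, 1] ->
  q s y @[y --> punct01 x] --> q s x -> is_deriv01 (G s) x (l * f x) -> q s x = l.
Proof.
move=> x01 qs Gl; have := is_deriv01_unique x01 (tailprim_deriv scr x01 qs) Gl.
by apply: mulIf; rewrite gt_eqF// (scr_f_gt0 scr).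
Qed.

Lemma eq_winK a x v w : x \in `[0, 1] ->
  {ae mu, forall s, q s v * G s x ^+ a = q s w * G s x ^+ a} -> K a x v = K a x w.
Proof.
by move=> x01 E; apply: ae_eq_Rintegral => //; apply: (measurable_qG scr); exact: le1.
Qed.

Lemma eq_winM a x v w : x \in `[0, 1] ->
  {ae mu, forall s, q s v * (q s x * G s x ^+ a) = q s w * (q s x * G s x ^+ a)} ->
  M a x v = M a x w.
Proof.
by move=> x01 E; apply: ae_eq_Rintegral => //; apply: (measurable_qqG scr); exact: le1.
Qed.

Section independent_screening.
Hypothesis G_prop : forall x, x \in `[0, 1] -> {ae mu, forall s, G s x = q s x * F x}.
Hypothesis q_cst : forall x v, x \in `[0, 1] -> v \in `[0, 1] ->
  {ae mu, forall s, q s v = q s x}.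

Lemma independent_compare a x v : x \in `[0, 1] -> v \in `[0, 1] ->
  M a x v * K a.+1 x x = M a x x * K a.+1 x v.
Proof.
move=> x01 v01; rewrite (@eq_winM a x v x)// ?(@eq_winK a.+1 x v x)//.
  by apply: filterS (q_cst x01 v01) => s ->.
by apply: filterS (q_cst x01 v01) => s ->.
Qed.

(** Replacing one factor G of K by q * F leaves F * M. *)
Lemma independent_power a x : x \in `[0, 1] ->
  a.+1%:R * M a x x * F x = a.+1%:R * K a.+1 x x.
Proof.
move=> x01; rewrite -mulrA; congr (_ * _).
have mM := measurable_qqG scr a (x := x) x x (le1 x01).
have iM : mu.-integrable setT (EFin \o (fun s => q s x * (q s x * G s x ^+ a))).
  by apply: integrable01 => // s; exact: (qqG_01 scr).
rewrite /winM mulrC -RintegralZl//; apply: ae_eq_Rintegral.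
- by apply: measurable_funM.
- by apply: (measurable_qG scr); exact: le1.
- by apply: filterS (G_prop x01) => s Gs; rewrite exprS {2}Gs; ring.
Qed.

End independent_screening.

Section threshold_screening.
Variables (u : R -> R) (b : nat).
Hypothesis qE : forall x, x \in `[0, 1] -> {ae mu, forall s, q s x = (u s < F x)%R%:R}.
Hypothesis GE : forall x, x \in `[0, 1] -> {ae mu, forall s, G s x = q s x * (F x - u s)}.
Hypothesis int_q : forall x, x \in `[0, 1] -> \int[mu]_s q s x = F x ^+ b.

Let one01 : (1 : R) \in `[0, 1]. Proof. by rewrite in_itv/= ler01 lexx. Qed.

Let fF := scr_density scr.

(** A cutoff that admits x admits every v >= x, so q s v * q s x = q s x. *)
Lemma threshold_M a x v : x \in `[0, 1] -> v \in `[0, 1] -> x <= v -> M a x v = K a x x.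
Proof.
move=> x01 v01 xv; apply: ae_eq_Rintegral.
- by apply: (measurable_qqG scr); exact: le1.
- by apply: (measurable_qG scr); exact: le1.
apply: filterS2 (qE x01) (qE v01) => s -> ->.
have [us|us] := ltP (u s) (F x); rewrite ?mul0r ?mulr0//.
rewrite (lt_le_trans us) ?mul1r//.
by move: x01 v01; rewrite !in_itv/= => /andP[x0 _] /andP[_ v1]; exact: (density_nondecreasing fF).
Qed.

(** Where x is rejected the tail G s x is 0, so the positive power of G hides the difference between
    q s v and q s x. *)
Lemma threshold_K a x v : x \in `[0, 1] -> v \in `[0, 1] -> x <= v -> K a.+1 x v = K a.+1 x x.
Proof.
move=> x01 v01 xv; apply: eq_winK => //.
apply: filterS3 (qE x01) (qE v01) (GE x01) => s qx qv Gs; rewrite Gs qx qv.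
have [us|us] := ltP (u s) (F x); last by rewrite mul0r expr0n/= !mulr0.
rewrite (lt_le_trans us)//.
by move: x01 v01; rewrite !in_itv/= => /andP[x0 _] /andP[_ v1]; exact: (density_nondecreasing fF).
Qed.

(* K (a + 1) x x = K (a + 1) x 1, whose derivative is (a + 1) f x * K a x x. *)
Lemma threshold_step a c : (forall x, x \in `[0, 1] -> K a x x = c * F x ^+ (a + b)) ->
  forall x, x \in `[0, 1] -> K a.+1 x x = a.+1%:R * c / (a + b).+1%:R * F x ^+ (a + b).+1.
Proof.
move=> Ka x x01; move: (x01); rewrite in_itv/= => /andP[x0 x1].
rewrite -(@threshold_K a x 1)//; apply/eqP; rewrite -subr_eq0; apply/eqP.
set c' := a.+1%:R * c / (a + b).+1%:R.
pose Z y := K a.+1 y 1 - c' * F y ^+ (a + b).+1.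
have Zd y : y \in `[0, 1] -> is_deriv01 Z y 0.
  move=> y01; have := is_deriv01B (@winK_deriv _ f F mu q scr a y 1 y01)
    (is_deriv01Z (c := c') (is_deriv01X (n := a + b) (density_deriv fF y01))).
  rewrite threshold_M//; last exact: le1.
  rewrite Ka// (_ : _ - _ = 0)// /c'.
  have N0 : (a + b).+1%:R != 0 :> R by rewrite pnatr_eq0.
  by field.
have sub y : y \in `[0, x] -> y \in `[0, 1].
  by rewrite !in_itv/= => /andP[-> yx]; rewrite (le_trans yx).
transitivity (Z 0); last first.
  by rewrite /Z (winK0 scr) (density_F0 fF) expr0n/= mulr0 subrr.
rewrite -/(Z x); apply/esym; apply: (@deriv01_cst _ Z 0 x) => //.
  by move=> y; rewrite in_itv/= => /andP[y0 yx]; apply: Zd; apply: sub; rewrite in_itv/= !ltW.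
by move=> y /sub y01; exact: is_deriv01_cvg (Zd y y01).
Qed.

(** The base case is [int_q], the probability that x clears the cutoff. The constant is left
    implicit because only ratios matter. *)
Lemma threshold_winK a :
  exists c, forall x, x \in `[0, 1] -> K a x x = c * F x ^+ (a + b).
Proof.
elim: a => [|a [c IH]].
  exists 1 => x x01; rewrite add0n mul1r -int_q// /winK.
  by under eq_Rintegral do rewrite expr0 mulr1.
by eexists => x x01; rewrite (threshold_step IH x01) addSn.
Qed.

Lemma threshold_power a x : x \in `[0, 1] ->
  a.+1%:R * M a x x * F x = (a + b).+1%:R * K a.+1 x x.
Proof.
move=> x01; have [c Kc] := threshold_winK a.
rewrite threshold_M// (threshold_step Kc x01) Kc// exprS.
have N0 : (a + b).+1%:R != 0 :> R by rewrite pnatr_eq0.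
by field.
Qed.

(* On {u < F v} the tail G is at least F x - F v, elsewhere it is at most that. *)
Lemma threshold_compare a x v : x \in `[0, 1] -> v \in `[0, 1] ->
  (x <= v -> M a x x * K a.+1 x v <= M a x v * K a.+1 x x) /\
  (v <= x -> M a x v * K a.+1 x x <= M a x x * K a.+1 x v).
Proof.
move=> x01 v01; split=> xv.
  by rewrite (threshold_K _ x01 v01 xv) !(threshold_M _ x01 _)//.
have Fvx : F v <= F x.
  by move: x01 v01; rewrite !in_itv/= => /andP[_ x1] /andP[v0 _]; exact: (density_nondecreasing fF).
set c := F x - F v; have c0 : 0 <= c by rewrite subr_ge0.
have mK w : measurable_fun setT (fun s => q s w * G s x ^+ a.+1).
  by apply: (measurable_qG scr); exact: le1.
have mM w : measurable_fun setT (fun s => q s w * (q s x * G s x ^+ a)).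
  by apply: (measurable_qqG scr); exact: le1.
have K01 s w := qG_01 scr a.+1 s w x01.
have M01 s w := qqG_01 scr a s w x x01.
have iK w := integrable01 mu (mK w) (fun s => K01 s w).
have iM w := integrable01 mu (mM w) (fun s => M01 s w).
have Mv_le : M a x v <= M a x x.
  apply: (@ae_le_Rintegral _ _ _ mu _ _ 1) => //.
  apply: filterS2 (qE x01) (qE v01) => s qx qv.
  case/andP: (qG_01 scr a s x x01) => qG0 _.
  rewrite ler_wpM2r// qx qv ler_nat; case: (ltP (u s) (F v)) => //= us.
  by rewrite (lt_le_trans us).
have le1K : c * M a x v <= K a.+1 x v.
  rewrite -RintegralZl//; apply: (@ae_le_Rintegral _ _ _ mu _ _ (c + 1)).
  - exact: measurable_funM.
  - exact: mK.
  - move=> s; case/andP: (M01 s v) => M0 M1; rewrite mulr_ge0//=.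
    by rewrite (le_trans (ler_piMr _ M1))// lerDl.
  - by move=> s; case/andP: (K01 s v) => K0 K1; rewrite K0 (le_trans K1)// lerDr.
  apply: filterS3 (qE x01) (qE v01) (GE x01) => s qx qv Gs.
  rewrite qv; have [us|us] := ltP (u s) (F v); last by rewrite !mul0r mulr0.
  have usx : u s < F x by rewrite (lt_le_trans us).
  rewrite !mul1r qx usx mul1r exprS ler_wpM2r//.
    by rewrite exprn_ge0//; case/andP: (tailprim_01 scr s x01).
  by rewrite Gs qx usx mul1r lerB// ltW.
have le2K : K a.+1 x x + c * M a x v <= K a.+1 x v + c * M a x x.
  have icM w : mu.-integrable setT (EFin \o (fun s => c * (q s w * (q s x * G s x ^+ a)))).
    exact: (integrableZl measurableT c (iM w)).
  have b01 (y z : R) : 0 <= y <= 1 -> 0 <= z <= 1 -> 0 <= y + c * z <= 1 + c.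
    move=> /andP[y0 y1] /andP[z0 z1]; rewrite addr_ge0 ?mulr_ge0//= lerD//.
    by rewrite ler_piMr.
  rewrite -!RintegralZl// -!RintegralD//.
  apply: (@ae_le_Rintegral _ _ _ mu _ _ (1 + c)).
  - by apply: measurable_funD => //; exact: measurable_funM.
  - by apply: measurable_funD => //; exact: measurable_funM.
  - by move=> s; exact: b01.
  - by move=> s; exact: b01.
  apply: filterS3 (qE x01) (qE v01) (GE x01) => s qx qv Gs.
  have [us|us] := ltP (u s) (F v).
    by rewrite qv qx us (lt_le_trans us).
  have Gc : q s x * G s x <= q s x * c.
    by case/andP: (scr_01 scr s x) => qx0 _; rewrite Gs qx; case: (u s < F x); rewrite ?mul0r// !mul1r lerB.
  have qq : q s x * q s x = q s x by rewrite qx; case: (u s < F x); rewrite ?mul0r ?mulr1.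
  rewrite qv ltNge us /= !mul0r mulr0 addr0 add0r.
  have -> : c * (q s x * (q s x * G s x ^+ a)) = q s x * q s x * c * G s x ^+ a by ring.
  rewrite qq exprS mulrA ler_wpM2r// exprn_ge0//.
  by case/andP: (tailprim_01 scr s x01).
have Mv0 := winM_ge0 scr a v x01.
(* Writing Mv, Mx, Kv, Kx: Mv Kx <= Mv Kv + c Mv (Mx - Mv) <= Mv Kv + Kv (Mx - Mv) = Mx Kv. *)
nra.
Qed.

End threshold_screening.

End screening_special.

(** * Null and perfect predictors as screenings *)

Section predictor_special.
Context {R : realType}.
Implicit Types (x y v s : R).
Variable P : predictor R.

Let q s y := 1 - F21 P s y.

Lemma F2_onto (X : R) : 0 <= X <= 1 -> exists2 t, t \in `[0, 1] & F2 P t = X.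
Proof.
move=> X01; apply: IVT => //; last by rewrite F2_le0// F2_1 min_l// max_r.
by apply: continuous_subspaceT => x; exact: F2_continuous.
Qed.

(** The quantile t of F1 x turns the comparison of F2 s with F1 x into one of s with t. The
    exceptional points 0, 1 and t are null since the cutoff law has no atoms. *)
Lemma F2_level x k : x \in `[0, 1] ->
  exists t, [/\ t \in `[0, 1], F2 P t = F1 P x &
    {ae cutoff P k, forall s, [/\ s \in `]0, 1[, s != t & (F2 P s < F1 P x) = (s < t)]}].
Proof.
move=> x01; have [t t01 Ft] : exists2 t, t \in `[0, 1] & F2 P t = F1 P x.
  apply: F2_onto; move: x01; rewrite in_itv/= => /andP[x0 x1].
  rewrite -{1}(density_F0 (density01_f1 P)) -(F1_1 P).
  by rewrite !(density_nondecreasing (density01_f1 P)).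
exists t; split => //.
have ne z : {ae cutoff P k, forall s, s != z}.
  exists [set z]; split => //; first exact: cutoff_atom.
  by move=> s /= /negP; rewrite negbK => /eqP.
have tsupp : {ae cutoff P k, forall s, s != t /\ s \in `[0, 1]}.
  by apply: filterS2 (ne t) (cutoff_support P k) => s.
apply: filterS3 (ne 0) (ne 1) tsupp => s s0 s1 [st]; rewrite -Ft in_itv/= => /andP[s0' s1'].
move: (t01); rewrite in_itv/= => /andP[t0 t1].
split => //; first by rewrite in_itv/= !lt_neqAle s0' s1' s1 eq_sym s0.
have [st'|ts] := ltP s t; first by rewrite F2_increasing.
by apply/negbTE; rewrite -leNgt F2_nondecreasing.
Qed.

Section screened.
Variable k : nat.
Hypotheses (k_gt0 : (0 < k)%N) (regP : regular P).

Let scr : screening (f1 P) (F1 P) (cutoff P k) q := screening_cutoff k_gt0 regP.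

Local Notation G := (tailprim (f1 P) q).

Let GE s x : x \in `[0, 1] -> G s x = F1 P x - F12 P x s.
Proof. exact: mixprim_F21. Qed.

(** Here G s y = (1 - F2 s) F1 y for all y, which is differentiated at x. *)
Lemma null_q x : null_predictor P -> x \in `[0, 1] ->
  {ae cutoff P k, forall s, q s x = 1 - F2 P s}.
Proof.
move=> nullP x01; apply: filterS2 (scr_cont scr x01) (cutoff_support P k) => s qs s01.
apply: (tailprim_deriv_unique scr x01 qs).
apply: (@eq_is_deriv01 _ _ (fun y => (1 - F2 P s) * F1 P y)) => //.
  by move=> y y01; rewrite GE// nullP//; ring.
by apply: is_deriv01Z; exact: f1_deriv.
Qed.

Lemma null_G x : null_predictor P -> x \in `[0, 1] ->
  {ae cutoff P k, forall s, G s x = q s x * F1 P x}.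
Proof.
move=> nullP x01; apply: filterS2 (null_q nullP x01) (cutoff_support P k) => s -> s01.
by rewrite GE// nullP//; ring.
Qed.

(** Here G s y = F1 y - min (F1 y) (F2 s). Near x this is F1 y - F2 s or 0, according to the sign of
    F1 x - F2 s; the kink F2 s = F1 x concerns a single s and is discarded. *)
Lemma perfect_q x : perfect_predictor P -> x \in `[0, 1] ->
  {ae cutoff P k, forall s, q s x = (F2 P s < F1 P x)%R%:R}.
Proof.
move=> perfP x01; have [t [t01 Ft lt_t]] := F2_level k x01.
apply: filterS2 (scr_cont scr x01) lt_t => s qs [s01 st Fs].
have s01' : s \in `[0, 1] by move: s01; rewrite !in_itv/= => /andP[/ltW-> /ltW->].
have Fsx : F2 P s != F1 P x.
  have [s_lt|t_le] := ltP s t; first by rewrite lt_eqF// Fs.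
  rewrite gt_eqF// -Ft F2_increasing//; last by move: s01'; rewrite in_itv/= => /andP[].
    by move: t01; rewrite in_itv/= => /andP[].
  by rewrite lt_neqAle eq_sym st.
apply: (tailprim_deriv_unique scr x01 qs).
have dF := density_deriv (density01_f1 P) x01; have cF := is_deriv01_cvg dF.
have [e /= e0 he] := (cvgrPdist_lt _ _).1 cF `|F1 P x - F2 P s| ltac:(by rewrite normr_gt0 subr_eq0 eq_sym).
have close y : y \in `[0, 1] -> `|y - x| < e -> `|F1 P x - F1 P y| < `|F1 P x - F2 P s|.
  move=> y01 yx; have [->|yx'] := eqVneq y x.
    by rewrite subrr normr0 normr_gt0 subr_eq0 eq_sym.
  by apply: he => //=; rewrite distrC.
have [s_lt|x_le] := ltP (F2 P s) (F1 P x).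
  rewrite mul1r; apply: (@near_eq_is_deriv01 _ _ (fun y => F1 P y - F2 P s) _ _ _ e0).
  - by rewrite GE// perfP// min_r// ltW.
  - move=> y y01 /(close y y01); rewrite (gtr0_norm (_ : 0 < F1 P x - F2 P s)) ?subr_gt0// ltr_norml => /andP[_ h].
    by rewrite GE// perfP// min_r//; lra.
  by rewrite -[X in is_deriv01 _ _ X]subr0; apply: is_deriv01B => //; exact: is_deriv01_cst.
have x_lt : F1 P x < F2 P s by rewrite lt_neqAle eq_sym Fsx.
rewrite mul0r; apply: (@near_eq_is_deriv01 _ _ (fun=> 0) _ _ _ e0); last exact: is_deriv01_cst.
  by rewrite GE// perfP// min_l// subrr.
move=> y y01 /(close y y01); rewrite (ltr0_norm (_ : F1 P x - F2 P s < 0)) ?subr_lt0// ltr_norml => /andP[h _].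
by rewrite GE// perfP// min_l ?subrr//; lra.
Qed.

Lemma perfect_G x : perfect_predictor P -> x \in `[0, 1] ->
  {ae cutoff P k, forall s, G s x = q s x * (F1 P x - F2 P s)}.
Proof.
move=> perfP x01; apply: filterS2 (perfect_q perfP x01) (cutoff_support P k) => s -> s01.
rewrite GE// perfP//; have [s_lt|x_le] := ltP (F2 P s) (F1 P x).
  by rewrite mul1r.
by rewrite mul0r subrr.
Qed.

(** Almost surely q s x is the indicator of ]0, t] with F2 t = F1 x, and this interval has mass F2 t
    ^ k. *)
Lemma perfect_int x : perfect_predictor P -> x \in `[0, 1] ->
  \int[cutoff P k]_s q s x = F1 P x ^+ k.
Proof.
move=> perfP x01; have [t [t01 Ft lt_t]] := F2_level k x01.
move: t01; rewrite in_itv/= => /andP[t0 t1].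
transitivity (\int[cutoff P k]_s (\1_(`]0, t]%classic) s : R)).
  apply: ae_eq_Rintegral; first exact: (measurable_mix (scr_measurable scr)).
    exact: measurable_indic.
  apply: filterS2 (perfect_q perfP x01) lt_t => s -> [s01 st ->].
  rewrite indicE mem_setE in_itv/=; congr (nat_of_bool _)%:R.
  by move: s01; rewrite in_itv/= => /andP[-> _]; rewrite le_eqVlt (negbTE st).
rewrite /Rintegral integral_indic// setIT [X in fine X](@cutoff_itv _ P k 0 t (lexx 0) t0 t1) /=.
by rewrite (F2_le0 P (lexx 0)) expr0n gtn_eqF// subr0 Ft.
Qed.

End screened.

End predictor_special.

(** * Equilibria in the special cases and the final theorem *)

Section equilibria.
Context {R : realType}.
Implicit Types (P Q : predictor R) (x v : R).

Lemma screening_exists m k P : (k.+2 <= m)%N -> ((k.+2 < m)%N -> regular P) ->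
  exists (mu : {finite_measure set R -> \bar R}) (q : R -> R -> R),
    screening (f1 P) (F1 P) mu q /\
    forall w, psi m k.+2 P w = \int[mu]_s \prod_(y <- w) q s y.
Proof.
rewrite leq_eqVlt => /orP[/eqP <- _|km /(_ km) regP].
  by exists (dirac (0 : R)), (fun _ _ => 1); split; [exact: screening_all|exact: psi_all].
have k_gt0 : (0 < m - k.+2)%N by rewrite subn_gt0.
exists (cutoff P (m - k.+2)), (fun s y => 1 - F21 P s y); split.
  exact: screening_cutoff.
by move=> w; exact: psi_cutoff.
Qed.

Lemma all_admitted_equilibrium k P :
  [/\ FP_condition k.+2 k.+2 P, SSM k.+2 k.+2 P (sigmaFP k.+2 k.+2 P) &
    forall v, v \in `[0, 1] -> sigmaFP k.+2 k.+2 P v =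
      v - \int[@lebesgue_measure R]_(x in `[0, v]) (F1 P x ^+ k.+1 / F1 P v ^+ k.+1)].
Proof.
have scr := screening_all P.
pose mu : {finite_measure set R -> \bar R} := dirac (0 : R).
have Gp x : x \in `[0, 1] ->
    {ae mu, forall s, tailprim (f1 P) (fun _ _ => (1 : R)) s x = 1 * F1 P x}.
  move=> x01; apply: aeW => s; rewrite mul1r F1_integral// /tailprim /mixprim.
  by apply: eq_Rintegral => y _; rewrite mul1r.
have qc x v : x \in `[0, 1] -> v \in `[0, 1] -> {ae mu, forall s : R, (1 : R) = 1}.
  by move=> _ _; exact: aeW.
apply: (power_equilibrium (leqnn _) scr (psi_all P _)).
  by move=> x v /in01_oc x01 v01; rewrite (independent_compare scr qc k x01 v01).
by move=> x /in01_oc x01; exact: (independent_power scr Gp).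
Qed.

Lemma sigmaFP_all_admitted m P Q v : (2 <= m)%N ->
  (forall x, x \in `[0, 1] -> F1 Q x = F1 P x) -> v \in `[0, 1] ->
  sigmaFP m m Q v =
    v - \int[@lebesgue_measure R]_(x in `[0, v]) (F1 P x ^+ m.-1 / F1 P v ^+ m.-1).
Proof.
case: m => [//|[//|k]] _ QP v01; have [_ _ sQ] := all_admitted_equilibrium k Q.
rewrite (sQ _ v01) (QP _ v01); congr (_ - _); apply: eq_Rintegral => x.
rewrite inE /= => xv; rewrite QP//.
by move: xv v01; rewrite !in_itv/= => /andP[-> xv] /andP[_ v1]; rewrite (le_trans xv).
Qed.

Lemma null_equilibrium m k P : (k.+2 < m)%N -> regular P -> null_predictor P ->
  FP_condition m k.+2 P /\ SSM m k.+2 P (sigmaFP m k.+2 P).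
Proof.
move=> km regP nullP; have k_gt0 : (0 < m - k.+2)%N by rewrite subn_gt0.
have scr := screening_cutoff k_gt0 regP.
have Gp x := @null_G _ P _ k_gt0 regP x nullP.
have qc x v : x \in `[0, 1] -> v \in `[0, 1] ->
    {ae cutoff P (m - k.+2), forall s, 1 - F21 P s v = 1 - F21 P s x}.
  move=> x01 v01; apply: filterS2 (null_q k_gt0 regP nullP x01) (null_q k_gt0 regP nullP v01).
  by move=> s -> ->.
have [] := power_equilibrium (N := k) (ltnW km) scr (fun w => psi_cutoff P w km erefl); last by [].
  by move=> x v /in01_oc x01 v01; rewrite (independent_compare scr qc k x01 v01).
by move=> x /in01_oc x01; exact: (independent_power scr Gp).
Qed.

Lemma perfect_equilibrium m k P : (k.+2 < m)%N -> regular P -> perfect_predictor P ->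
  [/\ FP_condition m k.+2 P, SSM m k.+2 P (sigmaFP m k.+2 P) &
    forall v, v \in `[0, 1] -> sigmaFP m k.+2 P v =
      v - \int[@lebesgue_measure R]_(x in `[0, v]) (F1 P x ^+ m.-1 / F1 P v ^+ m.-1)].
Proof.
move=> km regP perfP; have k_gt0 : (0 < m - k.+2)%N by rewrite subn_gt0.
have scr := screening_cutoff k_gt0 regP.
have qE x := @perfect_q _ P _ k_gt0 regP x perfP.
have GE x := @perfect_G _ P _ k_gt0 regP x perfP.
have int_q x := @perfect_int _ P _ k_gt0 regP x perfP.
(* k of the rivals' factors come from the power of G and m - n from the cutoff law; differentiation
   supplies the last one. *)
have -> : m.-1 = (k + (m - k.+2)).+1 by lia.
apply: (power_equilibrium (ltnW km) scr (fun w => psi_cutoff P w km erefl)).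
  by move=> x v /in01_oc x01 v01; exact: (threshold_compare scr qE GE).
by move=> x /in01_oc x01; exact: (threshold_power scr qE GE int_q).
Qed.

End equilibria.

Theorem proposition2 (R : realType) (m n : nat) (P : predictor R)
    (hn : (2 <= n)%N) (hnm : (n <= m)%N) (hP : (n < m)%N -> regular P) :
  (* (i) *)
  ((FP_condition m n P ->
      exists sigma : R -> R, SSM0 m n P sigma /\
        (RHR_regular_at0 m n P -> SSM m n P sigma)) /\
   (null_predictor P \/ perfect_predictor P \/ n = m ->
      FP_condition m n P /\ exists sigma : R -> R, SSM m n P sigma)) /\
  (* (ii) *)
  (forall sigma : R -> R, SSM0 m n P sigma ->
     forall v : R, v \in `[0, 1] -> sigma v = sigmaFP m n P v) /\
  (* (iii) *)
  (perfect_predictor P ->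
     forall v : R, v \in `[0, 1] ->
       sigmaFP m n P v =
         v - \int[@lebesgue_measure R]_(x in `[0, v])
               (F1 P x ^+ m.-1 / F1 P v ^+ m.-1) /\
       forall Q : predictor R,
         (forall x : R, x \in `[0, 1] -> F1 Q x = F1 P x) ->
         sigmaFP m m Q v = sigmaFP m n P v).
Proof.
case: n hn hnm hP => [//|[//|k]] _ km regP.
have [mu [q [scr psiE]]] := screening_exists km regP.
have [km'|] := ltnP k.+2 m; last first.
  move=> mk; have {mk} mE : m = k.+2 by apply/eqP; rewrite eqn_leq mk km.
  move: km regP psiE; rewrite mE => km regP psiE.
  have [FPc SSMc sE] := all_admitted_equilibrium k P.
  split; first by split => _; [exists (sigmaFP k.+2 k.+2 P); split => //; exact: (FP_SSM0 km scr psiE)|split => //; exists (sigmaFP k.+2 k.+2 P)].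
  split; first by move=> sigma S v v01; exact: (SSM0_unique km scr psiE S v01).
  move=> _ v v01; split; first exact: sE.
  by move=> Q QP; rewrite (sigmaFP_all_admitted (P := P) _ QP v01)// sE.
have regP' := regP km'.
split; first split.
- move=> FPc; exists (sigmaFP m k.+2 P); split; first exact: (FP_SSM0 km scr psiE).
  exact: (FP_SSM km scr psiE).
- move=> [nullP|[perfP|mE]].
  + have [FPc S] := null_equilibrium km' regP' nullP.
    by split => //; exists (sigmaFP m k.+2 P).
  + have [FPc S _] := perfect_equilibrium km' regP' perfP.
    by split => //; exists (sigmaFP m k.+2 P).
  + by move: km'; rewrite mE ltnn.
split; first by move=> sigma S v v01; exact: (SSM0_unique km scr psiE S v01).
move=> perfP v v01; have [_ _ sE] := perfect_equilibrium km' regP' perfP.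
split; first exact: sE.
move=> Q QP; rewrite (sE _ v01); apply: sigmaFP_all_admitted QP v01.
exact: leq_trans (ltnW km').
Qed.
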